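(* Let $n\ge 2$ and let $w(s)=\tanh\left(\frac{s}{\sqrt2}\right)$. There exist a function $u(x,t)$ on $\mathbb{R}^n\times(-\infty,0]$, radially symmetric in $x$, solving $$u_t=\Delta u+(1-u^2)u\quad\text{in }\mathbb{R}^n\times(-\infty,0],$$ and a function $\rho(t)$ with $$\rho(t)=\sqrt{-2(n-1)t}+O(1)\quad\text{as }t\to-\infty,$$ such that $$u(x,t)=w(|x|-\rho(t))+\phi(x,t),\qquad \lim_{t\to-\infty}\phi(x,t)=0\ \text{ uniformly in }x\in\mathbb{R}^n.$$
   Context: The function $w(s)=\tanh(s/\sqrt2)$ is the heteroclinic solution of $w''+(1-w^2)w=0$ on $\mathbb{R}$ with $w(0)=0$, $w(\pm\infty)=\pm1$. *)

(* Defs.v *)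
From mathcomp Require Import all_boot all_order all_algebra.
From mathcomp Require Import all_classical all_reals all_analysis.

Set Implicit Arguments.
Unset Strict Implicit.
Unset Printing Implicit Defensive.

Import Order.TTheory GRing.Theory Num.Theory.
Import numFieldNormedType.Exports.

Local Open Scope classical_set_scope.
Local Open Scope ring_scope.

(* The library norm on ['rV[R]_n] is the sup norm (it induces the same
   topology), so the Euclidean norm |x| is introduced separately. *)
Definition enorm (R : realType) (n : nat) (x : 'rV[R]_n) : R :=
  Num.sqrt (\sum_i x ord0 i ^+ 2).

Definition tanh (R : realType) (s : R) : R :=
  (expR s - expR (- s)) / (expR s + expR (- s)).

Definition heteroclinic (R : realType) (s : R) : R := tanh (s / Num.sqrt 2).

Section Parabolic.
Variables (R : realType) (n : nat).
Implicit Types (u : 'rV[R]_n -> R -> R) (x : 'rV[R]_n) (t : R) (i j : 'I_n).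

Definition dx i (f : 'rV[R]_n -> R) x : R := 'D_(delta_mx ord0 i) f x.

Definition dx_derivable i (f : 'rV[R]_n -> R) x : Prop :=
  derivable f x (delta_mx ord0 i).

Definition laplacian (f : 'rV[R]_n -> R) x : R := \sum_i dx i (dx i f) x.

(* Time increments are restricted to t + h <= 0: the derivative is the
   two-sided one for t < 0 and the left derivative at the final time t = 0. *)
Definition past_incr t : set_system R := within [set h | t + h <= 0] 0^'.

Definition dt_quotient u x t (h : R) : R := h^-1 * (u x (t + h) - u x t).

Definition dt u x t : R := lim (dt_quotient u x t @ past_incr t).

Definition dt_derivable u x t : Prop := cvg (dt_quotient u x t @ past_incr t).

Definition ancient_continuous (g : 'rV[R]_n -> R -> R) : Prop :=
  {within [set p : 'rV[R]_n * R | p.2 <= 0],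
    continuous (fun p : 'rV[R]_n * R => g p.1 p.2)}.

(* Class C^{2,1}: u, its first time derivative and its space derivatives up to
   order two exist and are jointly continuous on R^n x (-oo, 0]. *)
Definition ancient_C21 u : Prop :=
  [/\ ancient_continuous u,
      (forall x t, t <= 0 -> dt_derivable u x t) /\ ancient_continuous (dt u),
      forall i,
        (forall x t, t <= 0 -> dx_derivable i (u ^~ t) x) /\
        ancient_continuous (fun x t => dx i (u ^~ t) x) &
      forall i j,
        (forall x t, t <= 0 -> dx_derivable j (dx i (u ^~ t)) x) /\
        ancient_continuous (fun x t => dx j (dx i (u ^~ t)) x)].

Definition ancient_allen_cahn u : Prop :=
  ancient_C21 u /\
  forall x t, t <= 0 ->
    dt u x t = laplacian (u ^~ t) x + (1 - u x t ^+ 2) * u x t.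

Definition radially_symmetric (f : 'rV[R]_n -> R) : Prop :=
  forall x y, enorm x = enorm y -> f x = f y.

End Parabolic.

(* Main.v *)
(* Sub- and supersolutions.  Put a = n - 1 and let rhat be a smoothed |x|.  For each
   sign, consider
     U = w(s) + (a / rho^2) (psi(s) + chi(s) / rho) +- A / rho^4,   s = rhat - rho(t),
   where - rho' = a / rho + a b / rho^3 +- d and d is of order rho^-4.  Two decaying
   profiles psi, chi, solving the equation linearized at w, cancel the residual of U
   up to order rho^-4; since 3 sqrt 2 w' + 3 w^2 - 1 = 2 > 0, large A and d give the
   remainder a sign.  The two choices of sign yield a supersolution above a
   subsolution, both uniformly O(1 / rho) close to w(|x| - rho).
   In between, a solution is the decreasing limit of the iteration
   u := (d_t - Laplacian + 11)^-1 (12 u - u^3) started at the supersolution, 12 u - u^3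
   being nondecreasing on [-2, 2].  The inverse is an explicit Gaussian average, which
   commutes with derivatives and rotations and gains one space derivative by
   integration by parts; hence uniform bounds and a C^{2,1} radial limit. *)
Require Import Defs.
From mathcomp Require Import all_boot all_order all_algebra.
From mathcomp Require Import all_classical all_reals all_analysis.
From mathcomp Require Import measurable_realfun ring lra.

Set Implicit Arguments.
Unset Strict Implicit.
Unset Printing Implicit Defensive.

Import Order.TTheory GRing.Theory Num.Theory.
Import numFieldNormedType.Exports.

Local Open Scope classical_set_scope.
Local Open Scope ring_scope.

(** * Calculus *)

Section calculus.
Variable R : realType.
Local Notation mu := (@lebesgue_measure R).

(** No initial value problem is solved and no compactness theorem is used. The inverse of d_t -
    Laplacian + 11 acts on bounded functions on all of space-time and looks only at earlier times,
    so inequalities known for t <= 0 suffice, and pointwise monotone limits pass through its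
    integral formula by dominated convergence. The numbers 11 and 12 suit the range [-2, 2]: there
    12 u - u^3 is nondecreasing and bounded by 16, and 16 / 11 < 2. The residual is pushed down to
    order rho^-4 for the sake of the ordering of the barriers. A speed correction of order rho^-4
    changes rho^2 by O(rho^-1), hence rho by O(rho^-2); the corrections of size rho^-2 in the
    profile are then displaced by O(rho^-4), which the terms A / rho^4 absorb. The supersolution has
    the smaller radius, so the displacement of w itself goes the right way. The number b is forced
    by the solvability of the equation for chi; it puts a logarithm into rho^2, which stays bounded
    in rho. *)

Lemma is_derive_continuous (f : R -> R) (x d : R) :
  is_derive x 1 f d -> {for x, continuous f}.
Proof.
by move=> fd; apply/differentiable_continuous/derivable1_diffP.
Qed.

(** No order between a and b is assumed and the intermediate point is written a + t (b - a), so one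
    form serves for increments of either sign. *)
Lemma mvt_global (f df : R -> R) : (forall x : R, is_derive x 1 f (df x)) ->
  forall a b, exists2 t, 0 <= t <= 1 & f b - f a = df (a + t * (b - a)) * (b - a).
Proof.
move=> fd a b.
have cf (S : set R) : {within S, continuous f}.
  by apply: continuous_subspaceT => x; exact: is_derive_continuous (fd x).
have [->|ab] := eqVneq a b.
  by exists 0; rewrite ?lexx ?ler01// !subrr mulr0.
have ba0 : b - a != 0 by rewrite subr_eq0 eq_sym.
suff [c e ci] : exists2 c, f b - f a = df c * (b - a) &
    c \in `[Num.min a b, Num.max a b].
  exists ((c - a) / (b - a)); last by rewrite e mulfVK// subrKC.
  move: ci; rewrite in_itv/=.
  have [lab|lba] := leP a b => /andP[c1 c2].
    have p : 0 < b - a by rewrite subr_gt0 lt_neqAle ab.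
    by apply/andP; split; [rewrite divr_ge0 ?subr_ge0// ltW|rewrite ler_pdivrMr// mul1r lerB].
  have p : 0 < a - b by rewrite subr_gt0.
  rewrite -(opprB a b) -(opprB a c) invrN mulrNN.
  by apply/andP; split; [rewrite divr_ge0 ?subr_ge0// ltW|rewrite ler_pdivrMr// mul1r lerB].
have [lab|lba] := leP a b.
  by have [c ? ?] := MVT_segment lab (fun x _ => fd x) (cf _); exists c.
have [c ? e] := MVT_segment (ltW lba) (fun x _ => fd x) (cf _).
by exists c => //; rewrite -opprB e -mulrN opprB.
Qed.

Lemma ftc2 (F f : R -> R) a b : a <= b -> continuous f ->
  (forall x : R, is_derive x 1 F (f x)) ->
  \int[mu]_(x in `[a, b]) f x = F b - F a.
Proof.
rewrite le_eqVlt => /predU1P[-> cf dF|ab cf dF].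
  by rewrite set_itv1 Rintegral_set1 subrr.
rewrite /Rintegral (@continuous_FTC2 _ f F)//.
- exact: continuous_subspaceT.
- split.
  + by move=> x _; case: (dF x).
  + apply: cvg_at_right_filter; exact: is_derive_continuous (dF a).
  + apply: cvg_at_left_filter; exact: is_derive_continuous (dF b).
- by move=> x _; rewrite derive1E; case: (dF x).
Qed.

Lemma integrable_itv (f : R -> R) a b : continuous f ->
  mu.-integrable `[a, b] (EFin \o f).
Proof.
move=> cf; apply: continuous_compact_integrable; first exact: segment_compact.
exact: continuous_subspaceT.
Qed.

End calculus.

(** * Gaussian averages *)

Section linear_growth.
Variables (R : realType) (Y : normedModType R).

(** The growth class dictated by the kernels: a factor [2 s] from the time lag, or [2 z] from an
    integration by parts, times a bounded function. One constant for a whole family provides the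
    dominating function for limits. *)
Definition lgrowth (C : R) (H : Y -> R) :=
  continuous H /\ forall y, `|H y| <= C * (1 + `|y|).

(* Gaussian averages are used through these four properties only, so that
   iterated averages need no product measure. *)
Record gfun (L : (Y -> R) -> R) : Prop := GFun {
  gfunD : forall C H1 H2, lgrowth C H1 -> lgrowth C H2 ->
    L (H1 \+ H2) = L H1 + L H2 ;
  gfunZ : forall a C H, lgrowth C H -> L (a \*o H) = a * L H ;
  gfun_le : forall C H1 H2, lgrowth C H1 -> lgrowth C H2 ->
    (forall y, H1 y <= H2 y) -> L H1 <= L H2 ;
  gfun_cvg : forall C (H_ : nat -> Y -> R) H, (forall m, lgrowth C (H_ m)) ->
    lgrowth C H -> (forall y, H_ ^~ y @ \oo --> H y) ->
    (fun m => L (H_ m)) @ \oo --> L H }.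

End linear_growth.

Section ghalf.
Variable R : realType.
Local Notation mu := (@lebesgue_measure R).

(** Only a half line, and not normalized: the variable will be the square root of a time lag. *)
Definition ghalf (h : R -> R) : R :=
  \int[mu]_(x in `[0, +oo[) (gauss_fun x * h x).

Lemma is_derive_gauss (x : R) : is_derive x 1 gauss_fun (- (2 * x) * gauss_fun x).
Proof.
have -> : gauss_fun = expR \o (fun z : R => - (z ^+ 2)) by [].
have d : is_derive x 1 (fun z : R => - (z ^+ 2)) (- (2 * x)).
  by apply: is_derive_eq; rewrite /GRing.scale/=; ring.
by apply: is_derive_eq; rewrite mulrC.
Qed.

Lemma integrable_gauss_weight :
  mu.-integrable `[0, +oo[ (fun x => (gauss_fun x * (1 + `|x|))%:E).
Proof.
rewrite (_ : (fun _ => _) =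
    (EFin \o gauss_fun) \+ (EFin \o fun x => gauss_fun x * `|x|)); last first.
  by apply/funext => x /=; rewrite -EFinD; congr EFin; ring.
apply: integrableD => //.
  exact: integrableS integrableT_gauss.
have mf : measurable_fun `[(0:R), +oo[ (fun x => gauss_fun x * `|x|).
  apply: measurable_funTS; apply: measurable_funM => //.
  exact: measurable_gauss_fun.
apply/integrableP; split; first exact/measurable_EFinP.
rewrite (_ : (\int[mu]_(x in _) _)%E =
    (\int[mu]_(x in `[0%R, +oo[) (x * gauss_fun x)%:E)%E); last first.
  apply: eq_integral => x; rewrite inE/= in_itv/= andbT => x0.
  by rewrite ger0_norm ?mulr_ge0 ?gauss_fun_ge0// (ger0_norm x0) mulrC.
(* x exp(- x^2) has the explicit antiderivative - exp(- x^2) / 2, which tends to 0. *)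
rewrite (@ge0_continuous_FTC2y _ _ (fun x => - (2^-1) * gauss_fun x) 0 0).
- by rewrite -EFinB ltry.
- by move=> x x0; rewrite mulr_ge0 ?gauss_fun_ge0.
- apply: continuous_subspaceT => x; apply: continuousM => //.
  exact: continuous_gauss_fun.
- rewrite -(mulr0 (- 2^-1)); apply: cvgM; first exact: cvg_cst.
  exact: cvg_gauss_fun.
- by move=> x _; have [? _] := is_derive_gauss x; exact: derivableM.
- apply: cvg_at_right_filter; apply: cvgM; first exact: cvg_cst.
  exact: continuous_gauss_fun.
- move=> x _; rewrite derive1E.
  have := is_derive_gauss x => dg.
  by rewrite derive_val /= /GRing.scale /=; field.
Qed.

Lemma lgrowth_gauss_integrable C (h : R -> R) : lgrowth C h ->
  mu.-integrable `[0, +oo[ (EFin \o (fun x => gauss_fun x * h x)).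
Proof.
move=> [ch hC].
apply: le_integrable (integrableZl _ C integrable_gauss_weight) => //.
- apply/measurable_EFinP/measurable_funTS; apply: measurable_funM.
    exact: measurable_gauss_fun.
  exact: continuous_measurable_fun.
- move=> x _ /=; rewrite lee_fin normrM ger0_norm ?gauss_fun_ge0//.
  rewrite (le_trans _ (ler_norm _))// [leRHS]mulrCA.
  by rewrite ler_wpM2l ?gauss_fun_ge0.
Qed.

Lemma ghalf_le C (h1 h2 : R -> R) : lgrowth C h1 -> lgrowth C h2 ->
  (forall x, 0 <= x -> h1 x <= h2 x) -> ghalf h1 <= ghalf h2.
Proof.
move=> i1 i2 h12; apply: le_Rintegral => //=.
- exact: lgrowth_gauss_integrable i1.
- exact: lgrowth_gauss_integrable i2.
- move=> x; rewrite in_itv/= andbT => x0.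
  by rewrite ler_wpM2l ?gauss_fun_ge0// h12.
Qed.

Lemma eq_ghalf (h1 h2 : R -> R) : (forall x, 0 <= x -> h1 x = h2 x) -> ghalf h1 = ghalf h2.
Proof.
move=> h12; apply: eq_Rintegral => x; rewrite inE/= in_itv/= andbT => x0.
by rewrite h12.
Qed.

Lemma gfun_ghalf : gfun ghalf.
Proof.
split.
- move=> C h1 h2 i1 i2; rewrite /ghalf -RintegralD//.
  + by apply: eq_Rintegral => x _ /=; rewrite mulrDr.
  + exact: lgrowth_gauss_integrable i1.
  + exact: lgrowth_gauss_integrable i2.
- move=> a C h i; rewrite /ghalf -RintegralZl//.
    by apply: eq_Rintegral => x _ /=; rewrite mulrCA.
  exact: lgrowth_gauss_integrable i.
- by move=> C h1 h2 i1 i2 h12; apply: ghalf_le i1 i2 _ => x _.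
- move=> C h_ h i_ i h_h; rewrite /ghalf /Rintegral.
  apply: fine_cvg; rewrite fineK; last first.
    apply: integrable_fin_num => //; exact: lgrowth_gauss_integrable i.
  apply: (@dominated_cvg _ _ _ mu `[0, +oo[ _
      (fun m x => (gauss_fun x * h_ m x)%:E) (fun x => (gauss_fun x * h x)%:E)
      (fun x => C%:E * (gauss_fun x * (1 + `|x|))%:E)%E) => //.
  + move=> m; apply/measurable_EFinP/measurable_funTS; apply: measurable_funM.
      exact: measurable_gauss_fun.
    by apply: continuous_measurable_fun; case: (i_ m).
  + move=> x _; apply: cvg_EFin; first exact: nearW.
    by apply: cvgM; [exact: cvg_cst|exact: h_h].
  + exact: integrableZl integrable_gauss_weight.
  + move=> m x _ /=; rewrite lee_fin normrM ger0_norm ?gauss_fun_ge0//.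
    by rewrite [leRHS]mulrCA ler_wpM2l ?gauss_fun_ge0//; case: (i_ m).
Qed.

(** With its weight the integrand is the derivative of exp(- x^2) p, so only the boundary term at 0
    survives. When p is an average at time lag x^2, this term is the value at lag 0; that is how
    [heatT] gets inverted. *)
Lemma ghalf_ftc (C : R) (p dp : R -> R) :
  (forall x : R, is_derive x 1 p (dp x)) -> continuous dp ->
  (forall x, `|p x| <= C) -> (forall x, `|dp x| <= C * (1 + `|x|)) ->
  ghalf (fun x => dp x - 2 * x * p x) = - p 0.
Proof.
move=> dP cdp pC dpC.
have cp : continuous p by move=> x; exact: is_derive_continuous (dP x).
have ch : continuous (fun x => dp x - 2 * x * p x).
  move=> x; apply: cvgB; first exact: cdp.
  apply: cvgM; last exact: cp.
  by apply: cvgM; [exact: cvg_cst|exact: cvg_id].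
have C0 : 0 <= C := le_trans (normr_ge0 _) (pC 0).
have hC : lgrowth (3 * C) (fun x => dp x - 2 * x * p x).
  split=> // x; rewrite (le_trans (ler_normB _ _))//.
  rewrite !normrM (ger0_norm (ler0n _ 2)).
  have := dpC x; have := pC x; have := normr_ge0 x => x0 h1 h2.
  have : `|x| * `|p x| <= `|x| * C by rewrite ler_wpM2l.
  by nra.
have ig := lgrowth_gauss_integrable hC.
pose F x := gauss_fun x * p x.
have dF (x : R) : is_derive x 1 F (gauss_fun x * (dp x - 2 * x * p x)).
  have := dP x => dpx; have := is_derive_gauss x => dgx.
  by apply: is_derive_eq; rewrite /GRing.scale/=; ring.
have cf : continuous (fun x => gauss_fun x * (dp x - 2 * x * p x)).
  move=> x; apply: cvgM; last exact: ch.
  exact: continuous_gauss_fun.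
have lim1 : (fun m => F m%:R) @ \oo --> (0 : R).
  have gF : (fun m => C * gauss_fun (m%:R : R)) @ \oo --> (0 : R).
    rewrite -(mulr0 C); apply: cvgM; first exact: cvg_cst.
    exact: (cvg_comp _ _ (@cvgr_idn R) (@cvg_gauss_fun R)).
  apply/norm_cvg0P; apply: (squeeze_cvgr _ (cvg_cst 0) gF).
  apply: nearW => m; rewrite normr_ge0/= normrM ger0_norm ?gauss_fun_ge0//.
  by rewrite mulrC ler_wpM2r ?gauss_fun_ge0.
(* The integrals over [0, m] are put on the whole half line by an indicator, so that dominated
   convergence applies. *)
have lim2 : (fun m => F m%:R - F 0) @ \oo -->
    ghalf (fun x => dp x - 2 * x * p x).
  rewrite (_ : (fun m => _) = (fun m => fine (\int[mu]_(x in `[0%R, +oo[)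
      ((gauss_fun x * (dp x - 2 * x * p x)) * \1_`[0, m%:R] x)%:E)%E)); last first.
    apply/funext => m; rewrite -(ftc2 _ cf dF)//.
    rewrite -[RHS]/(Rintegral mu _ _).
    rewrite [in LHS](_ : `[0, m%:R]%classic = `[0, +oo[ `&` `[0, m%:R]); last first.
      apply/seteqP; split=> x /=; rewrite !in_itv/= ?andbT; last by case.
      by case/andP => ? ?; split=> //; apply/andP.
    by rewrite Rintegral_mkcondr; apply: eq_Rintegral => x _; rewrite patch_indic.
  apply: fine_cvg; rewrite fineK; last exact: integrable_fin_num.
  apply: (@dominated_cvg _ _ _ mu `[0, +oo[ _
      (fun m x => ((gauss_fun x * (dp x - 2 * x * p x)) * \1_`[0, m%:R] x)%:E)
      (fun x => (gauss_fun x * (dp x - 2 * x * p x))%:E)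
      (fun x => `|(gauss_fun x * (dp x - 2 * x * p x))%:E|)%E) => //.
  + move=> m; apply/measurable_EFinP/measurable_funTS; apply: measurable_funM.
      exact: continuous_measurable_fun.
    exact: measurable_indic.
  + move=> x x0; apply: cvg_near_cst.
    exists (Num.truncn `|x|).+1 => // m /= xm.
    rewrite indicE mem_set ?mulr1//=.
    move: x0; rewrite /= !in_itv/= andbT => x0; rewrite x0/=.
    rewrite ltW// -(ger0_norm x0); apply: lt_le_trans (truncnS_gt _) _.
    by rewrite ler_nat.
  + exact: integrable_abse.
  + move=> m x _ /=; rewrite lee_fin normrM ler_piMr//.
    by rewrite indicE; case: (_ \in _); rewrite ?normr1 ?normr0.
have := cvg_unique _ lim2 (cvgB lim1 (cvg_cst (F 0))).
by move=> ->//; rewrite sub0r /F /gauss_fun expr0n/= oppr0 expR0 mul1r.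
Qed.

End ghalf.

(** Dominated convergence, as recorded in [gfun_cvg], concerns sequences; continuity of averages in
    a parameter is therefore tested on sequences. *)
Lemma seq_continuous (R : realType) (V : normedModType R) (f : V -> R) (x : V) :
  (forall u : nat -> V, u @ \oo --> x -> (f \o u) @ \oo --> f x) ->
  {for x, continuous f}.
Proof.
move=> fu; apply/cvgrPdist_lt => e e0; apply/not_notP => nf.
have /choice[u uP] (k : nat) : exists y, ball x k.+1%:R^-1 y /\ e <= `|f x - f y|.
  apply/not_existsP => nk; apply: nf; apply/nbhs_ballP; exists k.+1%:R^-1 => /=.
    by rewrite invr_gt0.
  by move=> y xy /=; rewrite ltNge; apply/negP => efy; exact: (nk y).
have ux : u @ \oo --> x.
  apply/cvgrPdist_lt => d d0; near=> k.
  apply: (@lt_trans _ _ k.+1%:R^-1); first by case: (uP k) => /=; rewrite -ball_normE.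
  near: k; exact: near_infty_natSinv_lt (PosNum d0).
have /cvgrPdist_lt/(_ e e0)[N _ /(_ N (leqnn N))] := fu u ux.
by case: (uP N) => _; rewrite leNgt => /negP.
Unshelve. all: by end_near. Qed.

Section gfun_theory.
Variables (R : realType) (Y : normedModType R).
Implicit Types (H : Y -> R).

Lemma lgrowth_ge0 (C : R) H : lgrowth C H -> 0 <= C.
Proof.
by case=> _ /(_ 0); rewrite normr0 addr0 mulr1; apply: le_trans.
Qed.

Lemma lgrowthW (C C' : R) H : C <= C' -> lgrowth C H -> lgrowth C' H.
Proof.
by move=> CC' [cH HC]; split=> // y; rewrite (le_trans (HC y))// ler_wpM2r ?addr_ge0.
Qed.

Lemma lgrowthZ (a C : R) H : lgrowth C H -> lgrowth (`|a| * C) (a \*o H).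
Proof.
move=> [cH HC]; split=> [y|y]; first by apply: cvgM; [exact: cvg_cst|exact: cH].
by rewrite /= normrM -mulrA ler_wpM2l.
Qed.

Lemma lgrowthD (C1 C2 : R) H1 H2 :
  lgrowth C1 H1 -> lgrowth C2 H2 -> lgrowth (C1 + C2) (H1 \+ H2).
Proof.
move=> [c1 h1] [c2 h2]; split=> [y|y]; first by apply: cvgD; [exact: c1|exact: c2].
by rewrite /= (le_trans (ler_normD _ _))// mulrDl lerD.
Qed.

Lemma lgrowthB (C1 C2 : R) H1 H2 :
  lgrowth C1 H1 -> lgrowth C2 H2 -> lgrowth (C1 + C2) (H1 \- H2).
Proof.
move=> [c1 h1] [c2 h2]; split=> [y|y]; first by apply: cvgB; [exact: c1|exact: c2].
by rewrite /= (le_trans (ler_normB _ _))// mulrDl lerD.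
Qed.

Lemma lgrowth_weight : lgrowth 1 (fun y : Y => 1 + `|y|).
Proof.
split=> [y|y]; last by rewrite mul1r ger0_norm ?addr_ge0.
by apply: cvgD; [exact: cvg_cst|exact: norm_continuous].
Qed.

Lemma lgrowth_bounded (C : R) H :
  continuous H -> (forall y, `|H y| <= C) -> lgrowth C H.
Proof.
move=> cH HC; split=> // y; rewrite (le_trans (HC y))// ler_peMr ?lerDl//.
exact: le_trans (HC y).
Qed.

Variable L : (Y -> R) -> R.
Hypothesis gL : gfun L.

Lemma gfunDW (C1 C2 : R) H1 H2 : lgrowth C1 H1 -> lgrowth C2 H2 ->
  L (H1 \+ H2) = L H1 + L H2.
Proof.
move=> h1 h2; have ? := lgrowth_ge0 h1; have ? := lgrowth_ge0 h2.
by apply: (gfunD gL (C := C1 + C2)); [apply: lgrowthW h1|apply: lgrowthW h2]; lra.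
Qed.

Lemma gfunB (C1 C2 : R) H1 H2 : lgrowth C1 H1 -> lgrowth C2 H2 ->
  L (H1 \- H2) = L H1 - L H2.
Proof.
move=> h1 h2; rewrite -mulN1r -(gfunZ gL _ h2) -(gfunDW h1 (lgrowthZ (-1) h2)).
by congr L; apply/funext => y /=; rewrite mulN1r.
Qed.

Lemma gfun_sum (C : R) (I : Type) (r : seq I) (H : I -> Y -> R) :
  (forall i, lgrowth C (H i)) ->
  L (fun y => \sum_(i <- r) H i y) = \sum_(i <- r) L (H i).
Proof.
move=> h; elim: r => [|i r IH].
  rewrite big_nil; under eq_fun do rewrite big_nil.
  transitivity (L (0 \*o (fun y : Y => 1 + `|y|))).
    by congr L; apply/funext => y /=; rewrite mul0r.
  by rewrite (gfunZ gL 0 lgrowth_weight) mul0r.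
rewrite big_cons -IH; under eq_fun do rewrite big_cons.
have hr : lgrowth (\sum_(i <- r) C) (fun y => \sum_(i <- r) H i y).
  elim: r {IH} => [|k r IH].
    rewrite big_nil; under eq_fun do rewrite big_nil.
    by split=> [y|y]; [exact: cvg_cst|rewrite normr0 mul0r].
  rewrite big_cons (_ : (fun y => _) = H k \+ (fun y => \sum_(i <- r) H i y)).
    exact: lgrowthD.
  by apply/funext => y; rewrite big_cons.
exact: gfunDW (h i) hr.
Qed.

Lemma gfun_norm_le (C : R) H : lgrowth C H ->
  `|L H| <= C * L (fun y => 1 + `|y|).
Proof.
move=> hH; have C0 := lgrowth_ge0 hH.
have hC : lgrowth C (C \*o (fun y : Y => 1 + `|y|)).
  by have := lgrowthZ C lgrowth_weight; rewrite mulr1 ger0_norm.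
rewrite -(gfunZ gL _ lgrowth_weight) ler_norml; apply/andP; split.
  have hN := lgrowthZ (-1) hC.
  rewrite normrN1 mul1r in hN.
  rewrite -mulN1r -(gfunZ gL _ hC); apply: (gfun_le gL hN hH) => y /=.
  by rewrite mulN1r; case: hH => _ /(_ y); rewrite ler_norml => /andP[].
apply: (gfun_le gL hH hC) => y /=.
by case: hH => _ /(_ y); rewrite ler_norml => /andP[].
Qed.

(** The growth constant may depend on the parameter: along a convergent sequence the parameter is
    bounded, which restores a common constant. *)
Lemma gfun_continuous (P : normedModType R) (C : R) (G : P -> Y -> R) :
  (forall p, lgrowth (C * (1 + `|p|)) (G p)) ->
  (forall y, continuous (G ^~ y)) -> continuous (fun p => L (G p)).
Proof.
move=> gG cG p; apply: seq_continuous => u up.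
have [B [_ Bu]] := cvg_seq_bounded (cvgP _ up).
pose D := (Num.max 0 B) + 1.
have BD k : `|u k| <= D.
  apply: Bu => //; rewrite /D; have : B <= Num.max 0 B by rewrite le_max lexx orbT.
  lra.
have D0 : 0 <= D by apply: addr_ge0 => //; rewrite le_max lexx.
have C0 : 0 <= C.
  by have := lgrowth_ge0 (gG 0); rewrite normr0 addr0 mulr1.
apply: (gfun_cvg gL (C := C * (1 + (D + `|p|)))).
- move=> k; apply: lgrowthW (gG (u k)).
  by rewrite ler_wpM2l// lerD2l (le_trans (BD k))// lerDl.
- by apply: lgrowthW (gG p); rewrite ler_wpM2l// lerD2l lerDr.
- by move=> y; exact: (cvg_comp u (G^~ y) up (cG y p)).
Qed.

(** By the mean value theorem every difference quotient is a value of [G'], so the quotients share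
    its growth constant and the limit can be taken inside the average. *)
Lemma gfun_derive (C : R) (G G' : R -> Y -> R) :
  (forall (p : R) y, is_derive p 1 (G ^~ y) (G' p y)) ->
  (forall p, lgrowth C (G p)) -> (forall p, lgrowth C (G' p)) ->
  forall p : R, is_derive p 1 (fun q => L (G q)) (L (G' p)).
Proof.
move=> dG gG gG' p.
have lim : (fun h => h^-1 *: (L (G (h *: 1 + p)) - L (G p))) @ 0^' --> L (G' p).
  apply/cvgr_dnbhsP => u [u0 ucv].
  pose Hq k y := (u k)^-1 * (G (u k + p) y - G p y).
  have -> : (fun k => (u k)^-1 *: (L (G (u k *: 1 + p)) - L (G p))) =
      (fun k => L (Hq k)).
    apply/funext => k; rewrite /GRing.scale/= mulr1.
    by rewrite -(gfunB (gG _) (gG _)) -(gfunZ gL _ (lgrowthB (gG _) (gG _))).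
  apply: (gfun_cvg gL (C := C)) => //.
    move=> k; split.
      move=> y; apply: cvgM; first exact: cvg_cst.
      by apply: cvgB; [case: (gG (u k + p)) => + _; exact|case: (gG p) => + _; exact].
    move=> y; have [c _] := mvt_global (dG^~ y) p (u k + p).
    rewrite addrK /Hq => ->; rewrite mulrC mulfK//.
    by case: (gG' (p + c * u k)).
  move=> y; have [d dE] := dG p y.
  have : (fun h => h^-1 *: (G (h *: 1 + p) y - G p y)) @ 0^' --> G' p y.
    by rewrite -dE.
  move/cvgr_dnbhsP => /(_ u (conj u0 ucv)).
  rewrite (_ : (fun k => _) = Hq^~ y)//.
  by apply/funext => k; rewrite /GRing.scale/= mulr1.
by apply: DeriveDef; [exact: cvgP lim|exact: cvg_lim lim].
Qed.

End gfun_theory.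

Section gfun_comb.
Variables (R : realType) (Y Y' : normedModType R) (m : R -> Y -> Y').
Variables (j : (R -> R) -> R) (L : (Y -> R) -> R).
Hypothesis cm : forall z, continuous (m z).
Hypothesis cm1 : forall y, continuous (m^~ y).
Hypothesis mW : forall z y, 1 + `|m z y| <= (1 + `|z|) * (1 + `|y|).
Hypotheses (gj : gfun j) (gL : gfun L).

Definition gcomb (H : Y' -> R) : R := j (fun z => L (fun y => H (m z y))).

Lemma lgrowth_slice C H z : lgrowth C H ->
  lgrowth (C * (1 + `|z|)) (fun y => H (m z y)).
Proof.
move=> hH; have C0 := lgrowth_ge0 hH; case: hH => cH HC.
split=> [y|y]; first exact: (continuous_comp (@cm z y) (cH (m z y))).
by rewrite (le_trans (HC _))// -mulrA ler_wpM2l.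
Qed.

Lemma lgrowth_inner C H : lgrowth C H ->
  lgrowth (C * L (fun y => 1 + `|y|)) (fun z => L (fun y => H (m z y))).
Proof.
move=> hH; split.
  apply: (gfun_continuous gL) => [z|y z]; first exact: lgrowth_slice hH.
  by case: hH => cH _; exact: (continuous_comp (@cm1 y z) (cH (m z y))).
by move=> z; rewrite mulrAC; apply: gfun_norm_le => //; exact: lgrowth_slice.
Qed.

(** By [mW] the weight of the combined variable is at most a product of weights, so the inner
    average of a function of linear growth still has linear growth in z and the outer properties
    apply to it. *)
Lemma gfun_comb : gfun gcomb.
Proof.
split.
- move=> C H1 H2 h1 h2; rewrite /gcomb.
  rewrite -(gfunD gj (lgrowth_inner h1) (lgrowth_inner h2)); congr j.
  apply/funext => z /=.
  by rewrite -(gfunD gL (lgrowth_slice z h1) (lgrowth_slice z h2)).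
- move=> a C H h; rewrite /gcomb -(gfunZ gj _ (lgrowth_inner h)); congr j.
  by apply/funext => z /=; rewrite -(gfunZ gL _ (lgrowth_slice z h)).
- move=> C H1 H2 h1 h2 h12.
  apply: (gfun_le gj (lgrowth_inner h1) (lgrowth_inner h2)) => z.
  by apply: (gfun_le gL (lgrowth_slice z h1) (lgrowth_slice z h2)) => y.
- move=> C H_ H h_ h H_H.
  apply: (gfun_cvg gj _ (lgrowth_inner h)) => [k|z]; first exact: lgrowth_inner.
  apply: (gfun_cvg gL _ (lgrowth_slice z h)) => [k|y]; first exact: lgrowth_slice.
  exact: H_H.
Qed.

End gfun_comb.

(** * Directional derivatives and curves *)

Lemma scaler1 (R : realType) (h : R) : h *: (1 : R) = h.
Proof. exact: mulr1. Qed.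

Section directional.
Variables (R : realType) (V : normedModType R).
Implicit Types (f : V -> R) (a v : V) (d : R).

Lemma is_deriveP f a v d :
  is_derive a v f d <-> (fun h => h^-1 * (f (h *: v + a) - f a)) @ 0^' --> d.
Proof.
split=> [[df <-] //|fd]; by apply: DeriveDef; [exact: cvgP fd|exact: cvg_lim fd].
Qed.

Lemma is_derive_lincomb (I : Type) (r : seq I) (c d : I -> R) (f : I -> V -> R) x v :
  (forall i, is_derive x v (f i) (d i)) ->
  is_derive x v (fun y => \sum_(i <- r) c i * f i y) (\sum_(i <- r) c i * d i).
Proof.
move=> df; elim: r => [|i r IH].
  rewrite big_nil; under eq_fun do rewrite big_nil; exact: is_derive_cst.
rewrite big_cons (_ : (fun y => _) = (c i \*: f i) + (fun y => \sum_(j <- r) c j * f j y)).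
  by apply: is_deriveD.
by apply/funext => y; rewrite big_cons.
Qed.

End directional.

Section directional_line.
Variables (R : realType) (V : normedModType R).
Implicit Types (f : V -> R) (a v : V) (d : R).

Lemma is_derive_translate f a b v d :
  is_derive (a + b) v f d -> is_derive a v (fun x => f (x + b)) d.
Proof.
move/is_deriveP => h; apply/is_deriveP.
by under eq_fun do rewrite -addrA.
Qed.

Lemma is_derive_line f a v d (s : R) :
  is_derive (a + s *: v) v f d -> is_derive s 1 (fun h => f (a + h *: v)) d.
Proof.
move/is_deriveP => h; apply/is_deriveP.
rewrite (_ : (fun _ => _) = fun h0 => h0^-1 * (f (h0 *: v + (a + s *: v)) - f (a + s *: v)))//.
by apply/funext => h0; rewrite scaler1 scalerDl addrCA.
Qed.

Lemma is_derive_line0 f a v d :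
  is_derive (0 : R) 1 (fun h => f (a + h *: v)) d <-> is_derive a v f d.
Proof.
split=> [/is_deriveP h|h]; last by apply: is_derive_line; rewrite scale0r addr0.
apply/is_deriveP.
rewrite (_ : (fun _ => _) = fun h0 : R => h0^-1 *
   (f (a + (h0 *: (1 : R) + 0) *: v) - f (a + 0 *: v)))//.
by apply/funext => h0; rewrite scaler1 addr0 scale0r addr0 (addrC a).
Qed.

(* Moving along one direction at a time, the mean value theorem writes the
   increment in each direction as a partial derivative at a nearby point. *)
Lemma is_derive_curve (I : Type) (l : seq I) (v : I -> V) (f : V -> R)
    (df : I -> V -> R) (c : I -> R -> R) (dc : I -> R) (a : V) (s : R) :
  (forall i, continuous (df i)) ->
  (forall i x, is_derive x (v i) f (df i x)) ->
  (forall i, c i s = 0) -> (forall i, is_derive s 1 (c i) (dc i)) ->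
  is_derive s 1 (fun h => f (a + \sum_(i <- l) c i h *: v i))
    (\sum_(i <- l) dc i * df i a).
Proof.
move=> cdf dF c0 dC.
have cc i : {for s, continuous (c i)} by exact: is_derive_continuous (dC i).
have cq l0 : {for s, continuous (fun h => a + \sum_(i <- l0) c i h *: v i)}.
  apply: cvgD; first exact: cvg_cst.
  elim: l0 => [|i l0 IH].
    by under eq_fun do rewrite big_nil; rewrite big_nil; exact: cvg_cst.
  rewrite (_ : (fun _ => _) = fun h => c i h *: v i + \sum_(j <- l0) c j h *: v j).
    by rewrite big_cons; apply: cvgD => //; apply: cvgZr_tmp; exact: cc.
  by apply/funext => h; rewrite big_cons.
have q0 l0 : a + \sum_(i <- l0) c i s *: v i = a.
  by rewrite big1 ?addr0// => i _; rewrite c0 scale0r.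
elim: l => [|i l IH].
  rewrite big_nil; under eq_fun do rewrite big_nil.
  exact: is_derive_cst.
rewrite big_cons.
have /choice[t tP] h : exists t, 0 <= t <= 1 /\
   f (a + \sum_(j <- l) c j h *: v j + c i h *: v i) -
   f (a + \sum_(j <- l) c j h *: v j) =
   df i (a + \sum_(j <- l) c j h *: v j + (t * c i h) *: v i) * c i h.
  have [|t t01] := @mvt_global R (fun z => f (a + \sum_(j <- l) c j h *: v j + z *: v i))
     (fun z => df i (a + \sum_(j <- l) c j h *: v j + z *: v i)) _ 0 (c i h).
    by move=> z; exact: is_derive_line.
  by rewrite scale0r addr0 subr0 add0r => e; exists t.
rewrite (_ : (fun h => _) = (fun h =>
    df i (a + \sum_(j <- l) c j h *: v j + (t h * c i h) *: v i) * c i h) \+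
    (fun h => f (a + \sum_(j <- l) c j h *: v j))); last first.
  apply/funext => h /=; have [_ <-] := tP h.
  by rewrite subrK big_cons (addrC (_ *: _)) addrA.
apply: is_deriveD.
apply/is_deriveP.
have lim1 : (fun h : R => h^-1 * c i (h *: (1 : R) + s)) @ 0^' --> dc i.
  by have /is_deriveP := dC i; rewrite c0; under eq_fun do rewrite subr0.
have ss : (fun h : R => h *: (1 : R) + s) @ 0^' --> s.
  have : (fun h : R => h *: (1 : R) + s) @ 0^' --> (0 : R) *: (1 : R) + s.
    apply: cvg_within_filter; apply: cvgD; last exact: cvg_cst.
    by apply: cvgZr_tmp; exact: cvg_id.
  by rewrite scale0r add0r.
have lim2 : (fun h : R => df i (a + \sum_(j <- l) c j (h *: (1 : R) + s) *: v j +
    (t (h *: (1 : R) + s) * c i (h *: (1 : R) + s)) *: v i)) @ 0^' --> df i a.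
  have lim3 : (fun h : R => a + \sum_(j <- l) c j (h *: (1 : R) + s) *: v j +
    (t (h *: (1 : R) + s) * c i (h *: (1 : R) + s)) *: v i) @ 0^' --> a.
    suff : (fun h : R => a + \sum_(j <- l) c j (h *: (1 : R) + s) *: v j +
        (t (h *: (1 : R) + s) * c i (h *: (1 : R) + s)) *: v i) @ 0^' -->
        a + (0 : R) *: v i.
      by rewrite scale0r addr0.
    apply: cvgD.
      have := cq l; rewrite /prop_for /continuous_at q0 => cql.
      exact: (cvg_comp _ _ ss cql).
    apply: cvgZr_tmp; apply/norm_cvg0P.
    have h1 : (fun h : R => `|c i (h *: (1 : R) + s)|) @ 0^' --> (0 : R).
      apply/norm_cvg0P; have := cc i; rewrite /prop_for /continuous_at c0 => cci.
      exact: (cvg_comp _ _ ss cci).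
    apply: (squeeze_cvgr _ (cvg_cst 0) h1); apply: nearW => h.
    rewrite normr_ge0/= normrM ler_piMl//.
    by have [/andP[t0 t1] _] := tP (h *: (1 : R) + s); rewrite ger0_norm.
  exact: (cvg_comp _ _ lim3 (cdf i a)).
rewrite (_ : (fun h => _) = (fun h : R => (h^-1 * c i (h *: (1 : R) + s)) *
  df i (a + \sum_(j <- l) c j (h *: (1 : R) + s) *: v j +
    (t (h *: (1 : R) + s) * c i (h *: (1 : R) + s)) *: v i))); last first.
  by apply/funext => h; rewrite [X in _ - _ * X]c0; ring.
exact: cvgM.
Qed.

End directional_line.

Section gfull.
Variable R : realType.

Lemma lgrowth_cst (Y : normedModType R) (c : R) : lgrowth `|c| (fun _ : Y => c).
Proof. by apply: lgrowth_bounded => // y; exact: cvg_cst. Qed.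

Lemma ghalf1_gt0 : 0 < ghalf (fun _ : R => 1).
Proof.
rewrite /ghalf (_ : (fun _ => _) = gauss_fun); last first.
  by apply/funext => x; rewrite mulr1.
by rewrite /Rintegral integral0y_gauss/= divr_gt0// sqrtr_gt0 pi_gt0.
Qed.

(** The probability average for exp(- x^2) on the line, folded onto the half line so that its
    properties are inherited from [ghalf]. *)
Definition gfull (h : R -> R) : R :=
  (2 * ghalf (fun _ => 1))^-1 * ghalf (fun x => h x + h (- x)).

Lemma lgrowth_sym C (h : R -> R) : lgrowth C h ->
  lgrowth (C + C) (fun x => h x + h (- x)).
Proof.
move=> hh; apply: lgrowthD => //; case: hh => ch hC; split=> [x|x].
  by apply: continuous_comp; [exact: opp_continuous|exact: ch].
by rewrite (le_trans (hC _))// normrN.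
Qed.

Lemma gfun_gfull : gfun gfull.
Proof.
have c0 : 0 < (2 * ghalf (fun _ : R => 1))^-1 :> R.
  by rewrite invr_gt0 mulr_gt0// ghalf1_gt0.
split.
- move=> C h1 h2 i1 i2; rewrite /gfull -mulrDr; congr (_ * _).
  rewrite -(gfunD (@gfun_ghalf R) (lgrowth_sym i1) (lgrowth_sym i2)).
  by congr ghalf; apply/funext => x /=; rewrite addrACA.
- move=> a C h i; rewrite /gfull mulrCA; congr (_ * _).
  rewrite -(gfunZ (@gfun_ghalf R) _ (lgrowth_sym i)).
  by congr ghalf; apply/funext => x /=; rewrite mulrDr.
- move=> C h1 h2 i1 i2 h12; rewrite /gfull ler_wpM2l ?(ltW c0)//.
  apply: (gfun_le (@gfun_ghalf R) (lgrowth_sym i1) (lgrowth_sym i2)) => x.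
  by rewrite lerD.
- move=> C h_ h i_ i h_h; apply: cvgM; first exact: cvg_cst.
  apply: (gfun_cvg (@gfun_ghalf R) _ (lgrowth_sym i)) => [k|x].
    exact: lgrowth_sym.
  by apply: cvgD; exact: h_h.
Qed.

Lemma gfull_cst (c : R) : gfull (fun _ => c) = c.
Proof.
have h1 := lgrowth_cst R 1.
rewrite /gfull (_ : (fun _ : R => c + c) = ((2 * c) \*o (fun _ => 1))); last first.
  by apply/funext => x /=; rewrite mulr1 -mulr2n mulr_natl.
rewrite (gfunZ (@gfun_ghalf R) _ h1).
by rewrite (mulrC 2 c) -mulrA mulrCA mulVf ?mulr1// gt_eqF ?mulr_gt0 ?ghalf1_gt0.
Qed.

Lemma gfull_ibp (C : R) (p dp : R -> R) :
  (forall x : R, is_derive x 1 p (dp x)) -> continuous dp ->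
  (forall x, `|p x| <= C) -> (forall x, `|dp x| <= C) ->
  gfull (fun x => 2 * x * p x) = gfull dp.
Proof.
move=> dP cdp pC dpC.
have cp : continuous p by move=> x; exact: is_derive_continuous (dP x).
have C0 : 0 <= C := le_trans (normr_ge0 _) (pC 0).
have g1 : lgrowth (2 * C) (fun x : R => 2 * x * p x).
  split=> [x|x].
    apply: cvgM; last exact: cp.
    by apply: cvgM; [exact: cvg_cst|exact: cvg_id].
  rewrite !normrM (ger0_norm (ler0n _ 2)) -!mulrA ler_wpM2l// mulrC.
  by rewrite ler_pM// lerDr.
have g2 : lgrowth C dp by exact: lgrowth_bounded.
apply/eqP; rewrite eq_sym -subr_eq0 -(gfunB gfun_gfull g2 g1); apply/eqP.
rewrite /gfull [X in _ * X](_ : _ = 0) ?mulr0//.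
(* Folding dp - 2 x p replaces p by p(x) - p(-x), which vanishes at 0: the boundary term of
   [ghalf_ftc] disappears. *)
pose q x := p x - p (- x).
pose dq x := dp x + dp (- x).
have dQ (x : R) : is_derive x 1 q (dq x).
  have h1 := dP x; have h2 := dP (- x).
  have h3 : is_derive x 1 (p \o (fun y => - y)) (dp (- x) * - 1).
    by apply: is_derive1_comp.
  by apply: is_derive_eq; rewrite mulrN1 opprK.
have H : ghalf (fun x => dq x - 2 * x * q x) = - q 0.
  apply: (@ghalf_ftc _ (2 * C)) => //.
  - move=> x; apply: cvgD; first exact: cdp.
    by apply: (@continuous_comp _ _ _ (fun y : R => - y)); [exact: opp_continuous|exact: cdp].
  - move=> x; rewrite (le_trans (ler_normB _ _))//.
    by have := pC x; have := pC (- x); lra.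
  - move=> x; rewrite (le_trans (ler_normD _ _))//.
    rewrite (@le_trans _ _ (2 * C))//.
      by have := dpC x; have := dpC (- x); lra.
    by rewrite ler_peMr ?mulr_ge0// lerDl.
rewrite /q oppr0 subrr oppr0 in H.
rewrite -[RHS]H; congr ghalf; apply/funext => x /=; rewrite /dq /q; ring.
Qed.

End gfull.

Lemma continuous_translate (R : realType) (V : normedModType R) (a : V) :
  continuous (fun z => z + a).
Proof. by move=> z; apply: cvgD; [exact: cvg_id|exact: cvg_cst]. Qed.

Lemma continuous_line (R : realType) (V : normedModType R) (v z : V) :
  continuous (fun t : R => z + t *: v).
Proof. by move=> t; apply: cvgD; [exact: cvg_cst|apply: cvgZr_tmp; exact: cvg_id]. Qed.

Lemma continuous_mul (R : realType) (V : topologicalType) (f g : V -> R) :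
  continuous f -> continuous g -> continuous (fun z => f z * g z).
Proof. by move=> cf cg z; apply: cvgM; [exact: cf|exact: cg]. Qed.

Section gexp.
Variables (R : realType) (n : nat).
Local Notation E := 'rV[R]_n.

Definition ev (i : 'I_n) : E := delta_mx ord0 i.

Lemma norm_ev i : `|ev i| <= 1.
Proof.
rewrite [`|_|]mx_normrE; apply/bigmax_leP; split => // -[a b] _ /=.
by rewrite mxE; case: andP => _; rewrite ?normr1 ?normr0.
Qed.

Lemma norm_coord (z : E) i : `|z ord0 i| <= `|z|.
Proof.
by rewrite [leRHS]mx_normrE; apply: (le_bigmax _ (fun ij : 'I_1 * 'I_n => `|z ij.1 ij.2|) (ord0, i)).
Qed.

Lemma evE i j (z : E) (t : R) : (z + t *: ev i) ord0 j = z ord0 j + (i == j)%:R * t.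
Proof. by rewrite !mxE eqxx/= eq_sym mulrC. Qed.

(** When [l] lists every coordinate once this is the average for exp(- |z|^2) over R^n. The base
    case evaluates at 0, so a coordinate absent from [l] stays equal to 0. *)
Fixpoint gexp (l : seq 'I_n) (H : E -> R) : R :=
  if l is i :: l' then gfull (fun t => gexp l' (fun z => H (z + t *: ev i)))
  else H 0.

Lemma step_weight i (t : R) (z : E) :
  1 + `|z + t *: ev i| <= (1 + `|t|) * (1 + `|z|).
Proof.
have h : `|z + t *: ev i| <= `|z| + `|t|.
  rewrite (le_trans (ler_normD _ _))// lerD2l normrZ ler_piMr//.
  exact: norm_ev.
have := mulr_ge0 (normr_ge0 t) (normr_ge0 z); nra.
Qed.

Lemma gfun_gexp l : gfun (gexp l).
Proof.
elim: l => [|i l IH] /=.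
  split=> //= C H_ H _ _ hH; exact: hH.
apply: (gfun_comb (m := fun t z => z + t *: ev i)) IH => //.
- by move=> t; exact: continuous_translate.
- by move=> y; exact: continuous_line.
- by move=> t z; exact: step_weight.
- exact: gfun_gfull.
Qed.

Lemma gexp_cst l (c : R) : gexp l (fun _ => c) = c.
Proof. by elim: l => //= i l IH; rewrite IH gfull_cst. Qed.

Lemma eq_gexp_hyperplane l j (H1 H2 : E -> R) : j \notin l ->
  (forall z : E, z ord0 j = 0 -> H1 z = H2 z) -> gexp l H1 = gexp l H2.
Proof.
elim: l H1 H2 => [|i l IH] H1 H2 /=; first by move=> _; apply; rewrite mxE.
rewrite inE negb_or eq_sym => /andP[/negbTE ij jl] h12.
congr gfull; apply/funext => t; apply: IH => // z z0; apply: h12.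
by rewrite evE z0 ij mul0r addr0.
Qed.

Lemma gexp_ibp (C : R) l j (H dH : E -> R) : uniq l -> j \in l ->
  continuous H -> continuous dH ->
  (forall z, is_derive z (ev j) H (dH z)) ->
  (forall z, `|H z| <= C) -> (forall z, `|dH z| <= C) ->
  gexp l (fun z => 2 * z ord0 j * H z) = gexp l dH.
Proof.
elim: l H dH => //= i l IH H dH /andP[il ul] jl cH cdH dE HC dHC.
have sc t (K : E -> R) : continuous K -> continuous (fun z : E => K (z + t *: ev i)).
  by move=> cK z; apply: continuous_comp; [exact: continuous_translate|exact: cK].
have sd t z : is_derive z (ev j) (fun y => H (y + t *: ev i)) (dH (z + t *: ev i)).
  exact: is_derive_translate.
move: jl; rewrite inE => /predU1P[ji|jl]; last first.
  have nij : (i == j) = false by apply/negbTE; apply: contraNN il => /eqP ->.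
  congr gfull; apply/funext => t.
  rewrite -(IH (fun z => H (z + t *: ev i)) (fun z => dH (z + t *: ev i)))//; do ?exact: sc.
  by congr gexp; apply/funext => z; rewrite evE nij mul0r addr0.
rewrite -{}ji in il sc sd *.
have bd t (K : E -> R) : continuous K -> (forall z, `|K z| <= C) ->
    lgrowth C (fun z => K (z + t *: ev j)).
  by move=> cK KC; apply: lgrowth_bounded => //; exact: sc.
pose N := gexp l (fun z => 1 + `|z|).
have phiC t (K : E -> R) : continuous K -> (forall z, `|K z| <= C) ->
    `|gexp l (fun z => K (z + t *: ev j))| <= C * N.
  by move=> cK KC; exact: (gfun_norm_le (gfun_gexp l) (bd t K cK KC)).
(* Since j does not recur in the tail, the coordinate of index j equals t throughout the inner
   average and can be taken out; what is left is one-dimensional. *)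
transitivity (gfull (fun t => 2 * t * gexp l (fun z => H (z + t *: ev j)))).
  congr gfull; apply/funext => t.
  rewrite -(gfunZ (gfun_gexp l) _ (bd t H cH HC)).
  by apply: eq_gexp_hyperplane il _ => z z0; rewrite evE z0 eqxx mul1r add0r.
apply: (@gfull_ibp _ (C * N)).
- move=> t; apply: (gfun_derive (gfun_gexp l) (C := C)
    (G := fun t z => H (z + t *: ev j)) (G' := fun t z => dH (z + t *: ev j))).
  + by move=> p y; exact: is_derive_line.
  + by move=> p; exact: bd.
  + by move=> p; exact: bd.
- apply: (gfun_continuous (gfun_gexp l) (C := C)) => [t|z].
    have C0 : 0 <= C := le_trans (normr_ge0 _) (HC 0).
    by apply: lgrowthW (bd t dH cdH dHC); rewrite ler_peMr// lerDl.
  by move=> t; apply: continuous_comp; [exact: continuous_line|exact: cdH].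
- by move=> t; exact: phiC.
- by move=> t; exact: phiC.
Qed.

End gexp.

(** * The heat resolvent *)

Section continuity.
Variable R : realType.

Lemma continuous_pair (T U V : topologicalType) (f : T -> U) (g : T -> V) :
  continuous f -> continuous g -> continuous (fun x => (f x, g x)).
Proof. by move=> cf cg x; apply: cvg_pair; [exact: cf|exact: cg]. Qed.

Lemma continuous_scale (T : topologicalType) (V : normedModType R)
    (f : T -> R) (g : T -> V) :
  continuous f -> continuous g -> continuous (fun x => f x *: g x).
Proof. by move=> cf cg x; apply: cvgZ; [exact: cf|exact: cg]. Qed.

Lemma continuous_add (T : topologicalType) (V : normedModType R)
    (f g : T -> V) :
  continuous f -> continuous g -> continuous (fun x => f x + g x).
Proof. by move=> cf cg x; apply: cvgD; [exact: cf|exact: cg]. Qed.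

Lemma continuous_opp (T : topologicalType) (V : normedModType R) (f : T -> V) :
  continuous f -> continuous (fun x => - f x).
Proof. by move=> cf x; apply: cvgN; exact: cf. Qed.

Lemma continuous_fst (U V : topologicalType) : continuous (@fst U V).
Proof. by move=> x; exact: cvg_fst. Qed.

Lemma continuous_snd (U V : topologicalType) : continuous (@snd U V).
Proof. by move=> x; exact: cvg_snd. Qed.

Lemma continuous_compf (T U V : topologicalType) (f : T -> U) (g : U -> V) :
  continuous f -> continuous g -> continuous (fun x => g (f x)).
Proof. by move=> cf cg x; apply: continuous_comp; [exact: cf|exact: cg]. Qed.

Lemma continuous_sum (T : topologicalType) (I : Type) (r : seq I)
    (f : I -> T -> R) : (forall i, continuous (f i)) ->
  continuous (fun z => \sum_(i <- r) f i z).
Proof.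
move=> cf; elim: r => [|i r IH] z.
  by under eq_fun do rewrite big_nil; exact: cst_continuous.
rewrite (_ : (fun z => _) = fun z => f i z + \sum_(j <- r) f j z).
  by apply: cvgD; [exact: cf|exact: IH].
by apply/funext => y; rewrite big_cons.
Qed.

End continuity.

Section heat_operator.
Variables (R : realType) (n : nat).
Local Notation E := 'rV[R]_n.
Local Notation X := ('rV[R]_n * R)%type.
Local Notation Y := (R * 'rV[R]_n)%type.

(* Substituting "time lag s^2, displacement 2 s z" in the heat kernel writes the
   inverse of d_t - Laplacian + 11 as the average of 2 s e^(-11 s^2) F(p + (2 s z, - s^2))
   over s > 0 and a Gaussian z; one factor e^(-s^2) of the weight sits in [ghalf].
   In [heatD j] the derivative in x_j has been moved onto the Gaussian. *)
Definition dirv (i : option 'I_n) : X := if i is Some i then (ev R i, 0) else (0, 1).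

Definition sh (s : R) (z : E) : X := ((2 * s) *: z, - s ^+ 2).

Definition lam (H : Y -> R) : R :=
  ghalf (fun s => gexp (enum 'I_n) (fun z => H (s, z))).

Lemma gfun_lam : gfun lam.
Proof.
apply: (gfun_comb (m := fun (s : R) (z : E) => (s, z)) (Y' := Y)).
- move=> s; apply: continuous_pair; first exact: cst_continuous.
  by move=> z; exact: cvg_id.
- move=> z; apply: continuous_pair; last exact: cst_continuous.
  by move=> s; exact: cvg_id.
- move=> s z; rewrite prod_normE/= mulrDl mul1r mulrDr mulr1 -!addrA lerD2l.
  have := mulr_ge0 (normr_ge0 s) (normr_ge0 z).
  have := normr_ge0 s; have := normr_ge0 z.
  by rewrite ge_max => ? ? ?; apply/andP; split; lra.
- exact: gfun_ghalf.
- exact: gfun_gexp.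
Qed.

Definition bc (C : R) (F : X -> R) := continuous F /\ forall p, `|F p| <= C.

Lemma bc_ge0 C F : bc C F -> 0 <= C.
Proof. by case=> _ /(_ 0); apply: le_trans. Qed.

Lemma bcW C C' F : C <= C' -> bc C F -> bc C' F.
Proof. by move=> CC' [cF FC]; split=> // p; exact: le_trans CC'. Qed.

Definition kernel (k : R -> E -> R) := lgrowth 2 (fun q : Y => k q.1 q.2).

(** [heatT] and [heatD] differ only by their kernel, so bounds, differentiation and limits are
    established once for any kernel of linear growth. *)
Definition conv (k : R -> E -> R) (F : X -> R) (p : X) : R :=
  lam (fun q => k q.1 q.2 * F (p + sh q.1 q.2)).

Lemma continuous_sh : continuous (fun q : Y => sh q.1 q.2).
Proof.
apply: continuous_pair.
  apply: continuous_scale; last exact: continuous_snd.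
  apply: continuous_mul; [exact: cst_continuous|exact: continuous_fst].
apply: continuous_opp; rewrite /GRing.exp/=.
by apply: continuous_mul; exact: continuous_fst.
Qed.

Section conv.
Variable k : R -> E -> R.
Hypothesis kk : kernel k.

Lemma conv_lgrowth C F p : bc C F ->
  lgrowth (2 * C) (fun q : Y => k q.1 q.2 * F (p + sh q.1 q.2)).
Proof.
move=> hF; have C0 := bc_ge0 hF; case: hF => cF FC; case: kk => ck kC.
split=> [|q].
  apply: continuous_mul => //; apply: continuous_compf cF.
  by apply: continuous_add; [exact: cst_continuous|exact: continuous_sh].
by rewrite normrM mulrAC ler_pM.
Qed.

Lemma conv_bc C F : bc C F -> bc (2 * C * lam (fun q => 1 + `|q|)) (conv k F).
Proof.
move=> hF; have C0 := bc_ge0 hF; split=> [|p]; last first.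
  exact: (gfun_norm_le gfun_lam (conv_lgrowth p hF)).
apply: (gfun_continuous gfun_lam (C := 2 * C)) => [p|q].
  by apply: lgrowthW (conv_lgrowth p hF); rewrite ler_peMr ?mulr_ge0// lerDl.
apply: continuous_mul; first exact: cst_continuous.
by case: hF => cF _; apply: continuous_compf cF; exact: continuous_translate.
Qed.

Lemma conv_derive C F F' v : bc C F -> bc C F' ->
  (forall p, is_derive p v F (F' p)) ->
  forall p, is_derive p v (conv k F) (conv k F' p).
Proof.
move=> hF hF' dF p; apply/is_derive_line0.
have -> : conv k F' p = lam (fun q => k q.1 q.2 * F' (p + (0 : R) *: v + sh q.1 q.2)).
  by rewrite scale0r addr0.
apply: (gfun_derive gfun_lam (C := 2 * C)
  (G := fun h q => k q.1 q.2 * F (p + h *: v + sh q.1 q.2))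
  (G' := fun h q => k q.1 q.2 * F' (p + h *: v + sh q.1 q.2))).
- move=> h q; have h1 : is_derive h 1 (fun h0 => F (p + h0 *: v + sh q.1 q.2))
      (F' (p + h *: v + sh q.1 q.2)).
    rewrite (_ : (fun h0 => _) = (fun h0 => F (p + sh q.1 q.2 + h0 *: v))).
      by apply: is_derive_line; rewrite addrAC.
    by apply/funext => h0; rewrite addrAC.
  by apply: is_derive_eq.
- by move=> h; exact: conv_lgrowth.
- by move=> h; exact: conv_lgrowth.
Qed.

(** The displacement [sh] lowers time by s^2, so convergence at earlier times is enough. This keeps
    the whole limit procedure inside t <= 0. *)
Lemma conv_cvg C (F_ : nat -> X -> R) F p : (forall m, bc C (F_ m)) -> bc C F ->
  (forall q, q.2 <= p.2 -> F_^~ q @ \oo --> F q) ->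
  (fun m => conv k (F_ m) p) @ \oo --> conv k F p.
Proof.
move=> hF_ hF F_F; apply: (gfun_cvg gfun_lam (C := 2 * C)).
- by move=> m; exact: conv_lgrowth.
- exact: conv_lgrowth.
- move=> q; apply: cvgM; first exact: cvg_cst.
  by apply: F_F; rewrite /= gerDl oppr_le0 sqr_ge0.
Qed.

Lemma convD C F G p : bc C F -> bc C G ->
  conv k (fun q => F q + G q) p = conv k F p + conv k G p.
Proof.
move=> hF hG; rewrite /conv.
rewrite -(gfunD gfun_lam (conv_lgrowth p hF) (conv_lgrowth p hG)).
by congr lam; apply/funext => q /=; rewrite mulrDr.
Qed.

Lemma convZ C F a p : bc C F -> conv k (fun q => a * F q) p = a * conv k F p.
Proof.
move=> hF; rewrite /conv -(gfunZ gfun_lam _ (conv_lgrowth p hF)).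
by congr lam; apply/funext => q /=; rewrite mulrCA.
Qed.

Lemma conv_sum C (I : Type) (r : seq I) (F : I -> X -> R) p :
  (forall i, bc C (F i)) ->
  conv k (fun q => \sum_(i <- r) F i q) p = \sum_(i <- r) conv k (F i) p.
Proof.
move=> hF; rewrite /conv -(gfun_sum gfun_lam (C := 2 * C)); last first.
  by move=> i; exact: conv_lgrowth.
by congr lam; apply/funext => q /=; rewrite mulr_sumr.
Qed.

End conv.

Definition kT (s : R) (z : E) : R := 2 * s * expR (- 10 * s ^+ 2).
Definition kD (j : 'I_n) (s : R) (z : E) : R := expR (- 10 * s ^+ 2) * (2 * z ord0 j).

Lemma expRN10_le1 (s : R) : expR (- 10 * s ^+ 2) <= 1.
Proof. by rewrite -expR0 ler_expR mulNr oppr_le0 mulr_ge0// sqr_ge0. Qed.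

Lemma continuous_exp10 : continuous (fun s : R => expR (- 10 * s ^+ 2)).
Proof.
apply: continuous_compf; last exact: continuous_expR.
apply: continuous_mul; first exact: cst_continuous.
exact: exprn_continuous.
Qed.

Lemma kernel_kT : kernel kT.
Proof.
rewrite /kernel/kT; split=> [|q].
  apply: continuous_mul.
    by apply: continuous_mul; [exact: cst_continuous|exact: continuous_fst].
  by apply: continuous_compf continuous_exp10; exact: continuous_fst.
rewrite !normrM (ger0_norm (expR_ge0 _)) ger0_norm// -mulrA ler_wpM2l//.
rewrite (@le_trans _ _ `|q.1|)//; first by rewrite ler_piMr// expRN10_le1.
by rewrite prod_normE (le_trans (y := Num.max `|q.1| `|q.2|)) ?lerDr// le_max lexx.
Qed.

Lemma kernel_kD j : kernel (kD j).
Proof.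
rewrite /kernel/kD; split=> [|q].
  apply: continuous_mul.
    by apply: continuous_compf continuous_exp10; exact: continuous_fst.
  apply: continuous_mul; first exact: cst_continuous.
  apply: (@continuous_compf _ _ _ snd (fun z : E => z ord0 j)).
    exact: continuous_snd.
  exact: coord_continuous.
rewrite !normrM (ger0_norm (expR_ge0 _)) (ger0_norm (ler0n _ 2)).
rewrite (@le_trans _ _ (2 * `|q.2 ord0 j|))//.
  by rewrite ler_piMl ?mulr_ge0// expRN10_le1.
rewrite ler_wpM2l// (le_trans (norm_coord _ _))//.
by rewrite prod_normE (le_trans (y := Num.max `|q.1| `|q.2|)) ?lerDr// le_max lexx orbT.
Qed.

Definition heatT (F : X -> R) (p : X) := conv kT F p.
Definition heatD j (F : X -> R) (p : X) := conv (kD j) F p.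

(** [kT] has the sign of s, so positivity holds only because the outer integral runs over s >= 0.
    The comparison therefore goes through [ghalf_le] and not through the monotonicity of [lam],
    which would ask for an inequality at every s. *)
Lemma heatT_le C F G p : bc C F -> bc C G ->
  (forall q, q.2 <= p.2 -> F q <= G q) -> heatT F p <= heatT G p.
Proof.
move=> hF hG FG; rewrite /heatT /conv /lam.
have mw : forall (z : R) (y : E), 1 + `|(z, y) : Y| <= (1 + `|z|) * (1 + `|y|).
  move=> s z; rewrite prod_normE/= mulrDl mul1r mulrDr mulr1 -!addrA lerD2l.
  have := mulr_ge0 (normr_ge0 s) (normr_ge0 z).
  have := normr_ge0 s; have := normr_ge0 z.
  by rewrite ge_max => ? ? ?; apply/andP; split; lra.
have cm (z : R) : continuous (fun y : E => (z, y) : Y).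
  by apply: continuous_pair; [exact: cst_continuous|move=> y; exact: cvg_id].
have cm1 (y : E) : continuous (fun z : R => (z, y) : Y).
  by apply: continuous_pair; [move=> z; exact: cvg_id|exact: cst_continuous].
have lgF := conv_lgrowth kernel_kT p hF.
have lgG := conv_lgrowth kernel_kT p hG.
apply: ghalf_le.
- exact: (lgrowth_inner (m := fun (s : R) (z : E) => (s, z) : Y) (@cm) (@cm1) mw (gfun_gexp _ _) lgF).
- exact: (lgrowth_inner (m := fun (s : R) (z : E) => (s, z) : Y) (@cm) (@cm1) mw (gfun_gexp _ _) lgG).
- move=> s s0; apply: (gfun_le (gfun_gexp _ _)
    (lgrowth_slice (m := fun (s : R) (z : E) => (s, z) : Y) (@cm) mw s lgF)
    (lgrowth_slice (m := fun (s : R) (z : E) => (s, z) : Y) (@cm) mw s lgG)) => z /=.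
  rewrite ler_wpM2l//; first by rewrite /kT !mulr_ge0 ?expR_ge0.
  by apply: FG; rewrite /= gerDl oppr_le0 sqr_ge0.
Qed.

End heat_operator.

Section heat_inverse.
Variables (R : realType) (n : nat).
Local Notation E := 'rV[R]_n.
Local Notation X := ('rV[R]_n * R)%type.
Local Notation e10 s := (expR (- 10 * s ^+ 2)).
Local Notation gE := (@gexp R n (enum 'I_n)).

Lemma exp10_mul_le1 (s : R) : `|s| * e10 s <= 1.
Proof.
have h1 : 1 + 10 * s ^+ 2 <= expR (10 * s ^+ 2) by exact: expR_ge1Dx.
have h2 : `|s| <= 1 + 10 * s ^+ 2.
  by rewrite -(normr_id s) -real_normK ?num_real// normr_id; have := sqr_ge0 (`|s| - 1); have := sqr_ge0 `|s|; nra.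
rewrite mulNr expRN ler_pdivrMr ?expR_gt0// mul1r; exact: le_trans h1.
Qed.

Definition allv : seq (option 'I_n) := None :: map Some (enum 'I_n).

Lemma sum_allv (V : zmodType) (f : option 'I_n -> V) :
  \sum_(i <- allv) f i = f None + \sum_i f (Some i).
Proof. by rewrite /allv big_cons big_map big_enum. Qed.

Lemma sum_dirv (f : 'I_n -> R) :
  \sum_i f i *: dirv R (Some i) = (\sum_i f i *: ev R i, 0) :> X.
Proof.
elim/big_rec2 : _ => // i y1 y2 _ ->.
by apply/pair_equal_spec; rewrite /= scaler0 addr0.
Qed.

Lemma sh_increment (s r : R) (z : E) :
  sh r z = sh s z + ((- (r ^+ 2 - s ^+ 2)) *: dirv R None +
    \sum_i (2 * (r - s) * z ord0 i) *: dirv R (Some i)).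
Proof.
rewrite (sum_dirv (fun i => 2 * (r - s) * z ord0 i)).
apply/pair_equal_spec; split => /=.
  rewrite /sh/= scaler0 add0r {1 2}(row_sum_delta z).
  rewrite !scaler_sumr -big_split/=; apply: eq_bigr => i _.
  by rewrite !scalerA -scalerDl; congr (_ *: _); ring.
by rewrite addr0 scaler1; ring.
Qed.

Lemma is_derive_sh (C : R) (F : X -> R) (F1 : option 'I_n -> X -> R) (p : X) (z : E) (s : R) :
  (forall i, bc C (F1 i)) -> (forall i q, is_derive q (dirv R i) F (F1 i q)) ->
  is_derive s 1 (fun r => F (p + sh r z))
    (- (2 * s) * F1 None (p + sh s z) +
     \sum_i (2 * z ord0 i) * F1 (Some i) (p + sh s z)).
Proof.
move=> hF1 dF.
pose c (i : option 'I_n) (r : R) : R :=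
  if i is Some i then 2 * (r - s) * z ord0 i else - (r ^+ 2 - s ^+ 2).
pose dc (i : option 'I_n) : R := if i is Some i then 2 * z ord0 i else - (2 * s).
have := @is_derive_curve R X (option 'I_n) allv (@dirv R n) F F1 c dc (p + sh s z) s _ dF.
rewrite sum_allv/= => H.
rewrite (_ : (fun r => _) = (fun h => F (p + sh s z + \sum_(i <- allv) c i h *: dirv R i))).
  apply: H => [i|[i|]|[i|]].
  - by case: (hF1 i).
  - by rewrite /= subrr mulr0 mul0r.
  - by rewrite /= subrr oppr0.
  - rewrite (_ : c (Some i) = (fun r => (2 * z ord0 i) * (r - s))).
      by apply: is_derive_eq; rewrite /dc /GRing.scale/=; ring.
    by apply/funext => r; rewrite /c; ring.
  - by rewrite /c; apply: is_derive_eq; rewrite /dc /GRing.scale/=; ring.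
by apply/funext => r; rewrite sum_allv (sh_increment s r z)/= addrA.
Qed.

Lemma is_derive_sh_coord (F F' : X -> R) j (p : X) (s : R) (z : E) :
  (forall q, is_derive q (dirv R (Some j)) F (F' q)) ->
  is_derive z (ev R j) (fun z => F (p + sh s z)) (2 * s * F' (p + sh s z)).
Proof.
move=> dF; apply/is_derive_line0.
rewrite (_ : (fun h : R => _) =
    (fun t : R => F (p + sh s z + t *: dirv R (Some j))) \o (fun h => (2 * s) * h)); last first.
  apply/funext => h /=; congr F; rewrite -addrA; congr (_ + _).
  by apply/pair_equal_spec; split => /=; rewrite ?scalerDr ?scalerA// scaler0 addr0.
have h1 : is_derive (2 * s * 0) 1 (fun t : R => F (p + sh s z + t *: dirv R (Some j)))
    (F' (p + sh s z)).
  by apply: is_derive_line; rewrite mulr0 scale0r addr0.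
have h2 : is_derive (0 : R) 1 (fun h => (2 * s) * h) (2 * s).
  by apply: is_derive_eq; rewrite /GRing.scale/= mulr1.
by apply: is_derive_eq; rewrite mulrC.
Qed.

Lemma continuous_slice (F : X -> R) p s : continuous F ->
  continuous (fun z : E => F (p + sh s z)).
Proof.
move=> cF; apply: continuous_compf cF.
apply: continuous_add; first exact: cst_continuous.
apply: (@continuous_compf E (R * E)%type X (fun z => (s, z)) (fun q => sh q.1 q.2)).
  by apply: continuous_pair; [exact: cst_continuous|move=> z; exact: cvg_id].
exact: continuous_sh.
Qed.

(** Differentiating F(p + [sh s z]) in z_j brings out a factor 2 s, exactly the one by which [kT]
    differs from exp(- 10 s^2). *)
Lemma slice_ibp C (F F' : X -> R) j p s : bc C F -> bc C F' ->
  (forall q, is_derive q (dirv R (Some j)) F (F' q)) ->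
  gE (fun z => kD j s z * F (p + sh s z)) = gE (fun z => kT s z * F' (p + sh s z)).
Proof.
move=> hF hF' dF; have C0 := bc_ge0 hF; case: hF hF' => cF FC [cF' FC'].
rewrite (_ : (fun z => kT s z * _) = (fun z => e10 s * (2 * s * F' (p + sh s z)))); last first.
  by apply/funext => z; rewrite /kT; ring.
rewrite (_ : (fun z => kD j s z * _) = (fun z => 2 * z ord0 j * (e10 s * F (p + sh s z)))); last first.
  by apply/funext => z; rewrite /kD; ring.
have e1 := expRN10_le1 s; have e0 := expR_ge0 (- 10 * s ^+ 2).
apply: (@gexp_ibp _ _ ((1 + 2 * `|s|) * C)).
- exact: enum_uniq.
- by rewrite mem_enum.
- apply: continuous_mul; [exact: cst_continuous|exact: continuous_slice].
- apply: continuous_mul; first exact: cst_continuous.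
  by apply: continuous_mul; [exact: cst_continuous|exact: continuous_slice].
- move=> z; have := is_derive_sh_coord p s z dF => d.
  by apply: is_derive_eq.
- move=> z; rewrite normrM ger0_norm//.
  rewrite (@le_trans _ _ (1 * C))//; first by rewrite ler_pM.
  by rewrite ler_wpM2r// lerDl mulr_ge0.
- move=> z; rewrite !normrM (ger0_norm e0) (ger0_norm (ler0n _ 2)).
  rewrite (@le_trans _ _ (1 * (2 * `|s| * C)))//.
    by rewrite ler_pM ?mulr_ge0// ler_wpM2l ?mulr_ge0.
  by rewrite mul1r ler_wpM2r// lerDr.
Qed.

Lemma heatD_ibp C (F F' : X -> R) j p : bc C F -> bc C F' ->
  (forall q, is_derive q (dirv R (Some j)) F (F' q)) ->
  heatD j F p = heatT F' p.
Proof.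
move=> hF hF' dF; unfold heatD, heatT, conv, lam.
by apply: eq_ghalf => s s0; exact: slice_ibp hF hF' dF.
Qed.

Definition c21 (C : R) (F : X -> R) (F1 : option 'I_n -> X -> R)
    (F2 : 'I_n -> X -> R) :=
  [/\ bc C F, forall i, bc C (F1 i), forall i, bc C (F2 i),
    forall i p, is_derive p (dirv R i) F (F1 i p) &
    forall i p, is_derive p (dirv R (Some i)) (F1 (Some i)) (F2 i p)].

Definition heatop F (F1 : option 'I_n -> X -> R) (F2 : 'I_n -> X -> R) (q : X) : R :=
  F1 None q - \sum_i F2 i q + 11 * F q.

(** Let G be exp(- 10 s^2) F(p + [sh s z]), averaged over z, and apply [ghalf_ftc] in s: the
    boundary term is F(p). The s-derivative consists of - 2 s times the time derivative, of - 22 s F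
    counting the weight exp(- s^2), and of the terms 2 z_i d_i F, which [slice_ibp] turns into 2 s
    times the Laplacian. Together they make up - 2 s (d_t - Laplacian + 11) F. *)
Lemma heatT_inv C (F : X -> R) F1 F2 p : c21 C F F1 F2 -> heatT (heatop F F1 F2) p = F p.
Proof.
move=> [hF hF1 hF2 dF1 dF2].
have C0 := bc_ge0 hF.
pose G (s : R) (z : E) : R := e10 s * F (p + sh s z).
pose S (s : R) (z : E) : R := \sum_i (2 * z ord0 i) * F1 (Some i) (p + sh s z).
pose G' (s : R) (z : E) : R := e10 s * (S s z - 2 * s * F1 None (p + sh s z) - 20 * s * F (p + sh s z)).
pose C' := (22 + 2 * n%:R) * C.
have CC' : C <= C'.
  by rewrite /C' ler_peMl//; have : 0 <= n%:R :> R by []; lra.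
have C'0 : 0 <= C' := le_trans C0 CC'.
have bS (s : R) (z : E) : `|S s z| <= 2 * n%:R * C * (1 + `|z|).
  rewrite (le_trans (ler_norm_sum _ _ _))//.
  rewrite (@le_trans _ _ (\sum_(i < n) (2 * C * (1 + `|z|))))//.
    apply: ler_sum => i _; rewrite !normrM (ger0_norm (ler0n _ 2)) -!mulrA ler_wpM2l//.
    rewrite mulrC ler_pM//; first by case: (hF1 (Some i)).
    by rewrite (le_trans (norm_coord _ _))// lerDr.
  rewrite sumr_const card_ord -mulr_natl.
  by rewrite le_eqVlt; apply/orP; left; apply/eqP; ring.
have gG s : lgrowth C' (G s).
  apply: lgrowthW CC' _; apply: lgrowth_bounded => [|z].
    apply: continuous_mul; first exact: cst_continuous.
    by apply: continuous_slice; case: hF.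
  rewrite normrM ger0_norm ?expR_ge0// -[leRHS]mul1r.
  by rewrite ler_pM ?expR_ge0 ?expRN10_le1//; case: hF.
have gG' s : lgrowth C' (G' s).
  split=> [|z].
    apply: continuous_mul; first exact: cst_continuous.
    apply: continuous_add; last first.
      apply: continuous_opp; apply: continuous_mul; first exact: cst_continuous.
      by apply: continuous_slice; case: hF.
    apply: continuous_add; last first.
      apply: continuous_opp; apply: continuous_mul; first exact: cst_continuous.
      by apply: continuous_slice; case: (hF1 None).
    apply: continuous_sum => i; apply: continuous_mul.
      by apply: continuous_mul; [exact: cst_continuous|exact: coord_continuous].
    by apply: continuous_slice; case: (hF1 (Some i)).
  have e0 := expR_ge0 (- 10 * s ^+ 2); have e1 := expRN10_le1 s.
  have es := exp10_mul_le1 s.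
  have FC : `|F (p + sh s z)| <= C by case: hF.
  have FC1 : `|F1 None (p + sh s z)| <= C by case: (hF1 None).
  have h1 : `|e10 s * S s z| <= 2 * n%:R * C * (1 + `|z|).
    rewrite normrM ger0_norm// (le_trans _ (bS s z))// ler_piMl//.
  have h2 : `|e10 s * (s * F1 None (p + sh s z))| <= C.
    by rewrite mulrA normrM normrM (ger0_norm e0) (mulrC (e10 s)) -[leRHS]mul1r ler_pM ?mulr_ge0.
  have h3 : `|e10 s * (s * F (p + sh s z))| <= C.
    by rewrite mulrA normrM normrM (ger0_norm e0) (mulrC (e10 s)) -[leRHS]mul1r ler_pM ?mulr_ge0.
  rewrite (_ : G' s z = e10 s * S s z - 2 * (e10 s * (s * F1 None (p + sh s z)))
     - 20 * (e10 s * (s * F (p + sh s z)))); last by rewrite /G'; ring.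
  have := ler_normB (e10 s * S s z - 2 * (e10 s * (s * F1 None (p + sh s z)))) (20 * (e10 s * (s * F (p + sh s z)))).
  have := ler_normB (e10 s * S s z) (2 * (e10 s * (s * F1 None (p + sh s z)))).
  rewrite (normrM 2) (normrM 20) (ger0_norm (ler0n _ 2)) (ger0_norm (ler0n _ 20)).
  have : 22 * C <= 22 * C * (1 + `|z|) by rewrite ler_peMr ?mulr_ge0// lerDl.
  rewrite /C'; nra.
have dG (s : R) (z : E) : is_derive s 1 (G^~ z) (G' s z).
  have d1 := is_derive_sh p z s hF1 dF1.
  have d2 : is_derive s 1 (fun r : R => e10 r) (- (20 * s) * e10 s).
    have d3 : is_derive s 1 (fun r : R => - 10 * r ^+ 2) (- (20 * s)).
      by apply: is_derive_eq; rewrite /GRing.scale/=; ring.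
    have d4 := @is_derive1_comp _ expR (fun r : R => - 10 * r ^+ 2) s _ _
      (is_derive_expR (- 10 * s ^+ 2)) d3.
    by apply: is_derive_eq; rewrite mulrC.
  apply: is_derive_eq; rewrite /GRing.scale/= /G' /S; ring.
have cu (z : E) : continuous (fun s : R => sh s z).
  apply: (@continuous_compf (R : Type) (R * E)%type X (fun s => (s, z)) (fun q => sh q.1 q.2)).
    by apply: continuous_pair; [move=> s; exact: cvg_id|exact: cst_continuous].
  exact: continuous_sh.
have cFs (K : X -> R) (z : E) : continuous K -> continuous (fun s : R => K (p + sh s z)).
  move=> cK; apply: continuous_compf cK.
  by apply: continuous_add; [exact: cst_continuous|exact: cu].
have cG' (z : E) : continuous (G'^~ z).
  apply: continuous_mul; first exact: continuous_exp10.
  have cid : continuous (fun s : R => s) by move=> s; exact: cvg_id.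
  apply: continuous_add; last first.
    apply: continuous_opp; apply: continuous_mul; last by apply: cFs; case: hF.
    by apply: continuous_mul => //; exact: cst_continuous.
  apply: continuous_add; last first.
    apply: continuous_opp; apply: continuous_mul; last by apply: cFs; case: (hF1 None).
    by apply: continuous_mul => //; exact: cst_continuous.
  apply: continuous_sum => i; apply: continuous_mul; first exact: cst_continuous.
  by apply: cFs; case: (hF1 (Some i)).
pose N := gE (fun z => 1 + `|z|).
have gg := gfun_gexp R (enum 'I_n).
have NG (s : R) (K : E -> R) : lgrowth C' K -> `|gE K| <= C' * N.
  by move=> hK; exact: (gfun_norm_le gg hK).
have : ghalf (fun s => gE (G' s) - 2 * s * gE (G s)) = - gE (G 0).
  apply: (@ghalf_ftc _ (C' * N)).
  - by move=> s; exact: (gfun_derive gg dG gG gG').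
  - apply: (gfun_continuous gg (C := C')) => // s.
    by apply: lgrowthW (gG' s); rewrite ler_peMr// lerDl.
  - by move=> s; exact: NG.
  - move=> s; rewrite (le_trans (NG s _ (gG' s)))// ler_peMr ?lerDl//.
    exact: le_trans (NG s _ (gG' s)).
have -> : gE (G 0) = F p.
  rewrite (_ : G 0 = fun _ => F p) ?gexp_cst//.
  apply/funext => z; rewrite /G expr0n/= mulr0 expR0 mul1r; congr F.
  by rewrite (_ : sh 0 z = 0) ?addr0// /sh mulr0 scale0r expr0n/= oppr0.
move=> H; apply: oppr_inj; rewrite -{}H.
have hL C0' F0 : bc C0' F0 -> forall s, lgrowth (2 * C0' * (1 + `|s|)) (fun z => kT s z * F0 (p + sh s z)).
  move=> hF0 s; have b0 := bc_ge0 hF0; case: hF0 => cF0 FC0.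
  apply: lgrowth_bounded => [|z].
    by apply: continuous_mul; [exact: cst_continuous|exact: continuous_slice].
  have e0 := expR_ge0 (- 10 * s ^+ 2); have es := exp10_mul_le1 s.
  rewrite /kT 3!normrM (ger0_norm e0) (ger0_norm (ler0n _ 2)).
  rewrite (@le_trans _ _ (2 * C0'))//; last by rewrite ler_peMr ?mulr_ge0// lerDl.
  rewrite -!mulrA ler_wpM2l// mulrA -[leRHS]mul1r ler_pM ?mulr_ge0//.
unfold heatT, conv, lam; rewrite -mulN1r.
have bQ : bc (C + n%:R * C + 11 * C) (heatop F F1 F2).
  split=> [|q].
    apply: continuous_add; last first.
      by apply: continuous_mul; [exact: cst_continuous|case: hF].
    apply: continuous_add; first by case: (hF1 None).
    by apply: continuous_opp; apply: continuous_sum => i; case: (hF2 i).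
  rewrite /heatop (le_trans (ler_normD _ _))// lerD//.
    rewrite (le_trans (ler_normB _ _))// lerD//; first by case: (hF1 None).
    rewrite (le_trans (ler_norm_sum _ _ _))//.
    rewrite (@le_trans _ _ (\sum_(i < n) C))//.
      by apply: ler_sum => i _; case: (hF2 i).
    by rewrite sumr_const card_ord mulr_natl.
  by rewrite normrM ger0_norm// ler_wpM2l//; case: hF.
rewrite -(gfunZ (@gfun_ghalf R) _ (C := 2 * (C + n%:R * C + 11 * C) * gE (fun z => 1 + `|z|))); last first.
  have := lgrowth_inner (m := fun (s : R) (z : E) => (s, z) : (R * E)%type) _ _ _ gg (conv_lgrowth (@kernel_kT R n) p bQ).
  apply.
  - by move=> z; apply: continuous_pair; [exact: cst_continuous|move=> y; exact: cvg_id].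
  - by move=> z; apply: continuous_pair; [move=> y; exact: cvg_id|exact: cst_continuous].
  - move=> s z; rewrite prod_normE/= mulrDl mul1r mulrDr mulr1 -!addrA lerD2l.
    have := mulr_ge0 (normr_ge0 s) (normr_ge0 z).
    have := normr_ge0 s; have := normr_ge0 z.
    by rewrite ge_max => ? ? ?; apply/andP; split; lra.
congr ghalf; apply/funext => s /=; rewrite mulN1r; apply/eqP; rewrite eq_sym -subr_eq0 opprK.
rewrite -(gfunZ gg _ (gG s)) -(gfunB gg (gG' s) (lgrowthZ (2 * s) (gG s))).
rewrite -(gfunDW gg (lgrowthB (gG' s) (lgrowthZ (2 * s) (gG s))) (hL _ _ bQ s)).
(* The terms in F and in its time derivative have cancelled; each remaining difference has average
   zero by [slice_ibp]. *)
rewrite (_ : _ \+ _ = fun z => \sum_i ((fun z => kD i s z * F1 (Some i) (p + sh s z)) \-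
   (fun z => kT s z * F2 i (p + sh s z))) z); last first.
  apply/funext => z /=; rewrite sumrB /G' /G /heatop /S -mulr_sumr.
  rewrite [X in _ = X - _](eq_bigr (fun i => e10 s * (2 * z ord0 i * F1 (Some i) (p + sh s z)))).
    by rewrite -mulr_sumr /kT; ring.
  by move=> i _; rewrite /kD -!mulrA.
have hK i : lgrowth (2 * C) (fun z => kD i s z * F1 (Some i) (p + sh s z)).
  split=> [|z].
    apply: continuous_mul; last by apply: continuous_slice; case: (hF1 (Some i)).
    apply: continuous_mul; first exact: cst_continuous.
    by apply: continuous_mul; [exact: cst_continuous|exact: coord_continuous].
  rewrite /kD normrM (normrM (expR _)) (normrM 2) (ger0_norm (expR_ge0 _)) (ger0_norm (ler0n _ 2)).
  rewrite (@le_trans _ _ (2 * `|z|  * C))//; last first.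
    by rewrite mulrAC ler_wpM2l ?mulr_ge0// lerDr.
  rewrite ler_pM ?mulr_ge0 ?expR_ge0//; last by case: (hF1 (Some i)).
  rewrite -[leRHS]mul1r ler_pM ?mulr_ge0 ?expR_ge0 ?expRN10_le1// ler_wpM2l//.
  exact: norm_coord.
rewrite (gfun_sum gg (C := 2 * C + 2 * C * (1 + `|s|))); last first.
  by move=> i; apply: lgrowthB; [exact: hK|exact: hL].
rewrite big1// => i _; rewrite (gfunB gg (hK i) (hL _ _ (hF2 i) s)).
by rewrite (slice_ibp p s (hF1 (Some i)) (hF2 i) (dF2 i)) subrr.
Qed.

End heat_inverse.

(** * Antiderivatives and derivatives of limits *)

Section antiderivative.
Variable R : realType.
Local Notation mu := (@lebesgue_measure R).

Lemma Rintegral_chasles (g : R -> R) a b c : continuous g -> a <= b -> b <= c ->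
  \int[mu]_(x in `[a, c]) g x =
  \int[mu]_(x in `[a, b]) g x + \int[mu]_(x in `[b, c]) g x.
Proof.
move=> cg ab bc; rewrite -(@Rintegral_itv_obnd_cbnd _ b).
  rewrite -(@Rintegral_itvB _ _ (BLeft a) (BRight c)) ?bnd_simp//.
    by rewrite addrC subrK.
  exact: integrable_itv.
apply: integrableS (integrable_itv b c cg) => //.
exact: subset_itv_oc_cc.
Qed.

Lemma antiderivative (g : R -> R) : continuous g ->
  exists A : R -> R, forall x : R, is_derive x 1 A (g x).
Proof.
move=> cg.
exists (fun x => if 0 <= x then \int[mu]_(t in `[0, x]) g t
                 else - \int[mu]_(t in `[x, 0]) g t) => x.
(* A base point below both 0 and x: near x both branches equal the integral from [a] minus its value
   at 0, so nothing has to be glued at 0. *)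
pose a := - (`|x| + 1).
have ax : a < x.
  by rewrite /a ltrNl (le_lt_trans (ler_norm _))// normrN ltrDl.
have a0 : a < 0 by rewrite /a oppr_lt0 ltr_wpDl.
have xx1 : x < x + 1 by rewrite ltrDl.
have [dF F'] := continuous_FTC1_closed xx1 (integrable_itv a (x + 1) cg) ax (cg x).
pose F y := \int[mu]_(t in `[a, y]) g t.
have F1 : is_derive x 1 F (g x) by split=> //; rewrite -derive1E.
apply: (@near_eq_is_derive _ _ _ (fun y => F y - F 0)); last first.
  by apply: is_derive_eq; rewrite subr0.
near=> y.
have ay : a <= y by apply: ltW; near: y; exact: lt_nbhsr.
rewrite /F; case: ifPn => [y0|].
  by rewrite (Rintegral_chasles cg (ltW a0) y0) addrAC subrr add0r.
rewrite -ltNge => /ltW y0.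
by rewrite (Rintegral_chasles cg ay y0) opprD addrA subrr add0r.
Unshelve. all: by end_near. Qed.

(** Bounded pointwise convergence of the derivatives replaces uniform convergence: both sides are
    integrated and dominated convergence is used. The statement is confined to [a, b] because in
    time the iterates converge only up to t = 0. *)
Lemma limit_of_derivatives (C : R) (f_ g_ : nat -> R -> R) (f g A : R -> R) a b :
  a <= b -> (forall k (x : R), is_derive x 1 (f_ k) (g_ k x)) ->
  (forall k, continuous (g_ k)) -> (forall k x, `|g_ k x| <= C) ->
  continuous g -> (forall x : R, is_derive x 1 A (g x)) ->
  (forall x, a <= x <= b -> f_^~ x @ \oo --> f x) ->
  (forall x, a <= x <= b -> g_^~ x @ \oo --> g x) ->
  f b - f a = A b - A a.
Proof.
move=> ab df cg_ gC cg dA ff gg.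
rewrite -(ftc2 ab cg dA).
have lim1 : (fun k => f_ k b - f_ k a) @ \oo --> f b - f a.
  by apply: cvgB; apply: ff; rewrite lexx ab.
have lim2 : (fun k => \int[mu]_(x in `[a, b]) g_ k x) @ \oo -->
    \int[mu]_(x in `[a, b]) g x.
  rewrite /Rintegral; apply: fine_cvg; rewrite fineK; last first.
    by apply: integrable_fin_num => //; exact: integrable_itv.
  apply: (@dominated_cvg _ _ _ mu `[a, b] _ (fun k x => (g_ k x)%:E)
     (fun x => (g x)%:E) (fun _ => C%:E)) => //.
  - by move=> k; apply/measurable_EFinP/measurable_funTS; exact: continuous_measurable_fun.
  - by move=> x; rewrite /= in_itv/= => x_ab; apply: cvg_EFin; [exact: nearW|exact: gg].
  - apply: (@integrable_itv _ (fun _ => C)); exact: cst_continuous.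
  - by move=> k x _; rewrite lee_fin.
apply: cvg_unique lim1 _ => //.
rewrite (_ : (fun k => _) = (fun k => \int[mu]_(x in `[a, b]) g_ k x))//.
by apply/funext => k; rewrite (ftc2 ab (cg_ k) (df k)).
Qed.

Lemma derivative_of_limit (C : R) (f_ g_ : nat -> R -> R) (f g : R -> R) :
  (forall k (x : R), is_derive x 1 (f_ k) (g_ k x)) ->
  (forall k, continuous (g_ k)) -> (forall k x, `|g_ k x| <= C) ->
  continuous g -> (forall x, f_^~ x @ \oo --> f x) ->
  (forall x, g_^~ x @ \oo --> g x) ->
  forall x : R, is_derive x 1 f (g x).
Proof.
move=> df cg_ gC cg ff gg x.
have [A dA] := antiderivative cg.
rewrite (_ : f = fun y => A y + (f 0 - A 0)).
  by apply: is_derive_eq; rewrite addr0.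
apply/funext => y; have [y0|/ltW y0] := leP 0 y.
  have := limit_of_derivatives y0 df cg_ gC cg dA (fun x _ => ff x) (fun x _ => gg x).
  lra.
have := limit_of_derivatives y0 df cg_ gC cg dA (fun x _ => ff x) (fun x _ => gg x).
lra.
Qed.

End antiderivative.

Section c1_functions.
Variables (R : realType) (n : nat).
Local Notation E := 'rV[R]_n.
Local Notation X := ('rV[R]_n * R)%type.

Lemma dirv_decomp (v : X) :
  v = \sum_(i <- @allv n) (if i is Some i then v.1 ord0 i else v.2) *: dirv R i.
Proof.
case: v => x t; rewrite sum_allv (sum_dirv (fun i => x ord0 i)).
apply/pair_equal_spec; split; rewrite /= ?scaler0 ?add0r ?addr0 ?scaler1//.
exact: row_sum_delta.
Qed.

Lemma is_derive_dir (F : X -> R) (F1 : option 'I_n -> X -> R) (p v : X) :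
  (forall i, continuous (F1 i)) -> (forall i q, is_derive q (dirv R i) F (F1 i q)) ->
  is_derive p v F (v.2 * F1 None p + \sum_i v.1 ord0 i * F1 (Some i) p).
Proof.
move=> cF1 dF.
pose a (i : option 'I_n) := if i is Some i then v.1 ord0 i else v.2.
have := @is_derive_curve R X _ (@allv n) (@dirv R n) F F1 (fun i h => h * a i) a p 0 cF1 dF.
rewrite sum_allv/= => H; apply/is_derive_line0.
rewrite (_ : (fun h : R => _) = (fun h => F (p + \sum_(i <- @allv n) (h * a i) *: dirv R i))).
  apply: H => i; first by rewrite mul0r.
  by apply: is_derive_eq; rewrite /GRing.scale/=; ring.
apply/funext => h; congr (F (_ + _)).
rewrite [in LHS](dirv_decomp v) scaler_sumr; apply: eq_bigr => i _.
by rewrite scalerA.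
Qed.

Lemma is_derive_space (F : X -> R) (F1 : 'I_n -> X -> R) (p : X) (v : E) :
  (forall i, continuous (F1 i)) ->
  (forall i q, is_derive q (dirv R (Some i)) F (F1 i q)) ->
  is_derive p (v, 0) F (\sum_i v ord0 i * F1 i p).
Proof.
move=> cF1 dF.
have := @is_derive_curve R X _ (index_enum _) (fun i => dirv R (Some i)) F F1
  (fun i h => h * v ord0 i) (fun i => v ord0 i) p 0 cF1 dF.
move=> H; apply/is_derive_line0.
rewrite (_ : (fun h : R => _) = (fun h => F (p + \sum_i (h * v ord0 i) *: dirv R (Some i)))).
  apply: H => i; first by rewrite mul0r.
  by apply: is_derive_eq; rewrite /GRing.scale/=; ring.
apply/funext => h; congr (F (_ + _)); rewrite (sum_dirv (fun i => h * v ord0 i)).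
apply/pair_equal_spec; split; rewrite /= ?scaler0//.
rewrite [in LHS](row_sum_delta v) scaler_sumr; apply: eq_bigr => i _.
by rewrite scalerA.
Qed.

(** Applied to the iterates with uniform constants, this makes their pointwise limit Lipschitz,
    hence continuous. *)
Lemma lipschitz_of_partials (C : R) (F : X -> R) (F1 : option 'I_n -> X -> R) (p q : X) :
  (forall i, bc C (F1 i)) -> (forall i q, is_derive q (dirv R i) F (F1 i q)) ->
  `|F q - F p| <= (1 + n%:R) * C * `|q - p|.
Proof.
move=> hF1 dF.
have cF1 i : continuous (F1 i) by case: (hF1 i).
have C0 := bc_ge0 (hF1 None).
pose v := q - p.
pose d x := v.2 * F1 None x + \sum_i v.1 ord0 i * F1 (Some i) x.
have [|t _] := @mvt_global R (fun h => F (p + h *: v)) (fun h => d (p + h *: v)) _ 0 1.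
  by move=> h; apply: is_derive_line; exact: is_derive_dir.
rewrite scale1r scale0r addr0 subr0 mulr1 add0r mulr1 (_ : p + v = q); last first.
  by rewrite /v addrC subrK.
move=> ->; rewrite /d (le_trans (ler_normD _ _))//.
rewrite -mulrA [leRHS]mulrDl mul1r lerD//.
  rewrite normrM mulrC ler_pM//; first by case: (hF1 None).
  by rewrite prod_normE le_max lexx orbT.
rewrite (le_trans (ler_norm_sum _ _ _))//.
rewrite (@le_trans _ _ (\sum_(i < n) (C * `|v|)))//; last first.
  by rewrite sumr_const card_ord mulr_natl.
apply: ler_sum => i _; rewrite normrM mulrC ler_pM//; first by case: (hF1 (Some i)).
by rewrite (le_trans (norm_coord _ _))// [leRHS]prod_normE le_max lexx.
Qed.

Lemma continuous_lipschitz (V : normedModType R) (F : V -> R) (K : R) :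
  (forall p q, `|F q - F p| <= K * `|q - p|) -> continuous F.
Proof.
move=> FK p; apply/cvgrPdist_le => e e0.
pose K' : R := `|K| + 1.
have K'0 : 0 < K' by rewrite ltr_wpDl.
near=> q.
rewrite (le_trans (FK q p))// (@le_trans _ _ (K' * `|p - q|))//.
  by rewrite ler_wpM2r// (le_trans (ler_norm _))// lerDl.
rewrite -ler_pdivlMl// mulrC.
near: q; have := near_ball p _ (divr_gt0 e0 K'0); apply: filterS => q.
by rewrite -ball_normE/= => /ltW.
Unshelve. all: by end_near. Qed.

End c1_functions.

(** * Smooth functions and rotations *)

Section bounded_continuous.
Variables (R : realType) (n : nat).
Local Notation E := 'rV[R]_n.
Local Notation X := ('rV[R]_n * R)%type.
Implicit Types (F G : X -> R).

Definition bcx F := exists C, bc C F.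

Lemma bcx_cst c : bcx (fun _ => c).
Proof. by exists `|c|; split=> //; exact: cst_continuous. Qed.

Lemma bcx_add F G : bcx F -> bcx G -> bcx (fun p => F p + G p).
Proof.
move=> [C [cF FC]] [D [cG GD]]; exists (C + D); split; first exact: continuous_add.
by move=> p; rewrite (le_trans (ler_normD _ _))// lerD.
Qed.

Lemma bcx_mul F G : bcx F -> bcx G -> bcx (fun p => F p * G p).
Proof.
move=> [C [cF FC]] [D [cG GD]]; exists (C * D); split; first exact: continuous_mul.
by move=> p; rewrite normrM ler_pM.
Qed.

Lemma bcx_opp F : bcx F -> bcx (fun p => - F p).
Proof.
move=> [C [cF FC]]; exists C; split; first exact: continuous_opp.
by move=> p; rewrite normrN.
Qed.

Lemma bcx_sum (I : Type) (r : seq I) (F : I -> X -> R) : (forall i, bcx (F i)) ->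
  bcx (fun p => \sum_(i <- r) F i p).
Proof.
move=> hF; elim: r => [|i r IH].
  by under eq_fun do rewrite big_nil; exact: bcx_cst.
rewrite (_ : (fun p => _) = fun p => F i p + \sum_(j <- r) F j p).
  exact: bcx_add.
by apply/funext => y; rewrite big_cons.
Qed.

Lemma bcx_comp F (r : X -> X) : continuous r -> bcx F -> bcx (fun p => F (r p)).
Proof. by move=> cr [C [cF FC]]; exists C; split=> //; exact: continuous_compf. Qed.

Lemma bcx_family (I : finType) (F : I -> X -> R) : (forall i, bcx (F i)) ->
  exists C, forall i, bc C (F i).
Proof.
move=> /choice[C hC]; exists (\sum_i C i) => i; apply: bcW (hC i).
rewrite (bigD1 i)//= lerDl; apply: sumr_ge0 => j _; exact: bc_ge0 (hC j).
Qed.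

(** Derivatives are carried as explicit data, so that the heat resolvent can act on each of them
    separately; the index [None] stands for time. Mixed second derivatives are included because
    rotations mix the coordinates. *)
Definition smooth (C : R) (F : X -> R) (F1 : option 'I_n -> X -> R)
    (F2 : 'I_n -> 'I_n -> X -> R) :=
  [/\ bc C F, forall i, bc C (F1 i), forall i j, bc C (F2 i j),
    forall i p, is_derive p (dirv R i) F (F1 i p) &
    forall i j p, is_derive p (dirv R (Some j)) (F1 (Some i)) (F2 i j p)].

Lemma smooth_of_bcx (F : X -> R) (F1 : option 'I_n -> X -> R)
    (F2 : 'I_n -> 'I_n -> X -> R) :
  bcx F -> (forall i, bcx (F1 i)) -> (forall i j, bcx (F2 i j)) ->
  (forall i p, is_derive p (dirv R i) F (F1 i p)) ->
  (forall i j p, is_derive p (dirv R (Some j)) (F1 (Some i)) (F2 i j p)) ->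
  exists C, smooth C F F1 F2.
Proof.
move=> [C hF] /bcx_family[D hF1] hF2 dF dF1.
have [B hB] := @bcx_family ('I_n * 'I_n)%type (fun ij => F2 ij.1 ij.2) (fun ij => hF2 ij.1 ij.2).
have C0 := bc_ge0 hF; have D0 := bc_ge0 (hF1 None).
exists (C + D + `|B|); split => //.
- by apply: bcW hF; rewrite -addrA lerDl addr_ge0.
- by move=> i; apply: bcW (hF1 i); rewrite addrAC lerDr addr_ge0.
- move=> i j; apply: bcW (hB (i, j)); rewrite (le_trans (ler_norm _))// lerDr addr_ge0//.
Qed.

Lemma smooth_c21 C (F : X -> R) (F1 : option 'I_n -> X -> R)
    (F2 : 'I_n -> 'I_n -> X -> R) : smooth C F F1 F2 -> c21 C F F1 (fun i => F2 i i).
Proof. by case=> *; split. Qed.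

Lemma smooth_heatT C (F : X -> R) (F1 : option 'I_n -> X -> R)
    (F2 : 'I_n -> 'I_n -> X -> R) : smooth C F F1 F2 ->
  smooth (2 * C * @lam R n (fun q => 1 + `|q|)) (heatT F) (fun i => heatT (F1 i))
    (fun i j => heatT (F2 i j)).
Proof.
move=> [hF hF1 hF2 dF dF1]; have kk := @kernel_kT R n; split.
- exact: conv_bc.
- by move=> i; exact: conv_bc.
- by move=> i j; exact: conv_bc.
- by move=> i p; exact: (conv_derive kk hF (hF1 i)).
- by move=> i j p; exact: (conv_derive kk (hF1 _) (hF2 i j)).
Qed.

(** [heatT] commutes with differentiation, so it commutes with the operator, and the left inverse
    [heatT_inv] is also a right inverse. *)
Lemma heatop_heatT C (F : X -> R) (F1 : option 'I_n -> X -> R)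
    (F2 : 'I_n -> 'I_n -> X -> R) p : smooth C F F1 F2 ->
  heatop (heatT F) (fun i => heatT (F1 i)) (fun i => heatT (F2 i i)) p = F p.
Proof.
move=> sF; rewrite -[RHS](heatT_inv p (smooth_c21 sF)).
have kk := @kernel_kT R n; case: sF => hF hF1 hF2 dF dF1.
have [D hD] : bcx (fun q => \sum_i F2 i i q).
  by apply: bcx_sum => i; exists C; exact: hF2.
have C0 := bc_ge0 hF; have D0 := bc_ge0 hD.
have [B hB] : bcx (fun q => F1 None q - \sum_i F2 i i q).
  by apply: bcx_add; [exists C; exact: hF1|apply: bcx_opp; exists D].
have [A hA] : bcx (fun q => 11 * F q).
  by apply: bcx_mul; [exact: bcx_cst|exists C].
have A0 := bc_ge0 hA; have B0 := bc_ge0 hB.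
rewrite /heatop /heatT.
rewrite (convD (C := A + B) kk (F := fun q => F1 None q - \sum_i F2 i i q) (G := fun q => 11 * F q)).
- rewrite (convZ kk _ _ hF); congr (_ + _).
  have [D' hD'] : bcx (fun q => - 1 * \sum_i F2 i i q).
    by apply: bcx_mul; [exact: bcx_cst|exists D].
  have D'0 := bc_ge0 hD'.
  rewrite (_ : (fun q => _ - _) = fun q => F1 None q + (-1) * \sum_i F2 i i q); last first.
    by apply/funext => q; rewrite mulN1r.
  rewrite (convD (C := C + D') kk); last 2 first.
  + by apply: bcW (hF1 None); rewrite lerDl.
  + by apply: bcW hD'; rewrite lerDr.
  rewrite (convZ kk _ _ hD) mulN1r; congr (_ - _).
  by rewrite (conv_sum kk (C := C)).
- by apply: bcW hB; rewrite lerDr.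
- by apply: bcW hA; rewrite lerDl.
Qed.

Lemma heatT_cst c p : heatT (fun _ : X => c) p = c / 11 :> R.
Proof.
have h0 : bc `|c| (fun _ : X => 0 : R).
  by split=> [|q]; [exact: cst_continuous|rewrite normr0].
have := @heatT_inv R n `|c| (fun _ => c / 11) (fun _ _ => 0) (fun _ _ => 0) p.
rewrite (_ : heatop _ _ _ = fun _ => c); last first.
  by apply/funext => q; rewrite /heatop big1// subr0 add0r mulrC divfK.
apply; split=> //.
- split=> [|q]; first exact: cst_continuous.
  by rewrite normrM ler_piMr// ger0_norm ?invf_le1//; lra.
- by move=> i q; exact: is_derive_cst.
- by move=> i q; exact: is_derive_cst.
Qed.

Lemma heatT_norm_le C (D : R) (F : X -> R) p : bc C F -> (forall q, `|F q| <= D) -> `|heatT F p| <= D / 11.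
Proof.
move=> hF FD; have C0 := bc_ge0 hF.
have D0 : 0 <= D := le_trans (normr_ge0 _) (FD p).
have hc d : `|d| = D -> bc (C + D) (fun _ : X => d).
  by move=> dD; split=> [|q]; [exact: cst_continuous|rewrite dD lerDr].
have hF' : bc (C + D) F by apply: bcW hF; rewrite lerDl.
rewrite ler_norml; apply/andP; split.
  rewrite -mulNr -(heatT_cst (- D) p); apply: heatT_le hF' _ => [|q _].
    by apply: hc; rewrite normrN ger0_norm.
  by have := FD q; rewrite ler_norml => /andP[].
rewrite -(heatT_cst D p); apply: heatT_le hF' _ _ => [|q _].
  by apply: hc; rewrite ger0_norm.
by have := FD q; rewrite ler_norml => /andP[].
Qed.

End bounded_continuous.

Section rotation.
Variables (R : realType) (n : nat) (Q : 'M[R]_n).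
Local Notation E := 'rV[R]_n.
Local Notation X := ('rV[R]_n * R)%type.
Hypothesis QQ : Q^T *m Q = 1%:M.

Definition rot (p : X) : X := (p.1 *m Q, p.2).

Lemma continuous_rot : continuous rot.
Proof.
apply: continuous_pair; last exact: continuous_snd.
rewrite (_ : (fun x : X => x.1 *m Q) = fun x => \sum_i x.1 ord0 i *: row i Q); last first.
  by apply/funext => x; rewrite mulmx_sum_row.
elim: (index_enum _) => [|i r IH].
  by under eq_fun do rewrite big_nil; exact: cst_continuous.
rewrite (_ : (fun x => _) = fun x : X => x.1 ord0 i *: row i Q + \sum_(j <- r) x.1 ord0 j *: row j Q).
  apply: continuous_add => //; apply: continuous_scale; last exact: cst_continuous.
  apply: (@continuous_compf _ _ _ fst (fun z : E => z ord0 i)).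
    exact: continuous_fst.
  exact: coord_continuous.
by apply/funext => y; rewrite big_cons.
Qed.

Lemma is_derive_rot (F : X -> R) p v d :
  is_derive (rot p) (rot v) F d -> is_derive p v (fun q => F (rot q)) d.
Proof.
move/is_deriveP => h; apply/is_deriveP.
rewrite (_ : (fun h0 => _) = fun h0 => h0^-1 * (F (h0 *: rot v + rot p) - F (rot p)))//.
apply/funext => h0; congr (_ * (F _ - _)); apply/pair_equal_spec; split => //=.
by rewrite mulmxDl scalemxAl.
Qed.

(** No change of variables in the Gaussian integral is made. With z = [heatT F], the rotated z
    solves the same equation with the same right-hand side F, and [heatT_inv] says that such a
    solution is [heatT F]. *)
Lemma heatT_rot C (F : X -> R) F1 F2 : smooth C F F1 F2 ->
  (forall q, F (rot q) = F q) -> forall q, heatT F (rot q) = heatT F q.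
Proof.
move=> sF rF.
have [hz hz1 hz2 dz dz1] := smooth_heatT sF.
have hop := fun q => heatop_heatT q sF.
set D := (2 * C * _)%R in hz hz1 hz2.
move: hz hz1 hz2 dz dz1 hop.
set z := heatT F; set z1 := fun i => heatT (F1 i); set z2 := fun i j => heatT (F2 i j).
move=> hz hz1 hz2 dz dz1 hop q.
pose Z1 (i : option 'I_n) p := if i is Some i then \sum_k Q i k * z1 (Some k) (rot p)
  else z1 None (rot p).
pose Z2 i j p := \sum_k Q i k * (\sum_l Q j l * z2 k l (rot p)).
have bz1 i : bcx (z1 i) by exists D; exact: hz1.
have bz2 i j : bcx (z2 i j) by exists D; exact: hz2.
have cz1 i : continuous (z1 i) by case: (hz1 i).
have cr := continuous_rot.
have evQ i k : (ev R i *m Q) ord0 k = Q i k.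
  by rewrite -rowE mxE.
have [B sZ] : exists B, smooth B (fun p => z (rot p)) Z1 Z2.
  apply: smooth_of_bcx.
  - by apply: bcx_comp => //; exists D.
  - case=> [i|]; last exact: bcx_comp.
    by apply: bcx_sum => k; apply: bcx_mul; [exact: bcx_cst|exact: bcx_comp].
  - move=> i j; apply: bcx_sum => k; apply: bcx_mul; first exact: bcx_cst.
    by apply: bcx_sum => l; apply: bcx_mul; [exact: bcx_cst|exact: bcx_comp].
  - move=> i p; apply: is_derive_rot.
    have := is_derive_dir (rot p) (rot (dirv R i)) cz1 dz.
    case: i => [i|] /=; last first.
      rewrite mul1r big1 ?addr0// => i _.
      by rewrite mul0mx mxE mul0r.
    by rewrite mul0r add0r; under eq_bigr do rewrite evQ.
  - move=> i j p.
    have dk k : is_derive p (dirv R (Some j)) (fun y => z1 (Some k) (rot y))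
        (\sum_l Q j l * z2 k l (rot p)).
      apply: is_derive_rot.
      have := is_derive_space (rot p) (ev R j *m Q) (fun l => proj1 (hz2 k l)) (dz1 k).
      by under eq_bigr do rewrite evQ.
    exact: (is_derive_lincomb (index_enum _) (fun k => Q i k) dk).
have -> : z (rot q) = heatT (heatop (fun p => z (rot p)) Z1 (fun i => Z2 i i)) q.
  by rewrite (heatT_inv q (smooth_c21 sZ)).
rewrite /z; congr heatT; apply/funext => p.
rewrite -rF -[RHS]hop /heatop; congr (_ - _ + _).
rewrite /Z2.
(* Orthonormality of the columns of Q is the rotation invariance of the Laplacian. *)
have Qkl k l : \sum_i Q i k * Q i l = (k == l)%:R.
  have := congr1 (fun M : 'M[R]_n => M k l) QQ; rewrite !mxE => <-.
  by apply: eq_bigr => i _; rewrite mxE.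
under eq_bigr do under eq_bigr do rewrite mulr_sumr.
rewrite exchange_big/=; apply: eq_bigr => k _.
rewrite exchange_big/= (bigD1 k)//= [X in _ + X]big1 ?addr0 => [|l lk].
  under eq_bigr do rewrite mulrA.
  by rewrite -mulr_suml Qkl eqxx mul1r.
under eq_bigr do rewrite mulrA.
by rewrite -mulr_suml Qkl eq_sym (negbTE lk) mul0r.
Qed.

End rotation.

(** * Monotone iteration *)

Section householder.
Variables (R : realType) (n : nat).
Implicit Types x y v : 'rV[R]_n.

Lemma mulmx_tr_eq0 v : (v *m v^T) ord0 ord0 = 0 -> v = 0.
Proof.
rewrite mxE => /eqP; rewrite psumr_eq0 => [/allP h|i _]; last first.
  by rewrite mxE -expr2 sqr_ge0.
apply/rowP => i; have /implyP/(_ isT) := h i (mem_index_enum _).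
by rewrite !mxE mulf_eq0 orbb => /eqP.
Qed.

(** Reflection in the hyperplane orthogonal to x - y. It reduces radial symmetry to invariance under
    orthogonal matrices. *)
Lemma householder x y : enorm x = enorm y ->
  exists2 Q : 'M[R]_n, Q^T *m Q = 1%:M & x *m Q = y.
Proof.
have sq0 z : 0 <= \sum_i z ord0 i ^+ 2 :> R by apply: sumr_ge0 => i _; exact: sqr_ge0.
move=> /(congr1 (fun r => r ^+ 2)); rewrite !sqr_sqrtr// => e.
have xy : (x *m x^T) ord0 ord0 = (y *m y^T) ord0 ord0.
  by rewrite !mxE; transitivity (\sum_i x ord0 i ^+ 2); [|rewrite e];
     apply: eq_bigr => i _; rewrite mxE expr2.
have [->|xny] := eqVneq x y.
  by exists 1%:M; rewrite ?trmx1 ?mulmx1.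
pose v := x - y; pose s := (v *m v^T) ord0 ord0.
have s0 : s != 0.
  by apply: contraNneq xny => /mulmx_tr_eq0/eqP; rewrite subr_eq0.
have vv : v *m v^T = s%:M by rewrite [LHS]mx11_scalar.
(* Equal lengths give x . v = |v|^2 / 2, so that the reflection subtracts exactly v from x. *)
have xv : x *m v^T = (s / 2)%:M.
  rewrite [LHS]mx11_scalar; congr (_%:M).
  have yx : (y *m x^T) ord0 ord0 = (x *m y^T) ord0 ord0.
    by rewrite !mxE; apply: eq_bigr => i _; rewrite !mxE mulrC.
  rewrite /s /v linearB/= !mulmxBl !mulmxBr.
  move: xy yx; move: (x *m x^T) (y *m y^T) (y *m x^T) (x *m y^T) => a b c d.
  by rewrite !mxE => -> ->; field.
have xvy : x - v = y by rewrite /v subKr.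
clearbody s; clearbody v.
exists (1%:M - (2 / s) *: (v^T *m v)); last first.
  rewrite mulmxBr mulmx1 -scalemxAr mulmxA xv mul_scalar_mx scalerA.
  by rewrite (_ : 2 / s * (s / 2) = 1) ?scale1r//; field.
have -> : (1%:M - (2 / s) *: (v^T *m v))^T = 1%:M - (2 / s) *: (v^T *m v).
  apply/matrixP => i j; rewrite !mxE eq_sym; congr (_ - _ * _).
  by apply: eq_bigr => k _; rewrite ![v^T _ _]mxE mulrC.
rewrite mulmxBl mul1mx mulmxBr mulmx1 -scalemxAl -scalemxAr.
rewrite mulmxA -(mulmxA v^T v v^T) vv mul_mx_scalar -!scalemxAl !scalerA.
rewrite -addrA -opprD -scalerBl -scalerDl.
suff -> : 2 / s + (2 / s - 2 / s * (2 / s * s)) = 0 by rewrite scale0r subr0.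
by field.
Qed.

End householder.

Section monotone_iteration.
Variables (R : realType) (n : nat).
Local Notation E := 'rV[R]_n.
Local Notation X := ('rV[R]_n * R)%type.

(* [nl v - 11 v] is the reaction term [(1 - v^2) v]; the linear part makes [nl]
   nondecreasing on [-2, 2]. *)
Definition nl (v : R) := 12 * v - v ^+ 3.
Definition nl1 (v : R) := 12 - 3 * v ^+ 2.
Definition nl2 (v : R) := - 6 * v.

Lemma nl_mono u v : -2 <= u -> u <= v -> v <= 2 -> nl u <= nl v.
Proof. move=> u2 uv v2; rewrite /nl -subr_ge0; have : 0 <= 12 - (v^+2 + u * v + u ^+ 2) by nra.
  move=> h; have -> : 12 * v - v ^+ 3 - (12 * u - u ^+ 3) = (v - u) * (12 - (v^+2 + u * v + u ^+ 2)) by ring.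
  by rewrite mulr_ge0// subr_ge0. Qed.

(** [nl] is monotone with endpoint values -16 and 16. As [heatT] divides bounds by 11 and 16 / 11 <
    2, the iteration stays in [-2, 2]. *)
Lemma nl_bound v : `|v| <= 2 -> `|nl v| <= 16.
Proof.
rewrite !ler_norml => /andP[v1 v2].
have := @nl_mono (-2) v (lexx _) v1 v2; have := @nl_mono v 2 v1 v2 (lexx _).
by rewrite /nl => *; apply/andP; split; lra.
Qed.

Lemma nl1_bound v : `|v| <= 2 -> `|nl1 v| <= 12.
Proof. by rewrite !ler_norml /nl1 => /andP[v1 v2]; apply/andP; split; nra. Qed.

Lemma continuous_nl : continuous nl.
Proof.
move=> v; apply: cvgB; last exact: exprn_continuous.
by apply: cvgM; [exact: cvg_cst|exact: cvg_id].
Qed.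

Lemma continuous_nl1 : continuous nl1.
Proof.
move=> v; apply: cvgB; first exact: cvg_cst.
by apply: cvgM; [exact: cvg_cst|exact: exprn_continuous].
Qed.

Lemma bcx_nl (u : X -> R) : bcx u -> bcx (fun p => nl (u p)).
Proof.
move=> hu; rewrite (_ : (fun p => _) = fun p => 12 * u p + - (u p * (u p * u p))).
  by do ?[exact: hu|exact: bcx_cst|apply: bcx_mul|apply: bcx_opp|apply: bcx_add].
by apply/funext => p; rewrite /nl; ring.
Qed.

Lemma bcx_nl1 (u : X -> R) : bcx u -> bcx (fun p => nl1 (u p)).
Proof.
move=> hu; rewrite (_ : (fun p => _) = fun p => 12 + - (3 * (u p * u p))).
  by do ?[exact: hu|exact: bcx_cst|apply: bcx_mul|apply: bcx_opp|apply: bcx_add].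
by apply/funext => p; rewrite /nl1; ring.
Qed.

Lemma bcx_nl2 (u : X -> R) : bcx u -> bcx (fun p => nl2 (u p)).
Proof.
by move=> hu; apply: bcx_mul => //; exact: bcx_cst.
Qed.

Lemma is_derive_nl (u : X -> R) p v d : is_derive p v u d ->
  is_derive p v (fun q => nl (u q)) (nl1 (u p) * d).
Proof.
move=> du; rewrite (_ : (fun q => _) = (12 \*: u) - u ^+ 3); last first.
  by apply/funext => q.
by apply: is_derive_eq; rewrite /nl1 /GRing.scale/=; ring.
Qed.

Lemma is_derive_nl1 (u : X -> R) p v d : is_derive p v u d ->
  is_derive p v (fun q => nl1 (u q)) (nl2 (u p) * d).
Proof.
move=> du; rewrite (_ : (fun q => _) = cst 12 - (3 \*: (u ^+ 2))); last first.
  by apply/funext => q.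
by apply: is_derive_eq; rewrite /nl2 /GRing.scale/=; ring.
Qed.

Definition jet := ((X -> R) * (option 'I_n -> X -> R) * ('I_n -> 'I_n -> X -> R))%type.
Definition jsmooth (C : R) (s : jet) := smooth C s.1.1 s.1.2 s.2.

Definition jnl (s : jet) : jet :=
  ((fun p => nl (s.1.1 p)), (fun i p => nl1 (s.1.1 p) * s.1.2 i p),
   (fun i j p => nl2 (s.1.1 p) * s.1.2 (Some j) p * s.1.2 (Some i) p
      + nl1 (s.1.1 p) * s.2 i j p)).

Definition jheat (s : jet) : jet :=
  (heatT s.1.1, (fun i => heatT (s.1.2 i)), (fun i j => heatT (s.2 i j))).

Lemma jsmooth_nl C s : jsmooth C s -> exists D, jsmooth D (jnl s).
Proof.
move=> [h h1 h2 d d1].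
have bu : bcx s.1.1 by exists C.
have b1 i : bcx (s.1.2 i) by exists C; exact: h1.
have b2 i j : bcx (s.2 i j) by exists C; exact: h2.
apply: smooth_of_bcx => /=.
- exact: bcx_nl.
- by move=> i; apply: bcx_mul => //; exact: bcx_nl1.
- move=> i j; apply: bcx_add; last by apply: bcx_mul => //; exact: bcx_nl1.
  by do 2!(apply: bcx_mul => //); exact: bcx_nl2.
- by move=> i p; apply: is_derive_nl.
- move=> i j p.
  have e1 := is_derive_nl1 (d (Some j) p); have e2 := d1 i j p.
  apply: is_derive_eq; rewrite /GRing.scale/=; ring.
Qed.

Lemma jsmooth_heat C s : jsmooth C s -> exists D, jsmooth D (jheat s).
Proof. by move=> h; eexists; exact: smooth_heatT h. Qed.

End monotone_iteration.

Section past.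
Variables (R : realType) (n : nat).
Local Notation X := ('rV[R]_n * R)%type.

(* The barriers are ordered only for t <= 0: time is frozen at 0 to define the
   limit everywhere. *)
Definition past (p : X) : X := (p.1, Num.min p.2 0).

Lemma past_le0 p : (past p).2 <= 0. Proof. by rewrite /= ge_min lexx orbT. Qed.

Lemma past_id p : p.2 <= 0 -> past p = p.
Proof. by case: p => x t /= t0; rewrite /past/= min_l. Qed.

Lemma past_dist p q : `|past q - past p| <= `|q - p|.
Proof.
rewrite !prod_normE/= ge_max le_max lexx/= le_max; apply/orP; right.
case: p q => [x s] [y t] /=.
rewrite /Num.min; case: ifPn => ht; case: ifPn => hs //.
- rewrite -leNgt in hs; rewrite subr0 ltr0_norm// ltr0_norm; last lra.
  lra.
- rewrite -leNgt in ht; rewrite sub0r normrN ltr0_norm// ger0_norm; lra.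
- by rewrite subrr normr0.
Qed.

End past.

(** * Passage to the limit in the iteration *)

Section limit_solution.
Variables (R : realType) (n : nat).
Local Notation E := 'rV[R]_n.
Local Notation X := ('rV[R]_n * R)%type.
Variables (C0 : R) (s0 : jet R n) (Lo : X -> R) (L1 : option 'I_n -> X -> R)
  (L2 : 'I_n -> X -> R).
Hypotheses (hs0 : jsmooth C0 s0) (b0 : forall p, `|s0.1.1 p| <= 2).
Hypotheses (hLo : c21 C0 Lo L1 L2) (bLo : forall p, `|Lo p| <= 2).
Hypothesis super : forall p : X, p.2 <= 0 ->
  nl (s0.1.1 p) <= heatop s0.1.1 s0.1.2 (fun i => s0.2 i i) p.
Hypothesis sub : forall p : X, p.2 <= 0 -> heatop Lo L1 L2 p <= nl (Lo p).
Hypothesis LoU : forall p : X, p.2 <= 0 -> Lo p <= s0.1.1 p.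
Hypothesis radU : forall (x y : E) t, enorm x = enorm y -> s0.1.1 (x, t) = s0.1.1 (y, t).

Let it k : jet R n := iter k (fun s => jheat (jnl s)) s0.

Lemma it_smooth k : exists C, jsmooth C (it k).
Proof.
elim: k => [|k [C IH]]; first by exists C0.
by have [D hD] := jsmooth_nl IH; exact: jsmooth_heat hD.
Qed.

Lemma it_bcx k : bcx (it k).1.1.
Proof. by have [C []] := it_smooth k; exists C. Qed.

Lemma it_bound k p : `|(it k).1.1 p| <= 2.
Proof.
elim: k p => [|k IH] p //=.
have [C hC] := bcx_nl (it_bcx k).
rewrite (le_trans (heatT_norm_le p hC (fun q => nl_bound (IH q))))//.
lra.
Qed.

Lemma it_nl_bc k : bc 16 (fun p => nl ((it k).1.1 p)).
Proof.
have [C [cF _]] := bcx_nl (it_bcx k); split=> // p.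
exact/nl_bound/it_bound.
Qed.

Lemma nl_mono_norm u v : `|u| <= 2 -> `|v| <= 2 -> u <= v -> nl u <= nl v :> R.
Proof.
rewrite !ler_norml => /andP[u1 _] /andP[_ v1] uv; exact: nl_mono.
Qed.

(** The start is the supersolution inequality under the positive operator [heatT]: [heatT] of
    [heatop s0] is s0 itself. The induction step is the monotonicity of [nl]. *)
Lemma it_decr k p : p.2 <= 0 -> (it k.+1).1.1 p <= (it k).1.1 p.
Proof.
elim: k p => [|k IH] p p0.
  have [h h1 h2 _ _] := hs0.
  have [D hD] : bcx (heatop s0.1.1 s0.1.2 (fun i => s0.2 i i)).
    apply: bcx_add; last by apply: bcx_mul; [exact: bcx_cst|exists C0].
    apply: bcx_add; first by exists C0.
    by apply: bcx_opp; apply: bcx_sum => i; exists C0; exact: h2.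
  rewrite /= -[leRHS](heatT_inv p (smooth_c21 hs0)).
  have D0 := bc_ge0 hD.
  apply: (@heatT_le _ _ (16 + D)).
  - by apply: bcW (it_nl_bc 0); rewrite lerDl.
  - by apply: bcW hD; rewrite lerDr.
  - by move=> q qp; apply: super; exact: le_trans p0.
apply: (@heatT_le _ _ 16); [exact: (it_nl_bc k.+1)|exact: (it_nl_bc k)|] => q qp.
by apply: nl_mono_norm (it_bound k.+1 q) (it_bound k q) _; apply: IH; exact: le_trans p0.
Qed.

Lemma it_ge k p : p.2 <= 0 -> Lo p <= (it k).1.1 p.
Proof.
elim: k p => [|k IH] p p0; first exact: LoU.
have [h h1 h2 _ _] := hLo.
have [D hD] : bcx (heatop Lo L1 L2).
  apply: bcx_add; last by apply: bcx_mul; [exact: bcx_cst|exists C0].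
  apply: bcx_add; first by exists C0.
  by apply: bcx_opp; apply: bcx_sum => i; exists C0; exact: h2.
rewrite -(heatT_inv p hLo).
have D0 := bc_ge0 hD.
apply: (@heatT_le _ _ (16 + D)).
- by apply: bcW hD; rewrite lerDr.
- by apply: bcW (it_nl_bc k); rewrite lerDl.
- move=> q qp; have q0 := le_trans qp p0.
  by rewrite (le_trans (sub q0))//; apply: nl_mono_norm (bLo q) (it_bound k q) _; exact: IH.
Qed.

(** Functions of |x| are those invariant under orthogonal maps, and both [nl] and, by [heatT_rot],
    [heatT] preserve this invariance. *)
Lemma it_rad k (x y : E) t : enorm x = enorm y -> (it k).1.1 (x, t) = (it k).1.1 (y, t).
Proof.
elim: k x y t => [|k IH] x y t exy; first exact: radU.
have [Q QQ xQ] := householder exy.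
have [C hC] := it_smooth k; have [D hD] := jsmooth_nl hC.
have rF (q : X) : nl ((it k).1.1 (rot Q q)) = nl ((it k).1.1 q).
  congr nl; case: q => z s; apply: IH; rewrite /enorm; congr Num.sqrt.
  transitivity ((z *m Q *m (z *m Q)^T) ord0 ord0).
    by rewrite [RHS]mxE; apply: eq_bigr => i _; rewrite [_^T _ _]mxE expr2.
  rewrite trmx_mul -mulmxA (mulmxA Q) (mulmx1C QQ) mul1mx mxE.
  by apply: eq_bigr => i _; rewrite [_^T _ _]mxE expr2.
have := heatT_rot QQ hD rF (x, t); rewrite /rot/= xQ.
by move=> <-.
Qed.

Let N := @lam R n (fun q => 1 + `|q|).
Let B1 := 2 * 16 * N.
Let B2 := 2 * (12 * B1) * N.

(** The constants given by [it_smooth] depend on k. Writing the gradient as [heatD] of the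
    undifferentiated [nl u], which is bounded by 16, yields the bound [B1] for every k; the same
    trick one step later yields [B2] for second derivatives. *)
Lemma it_d1E k i p : (it k.+1).1.2 (Some i) p = heatD i (fun q => nl ((it k).1.1 q)) p.
Proof.
have [C hC] := it_smooth k; have [D [h h1 _ dh _]] := jsmooth_nl hC.
by rewrite (heatD_ibp p h (h1 (Some i)) (dh (Some i))).
Qed.

Lemma it_d2E k i j p :
  (it k.+1).2 i j p = heatD j (fun q => nl1 ((it k).1.1 q) * (it k).1.2 (Some i) q) p.
Proof.
have [C hC] := it_smooth k; have [D [_ h1 h2 _ dh]] := jsmooth_nl hC.
by rewrite (heatD_ibp p (h1 (Some i)) (h2 i j) (dh i j)).
Qed.

Lemma it_d1_bc k i : bc B1 ((it k.+1).1.2 (Some i)).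
Proof.
rewrite (_ : (it k.+1).1.2 _ = heatD i (fun q => nl ((it k).1.1 q))).
  exact: (conv_bc (kernel_kD R i) (it_nl_bc k)).
by apply/funext => p; exact: it_d1E.
Qed.

Lemma it_nl1_bc k i : bc (12 * B1) (fun q => nl1 ((it k.+1).1.1 q) * (it k.+1).1.2 (Some i) q).
Proof.
have [cd bd] := it_d1_bc k i; split=> [|p].
  have [C [cF _]] := bcx_nl1 (it_bcx k.+1).
  exact: continuous_mul.
by rewrite normrM ler_pM// nl1_bound// it_bound.
Qed.

Lemma it_d2_bc k i j : bc B2 ((it k.+2).2 i j).
Proof.
rewrite (_ : (it k.+2).2 i j =
    heatD j (fun q => nl1 ((it k.+1).1.1 q) * (it k.+1).1.2 (Some i) q)).
  exact: (conv_bc (kernel_kD R j) (it_nl1_bc k i)).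
by apply/funext => p; exact: it_d2E.
Qed.

(** The equation itself expresses the time derivative by quantities bounded uniformly in k, so no
    kernel estimate in time is required. *)
Lemma it_dtE k p : (it k.+1).1.2 None p =
  \sum_i (it k.+1).2 i i p - 11 * (it k.+1).1.1 p + nl ((it k).1.1 p).
Proof.
have [C hC] := it_smooth k; have [D hD] := jsmooth_nl hC.
have := heatop_heatT p hD; rewrite /heatop /= => <-.
ring.
Qed.

Let B := 2 + B1 + B2 + (n%:R * B2 + 22 + 16).

(** Each step gains one derivative, so two steps are spent before second derivatives obey a uniform
    bound. *)
Lemma it_smooth_uniform k : jsmooth B (it k.+2).
Proof.
have [C [h h1 h2 d d1]] := it_smooth k.+2.
have N0 : 0 <= N.
  rewrite /N (le_trans (normr_ge0 (@lam R n (fun _ => 0))))//.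
  have hz : lgrowth 1 (fun _ : (R * 'rV[R]_n)%type => 0 : R).
    by split=> [|q]; [exact: cst_continuous|rewrite normr0 mul1r addr_ge0].
  by have := gfun_norm_le (@gfun_lam R n) hz; rewrite mul1r.
have B10 : 0 <= B1 by rewrite /B1 !mulr_ge0.
have B20 : 0 <= B2 by rewrite /B2 !mulr_ge0.
have nB2 : 0 <= n%:R * B2 by rewrite mulr_ge0.
split => //.
- by apply: bcW (conj (proj1 h) (it_bound k.+2)); rewrite /B; lra.
- case=> [i|]; first by apply: bcW (it_d1_bc k.+1 i); rewrite /B; lra.
  split=> [|p]; first by case: (h1 None).
  rewrite it_dtE (le_trans (ler_normD _ _))// (le_trans (lerD (ler_normB _ _) (lexx _)))//.
  have s1 : `|\sum_i (it k.+2).2 i i p| <= n%:R * B2.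
    rewrite (le_trans (ler_norm_sum _ _ _))//.
    rewrite (@le_trans _ _ (\sum_(i < n) B2))//.
      by apply: ler_sum => i _; case: (it_d2_bc k i i).
    by rewrite sumr_const card_ord mulr_natl.
  have s2 := it_bound k.+2 p; have s3 := nl_bound (it_bound k.+1 p).
  rewrite normrM ger0_norm// /B; lra.
- by move=> i j; apply: bcW (it_d2_bc k i j); rewrite /B; lra.
Qed.

Definition ulim (p : X) : R := limn (fun k => (it k).1.1 (past p)).

Lemma it_cvg m p : p.2 <= 0 -> (fun k => (it (k + m)%N).1.1 p) @ \oo --> ulim p.
Proof.
move=> p0.
suff : (fun k => (it k).1.1 p) @ \oo --> ulim p.
  by move=> h; rewrite (cvg_shiftn m (fun k => (it k).1.1 p)).
rewrite /ulim past_id//; apply: nonincreasing_is_cvgn.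
  by apply/nonincreasing_seqP => k; exact: it_decr.
by exists (- 2) => _ [k _ <-]; have := it_bound k p; rewrite ler_norml => /andP[].
Qed.

Lemma ulim_past p : ulim (past p) = ulim p.
Proof. by rewrite /ulim (past_id (past_le0 p)). Qed.

Lemma ulim_bound p : `|ulim p| <= 2.
Proof.
rewrite -ulim_past; have p0 := past_le0 p.
have cv := it_cvg 0 p0.
have h k := it_bound (k + 0) (past p).
by rewrite ler_norml -(cvg_lim _ cv)//; apply/andP; split;
  [apply: limr_ge|apply: limr_le]; do ?[exact: cvgP cv];
  apply: nearW => k; move: (h k); rewrite ler_norml => /andP[].
Qed.

Lemma ulim_le p : p.2 <= 0 -> Lo p <= ulim p <= s0.1.1 p.
Proof.
move=> p0; have cv := it_cvg 0 p0.
rewrite -(cvg_lim _ cv)//; apply/andP; split.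
  by apply: limr_ge; [exact: cvgP cv|apply: nearW => k; exact: it_ge].
apply: limr_le; [exact: cvgP cv|apply: nearW => k; rewrite addn0].
elim: k => // k IH; exact: le_trans (it_decr k p0) IH.
Qed.

Lemma ulim_rad (x y : E) t : enorm x = enorm y -> ulim (x, t) = ulim (y, t).
Proof.
move=> exy; rewrite /ulim /past/=; congr (lim (_ @ \oo)).
by apply/funext => k; exact: it_rad.
Qed.

Lemma ulim_lipschitz p q : `|ulim q - ulim p| <= (1 + n%:R) * B * `|q - p|.
Proof.
rewrite -(ulim_past p) -(ulim_past q).
have cv : (fun k => `|(it (k + 2)%N).1.1 (past q) - (it (k + 2)%N).1.1 (past p)|) @ \oo -->
    `|ulim (past q) - ulim (past p)|.
  by apply: cvg_norm; apply: cvgB; apply: it_cvg; exact: past_le0.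
rewrite -(cvg_lim _ cv)//; apply: limr_le; first exact: cvgP cv.
apply: nearW => k; rewrite addn2.
have [h h1 h2 d d1] := it_smooth_uniform k.
rewrite (le_trans (lipschitz_of_partials (past p) (past q) h1 d))//.
rewrite ler_wpM2l ?past_dist// mulr_ge0 ?(bc_ge0 h)//; exact: addr_ge0.
Qed.

Lemma ulim_bc : bc 2 ulim.
Proof.
split; last exact: ulim_bound.
by apply: continuous_lipschitz => p q; exact: ulim_lipschitz.
Qed.

Lemma ulim_nl_bc : bc 16 (fun p => nl (ulim p)).
Proof.
split=> [|p]; last exact/nl_bound/ulim_bound.
by case: ulim_bc => cu _; apply: continuous_compf cu _; exact: continuous_nl.
Qed.

(** The derivatives of the limit are first defined by the formulas that the iterates obey. They are
    then continuous by construction, and the iterates' derivatives converge to them by dominated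
    convergence. *)
Definition ulim1 i := heatD i (fun p => nl (ulim p)).
Definition unl1 i p := nl1 (ulim p) * ulim1 i p.
Definition ulim2 i j := heatD j (unl1 i).
Definition ulimt p := \sum_i ulim2 i i p - 11 * ulim p + nl (ulim p).

Lemma ulim1_bc i : bc B1 (ulim1 i).
Proof. exact: (conv_bc (kernel_kD R i) ulim_nl_bc). Qed.

Lemma unl1_bc i : bc (12 * B1) (unl1 i).
Proof.
have [cd bd] := ulim1_bc i; have [cu bu] := ulim_bc.
split=> [|p]; last by rewrite normrM ler_pM// nl1_bound.
apply: continuous_mul => //.
by apply: continuous_compf cu _; exact: continuous_nl1.
Qed.

Lemma ulim2_bc i j : bc B2 (ulim2 i j).
Proof. exact: (conv_bc (kernel_kD R j) (unl1_bc i)). Qed.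

Lemma continuous_ulimt : continuous ulimt.
Proof.
apply: continuous_add; last by case: ulim_nl_bc.
apply: continuous_add; first by apply: continuous_sum => i; case: (ulim2_bc i i).
apply: continuous_opp; apply: continuous_mul; first exact: cst_continuous.
by case: ulim_bc.
Qed.

Lemma nl_cvg m p : p.2 <= 0 -> (fun k => nl ((it (k + m)%N).1.1 p)) @ \oo --> nl (ulim p).
Proof. by move=> p0; apply: continuous_cvg; [exact: continuous_nl|exact: it_cvg]. Qed.

Lemma it_d1_cvg m i p : p.2 <= 0 ->
  (fun k => (it (k + m).+1).1.2 (Some i) p) @ \oo --> ulim1 i p.
Proof.
move=> p0; under eq_fun do rewrite it_d1E.
apply: (conv_cvg (kernel_kD R i) (fun k => it_nl_bc (k + m)) ulim_nl_bc) => q qp.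
by apply: nl_cvg; exact: le_trans p0.
Qed.

Lemma it_d2_cvg i j p : p.2 <= 0 ->
  (fun k => (it k.+2).2 i j p) @ \oo --> ulim2 i j p.
Proof.
move=> p0; under eq_fun do rewrite it_d2E.
apply: (conv_cvg (kernel_kD R j) (fun k => it_nl1_bc k i) (unl1_bc i)) => q qp.
have q0 := le_trans qp p0.
apply: cvgM.
  apply: continuous_cvg; first exact: continuous_nl1.
  by have := it_cvg 1 q0; under eq_fun do rewrite addn1.
by have := @it_d1_cvg 0 i q q0; under eq_fun do rewrite addn0.
Qed.

Lemma it_dt_cvg p : p.2 <= 0 -> (fun k => (it k.+2).1.2 None p) @ \oo --> ulimt p.
Proof.
move=> p0; under eq_fun do rewrite it_dtE.
apply: cvgD; last by have := nl_cvg 1 p0; under eq_fun do rewrite addn1.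
apply: cvgB.
  elim: (index_enum _) => [|i r IH].
    by under eq_fun do rewrite big_nil; rewrite big_nil; exact: cvg_cst.
  rewrite big_cons (_ : (fun k => _) = fun k => (it k.+2).2 i i p + \sum_(j <- r) (it k.+2).2 j j p).
    by apply: cvgD => //; exact: it_d2_cvg.
  by apply/funext => k; rewrite big_cons.
apply: cvgM; first exact: cvg_cst.
by have := it_cvg 2 p0; under eq_fun do rewrite addn2.
Qed.

(** A line in a space direction keeps the time fixed, hence stays in t <= 0 where the iterates
    converge, and the limit theorem for derivatives applies on the whole line. *)
Lemma ulim_dx i (p : X) : p.2 <= 0 -> is_derive p (dirv R (Some i)) ulim (ulim1 i p).
Proof.
move=> p0; apply/is_derive_line0.
have q0 h : (p + h *: dirv R (Some i)).2 <= 0 by rewrite /= scaler0 addr0.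
have cl (F : X -> R) : continuous F -> continuous (fun h : R => F (p + h *: dirv R (Some i))).
  by move=> cF h; apply: continuous_comp; [exact: continuous_line|exact: cF].
have := @derivative_of_limit R B (fun k h => (it (k + 2)%N).1.1 (p + h *: dirv R (Some i)))
  (fun k h => (it (k + 2)%N).1.2 (Some i) (p + h *: dirv R (Some i)))
  (fun h => ulim (p + h *: dirv R (Some i)))
  (fun h => ulim1 i (p + h *: dirv R (Some i))) _ _ _ _ _ _ 0.
rewrite scale0r addr0; apply.
- move=> k x; rewrite addn2; have [_ _ _ d _] := it_smooth_uniform k.
  exact: is_derive_line.
- move=> k; rewrite addn2; have [_ h1 _ _ _] := it_smooth_uniform k.
  by apply: cl; case: (h1 (Some i)).
- move=> k x; rewrite addn2; have [_ h1 _ _ _] := it_smooth_uniform k.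
  by case: (h1 (Some i)).
- by apply: cl; case: (ulim1_bc i).
- by move=> x; exact: it_cvg.
- move=> x; under eq_fun do rewrite addnS.
  exact: it_d1_cvg.
Qed.

Lemma ulim_dxx i j (p : X) : p.2 <= 0 -> is_derive p (dirv R (Some j)) (ulim1 i) (ulim2 i j p).
Proof.
move=> p0; apply/is_derive_line0.
have q0 h : (p + h *: dirv R (Some j)).2 <= 0 by rewrite /= scaler0 addr0.
have cl (F : X -> R) : continuous F -> continuous (fun h : R => F (p + h *: dirv R (Some j))).
  by move=> cF h; apply: continuous_comp; [exact: continuous_line|exact: cF].
have := @derivative_of_limit R B (fun k h => (it k.+2).1.2 (Some i) (p + h *: dirv R (Some j)))
  (fun k h => (it k.+2).2 i j (p + h *: dirv R (Some j)))
  (fun h => ulim1 i (p + h *: dirv R (Some j)))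
  (fun h => ulim2 i j (p + h *: dirv R (Some j))) _ _ _ _ _ _ 0.
rewrite scale0r addr0; apply.
- move=> k x; have [_ _ _ _ d] := it_smooth_uniform k.
  exact: is_derive_line.
- move=> k; have [_ _ h2 _ _] := it_smooth_uniform k.
  by apply: cl; case: (h2 i j).
- move=> k x; have [_ _ h2 _ _] := it_smooth_uniform k.
  by case: (h2 i j).
- by apply: cl; case: (ulim2_bc i j).
- move=> x; have := @it_d1_cvg 1 i _ (q0 x); under eq_fun do rewrite addn1; exact.
- by move=> x; exact: it_d2_cvg.
Qed.

(** A line in the time direction leaves t <= 0, where [ulim] is frozen. Only increments up to time 0
    are therefore described, through a function A differentiable on the whole line. *)
Lemma ulim_dt (x : E) : exists A : R -> R,
  (forall s : R, is_derive s 1 A (ulimt (x, s))) /\ forall a b, a <= 0 -> b <= 0 -> ulim (x, b) - ulim (x, a) = A b - A a.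
Proof.
have cl (F : X -> R) : continuous F -> continuous (fun h : R => F (x, h)).
  move=> cF; apply: continuous_compf cF.
  by apply: continuous_pair; [exact: cst_continuous|move=> h; exact: cvg_id].
have [A dA] := antiderivative (cl _ continuous_ulimt).
exists A; split=> // a b a_le0 b_le0.
suff H c d : c <= d -> d <= 0 -> ulim (x, d) - ulim (x, c) = A d - A c.
  have [ab|/ltW ba] := leP a b; first exact: H.
  by rewrite -opprB (H b a)// opprB.
move=> cd d0.
have df k (s : R) : is_derive s 1 (fun h => (it k.+2).1.1 (x, h)) ((it k.+2).1.2 None (x, s)).
  have [_ _ _ d' _] := it_smooth_uniform k.
  move: (it k.+2) d' => J d'.
  have e h : (x, 0) + h *: dirv R None = (x, h) :> X.
    by apply/pair_equal_spec; rewrite /= scaler0 addr0 add0r scaler1.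
  have <- : (fun h => J.1.1 ((x, 0) + h *: dirv R None)) = (fun h => J.1.1 (x, h)).
    by apply/funext => h; rewrite e.
  by apply: is_derive_line; rewrite e; exact: d'.
apply: (@limit_of_derivatives R B (fun k h => (it k.+2).1.1 (x, h))
   (fun k h => (it k.+2).1.2 None (x, h)) (fun h => ulim (x, h)) (fun h => ulimt (x, h)) A c d cd df) => //.
- move=> k; have [_ h1 _ _ _] := it_smooth_uniform k.
  by apply: cl; case: (h1 None).
- move=> k s; have [_ h1 _ _ _] := it_smooth_uniform k.
  by case: (h1 None).
- exact: cl continuous_ulimt.
- move=> s /andP[_ sd].
  have : (x, s).2 <= 0 by exact: le_trans d0.
  by move=> /(it_cvg 2); under eq_fun do rewrite addn2.
- by move=> s /andP[_ sd]; apply: it_dt_cvg; exact: le_trans d0.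
Qed.

End limit_solution.

(** * From ordered barriers to an ancient solution *)

Section ancient_solution.
Variables (R : realType) (n : nat).
Local Notation E := 'rV[R]_n.
Local Notation X := ('rV[R]_n * R)%type.

Lemma past_incr_proper (t : R) : t <= 0 -> ProperFilter (past_incr t).
Proof.
move=> t0; split; last exact: within_filter.
rewrite /past_incr /within/= => /nbhs_ballP[e /= e0 he].
have := he (- (e / 2)); rewrite -ball_normE/= sub0r opprK.
apply=> //.
- by rewrite gtr0_norm ?divr_gt0// ltr_pdivrMr// ltr_pMr//; lra.
- by rewrite oppr_eq0 gt_eqF// divr_gt0.
- have : 0 < e / 2 by rewrite divr_gt0.
  lra.
Qed.

Lemma ancient_continuousE (g : E -> R -> R) (G : X -> R) : continuous G ->
  (forall x t, t <= 0 -> g x t = G (x, t)) -> ancient_continuous g.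
Proof.
move=> cG gG; rewrite /ancient_continuous.
apply: (@subspace_eq_continuous _ _ _ G); last exact: continuous_subspaceT.
by move=> [x t]; rewrite inE/= => t0; rewrite /from_subspace gG.
Qed.

Lemma is_derive_slice (F : X -> R) i x t d :
  is_derive (x, t) (dirv R (Some i)) F d -> is_derive x (ev R i) (fun y => F (y, t)) d.
Proof.
move/is_deriveP => h; apply/is_deriveP.
rewrite (_ : (fun h0 => _) = fun h0 => h0^-1 * (F (h0 *: dirv R (Some i) + (x, t)) - F (x, t)))//.
apply/funext => h0; congr (_ * (F _ - _)); apply/pair_equal_spec; split => //=.
by rewrite scaler0 add0r.
Qed.

Theorem ancient_solution (C0 : R) (s0 : jet R n) (Lo : X -> R)
    (L1 : option 'I_n -> X -> R) (L2 : 'I_n -> X -> R) :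
  jsmooth C0 s0 -> (forall p, `|s0.1.1 p| <= 2) ->
  c21 C0 Lo L1 L2 -> (forall p, `|Lo p| <= 2) ->
  (forall p : X, p.2 <= 0 ->
    nl (s0.1.1 p) <= heatop s0.1.1 s0.1.2 (fun i => s0.2 i i) p) ->
  (forall p : X, p.2 <= 0 -> heatop Lo L1 L2 p <= nl (Lo p)) ->
  (forall p : X, p.2 <= 0 -> Lo p <= s0.1.1 p) ->
  (forall (x y : E) t, enorm x = enorm y -> s0.1.1 (x, t) = s0.1.1 (y, t)) ->
  exists u : E -> R -> R,
    [/\ forall t : R, t <= 0 -> radially_symmetric (u ^~ t),
        ancient_allen_cahn u &
        forall x t, t <= 0 -> Lo (x, t) <= u x t <= s0.1.1 (x, t)].
Proof.
move=> hs0 b0 hLo bLo super sub LoU radU.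
pose U := ulim s0; pose U1 i := ulim1 s0 i; pose U2 i j := ulim2 s0 i j.
pose Ut := ulimt s0.
exists (fun x t => U (x, t)); split.
- by move=> t t0 x y exy; exact: (ulim_rad hs0 radU t exy).
- have dx1 i x t : t <= 0 -> is_derive x (delta_mx ord0 i) (fun y => U (y, t)) (U1 i (x, t)).
    move=> t0; apply: is_derive_slice.
    exact: (ulim_dx hs0 b0 super i (p := (x, t)) t0).
  have dx1E i t : t <= 0 -> dx i (fun y => U (y, t)) = fun x => U1 i (x, t).
    by move=> t0; apply/funext => x; rewrite /dx; have [_] := dx1 i x t t0.
  have dx2 i j x t : t <= 0 -> is_derive x (delta_mx ord0 j) (fun y => U1 i (y, t)) (U2 i j (x, t)).
    move=> t0; apply: is_derive_slice.
    exact: (ulim_dxx hs0 b0 super i j (p := (x, t)) t0).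
  have dtc x t : t <= 0 -> dt_quotient (fun x t => U (x, t)) x t @ past_incr t --> Ut (x, t).
    move=> t0; have [A [dA AU]] := ulim_dt hs0 b0 super x.
    have PF := past_incr_proper t0.
    (* For admissible increments U and A have the same difference quotients; A being differentiable
       everywhere, t = 0 needs no separate treatment. *)
    have : (fun h => h^-1 * (A (h *: (1 : R) + t) - A t)) @ past_incr t --> Ut (x, t).
      by apply: cvg_within_filter; apply/is_deriveP.
    apply: cvg_trans; apply: near_eq_cvg.
    rewrite /past_incr; near=> h.
    rewrite /dt_quotient AU ?scaler1 1?(addrC h)//.
    by near: h; exact: withinT.
  have dtE x t : t <= 0 -> dt (fun x t => U (x, t)) x t = Ut (x, t).
    move=> t0; have PF := past_incr_proper t0.
    by apply: cvg_lim => //; exact: dtc.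
  split; last first.
    move=> x t t0; rewrite dtE// /laplacian.
    under eq_bigr do (rewrite dx1E//; rewrite /dx).
    rewrite (eq_bigr (fun i => U2 i i (x, t))); last first.
      by move=> i _; have [_] := dx2 i i x t t0.
    by rewrite /Ut /ulimt /nl -/U; ring.
  split.
  + apply: (@ancient_continuousE _ U) => //.
    by have [] := ulim_bc hs0 b0 super.
  + split; first by move=> x t t0; apply/cvg_ex; exists (Ut (x, t)); exact: dtc.
    apply: (@ancient_continuousE _ Ut) => //.
    exact: (continuous_ulimt hs0 b0 super).
  + move=> i; split; first by move=> x t t0; have [] := dx1 i x t t0.
    apply: (@ancient_continuousE _ (U1 i)) => //.
      by have [] := ulim1_bc hs0 b0 super i.
    by move=> x t t0; rewrite dx1E.
  + move=> i j; split.
      by move=> x t t0; rewrite /dx_derivable dx1E//; have [] := dx2 i j x t t0.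
    apply: (@ancient_continuousE _ (U2 i j)) => //.
      by have [] := ulim2_bc hs0 b0 super i j.
    by move=> x t t0; rewrite dx1E// /dx; have [_] := dx2 i j x t t0.
- move=> x t t0; exact: (ulim_le hs0 b0 hLo bLo super sub LoU (p := (x, t)) t0).
Unshelve. all: by end_near. Qed.

End ancient_solution.

(** * The heteroclinic and its correctors *)

Section heteroclinic_facts.
Variable R : realType.
Local Notation k := (Num.sqrt (2 : R)).
Local Notation w := (@heteroclinic R).

Lemma sqrt2_gt0 : 0 < k. Proof. by rewrite sqrtr_gt0. Qed.

Lemma sqrt2_sqr : k ^+ 2 = 2. Proof. by rewrite sqr_sqrtr. Qed.

Lemma sqrt2_ge1 : 1 <= k.
Proof. by rewrite -(@ler_sqr R) ?nnegrE ?ltW ?sqrt2_gt0// sqrt2_sqr expr1n; lra. Qed.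

Lemma sqrt2_inv : k^-1 = k / 2.
Proof.
have k0 := lt0r_neq0 sqrt2_gt0; apply: (mulfI k0); rewrite divff//.
by rewrite mulrA -expr2 sqrt2_sqr divff.
Qed.

(* This is sech^2 (s / sqrt 2) = sqrt 2 * w' s. *)
Definition sech2 (s : R) : R := 1 - w s ^+ 2.

Lemma is_derive_expl (c s : R) : is_derive s 1 (fun x => expR (c * x)) (c * expR (c * s)).
Proof.
have h : is_derive s 1 (fun x : R => c * x) c.
  by apply: is_derive_eq; rewrite /GRing.scale/= mulr1.
have := @is_derive1_comp _ expR (fun x => c * x) s _ _ (is_derive_expR (c * s)) h.
by move=> d; apply: is_derive_eq; rewrite mulrC.
Qed.

Lemma heteroclinicE (s : R) : w s = (expR (k^-1 * s) - expR (- k^-1 * s)) /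
   (expR (k^-1 * s) + expR (- k^-1 * s)).
Proof. by rewrite /heteroclinic /tanh !mulNr (mulrC s). Qed.

Lemma is_derive_w (s : R) : is_derive s 1 w (k^-1 * sech2 s).
Proof.
have d1 := is_derive_expl k^-1 s; have d2 := is_derive_expl (- k^-1) s.
have p0 : 0 < expR (k^-1 * s) + expR (- k^-1 * s) by rewrite addr_gt0 ?expR_gt0.
have n0 := lt0r_neq0 p0.
have -> : w = (fun x => (expR (k^-1 * x) - expR (- k^-1 * x)) *
   (expR (k^-1 * x) + expR (- k^-1 * x))^-1).
  by apply/funext => x; rewrite heteroclinicE.
have d3 : is_derive s 1 (fun x => (expR (k^-1 * x) + expR (- k^-1 * x))^-1)
   (- (expR (k^-1 * s) + expR (- k^-1 * s)) ^- 2 *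
     (k^-1 * expR (k^-1 * s) + - k^-1 * expR (- k^-1 * s))).
  have d4 : is_derive s 1 (fun x => expR (k^-1 * x) + expR (- k^-1 * x))
     (k^-1 * expR (k^-1 * s) + - k^-1 * expR (- k^-1 * s)).
    exact: is_deriveD.
  by have := is_deriveV (n0 : (fun x => expR (k^-1 * x) + expR (- k^-1 * x)) s != 0) d4.
apply: is_derive_eq; rewrite /sech2 heteroclinicE /GRing.scale/=.
move: (expR (k^-1 * s)) (expR (- k^-1 * s)) n0 => a b n0; field.
by rewrite n0 lt0r_neq0 ?sqrt2_gt0.
Qed.

Lemma sech2E s : sech2 s = 4 / (expR (k^-1 * s) + expR (- k^-1 * s)) ^+ 2.
Proof.
have p0 : 0 < expR (k^-1 * s) + expR (- k^-1 * s) by rewrite addr_gt0 ?expR_gt0.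
have n0 := lt0r_neq0 p0.
rewrite /sech2 heteroclinicE.
have : expR (k^-1 * s) * expR (- k^-1 * s) = 1.
  by rewrite -expRD mulNr subrr expR0.
move: (expR (k^-1 * s)) (expR (- k^-1 * s)) n0 => a b n0 ab.
rewrite -[4]mulr1 -[X in _ = _ * X / _]ab; field.
by rewrite n0.
Qed.

Lemma sech2_gt0 s : 0 < sech2 s.
Proof. by rewrite sech2E divr_gt0// exprn_gt0// addr_gt0// expR_gt0. Qed.

Lemma w_norm_lt1 s : `|w s| < 1.
Proof.
have := sech2_gt0 s; rewrite /sech2 => h.
rewrite -(@ltr_sqr R) ?nnegrE// expr1n real_normK ?num_real//; lra.
Qed.

Lemma w_odd s : w (- s) = - w s.
Proof.
rewrite !heteroclinicE mulrNN (_ : k^-1 * - s = - k^-1 * s) ?mulrN ?mulNr//.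
by rewrite -[RHS]mulNr opprB [X in _ = _ / X]addrC.
Qed.

Lemma sech2_even s : sech2 (- s) = sech2 s.
Proof. by rewrite /sech2 w_odd sqrrN. Qed.

Lemma is_derive_sech2 (s : R) : is_derive s 1 sech2 (- k * w s * sech2 s).
Proof.
have d := is_derive_w s.
have -> : sech2 = cst 1 - w ^+ 2 by apply/funext => x.
apply: is_derive_eq; rewrite /GRing.scale/= sqrt2_inv -[(cst 1 - w ^+ 2) s]/(sech2 s); by field.
Qed.

Lemma sech2_le_exp s : sech2 s <= 4 * expR (- `|s|).
Proof.
wlog s0 : s / 0 <= s.
  move=> h; have [/h//|s0] := leP 0 s.
  by rewrite -sech2_even -(normrN s); apply: h; lra.
rewrite sech2E ger0_norm// expRN ler_pdivrMr ?exprn_gt0 ?addr_gt0 ?expR_gt0//.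
rewrite -mulrA ler_peMr// ler_pdivlMl ?expR_gt0// mulr1.
rewrite (@le_trans _ _ (expR (k^-1 * s) ^+ 2))//.
  rewrite -expRM_natl ler_expR mulrA ler_peMl//.
  by rewrite sqrt2_inv mulrC divfK// sqrt2_ge1.
by rewrite ler_sqr ?nnegrE ?addr_ge0 ?expR_ge0// lerDl expR_ge0.
Qed.

Lemma w_mono s t : s <= t -> w s <= w t.
Proof.
move=> st; have [r /andP[r0 r1] e] := mvt_global is_derive_w s t.
rewrite -subr_ge0 e mulr_ge0 ?subr_ge0// mulr_ge0 ?invr_ge0 ?ltW ?sqrt2_gt0 ?sech2_gt0//.
Qed.

Lemma w0 : w 0 = 0.
Proof. by rewrite heteroclinicE !mulr0 subrr mul0r. Qed.

(** Beyond 4 one has sqrt 2 w >= 1, which makes the comparison function of [antiderivative_tail]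
    decrease fast enough. *)
Lemma w_ge s : 4 <= s -> k^-1 <= w s.
Proof.
move=> s4; have k0 := sqrt2_gt0.
have ws0 : 0 <= w s by rewrite -w0 w_mono//; lra.
rewrite -(@ler_sqr R) ?nnegrE ?invr_ge0 ?(ltW k0)// exprVn sqrt2_sqr.
have := sech2_le_exp s; rewrite ger0_norm; last lra.
have e8 : 8 <= expR s.
  rewrite (@le_trans _ _ (expR 4))// ?ler_expR//.
  have := @expR_ge1Dxn R 4 1 (ler0n _ _).
  by rewrite (_ : 2`! = 2)%N//; lra.
have : expR (- s) <= 8^-1 by rewrite expRN lef_pV2// posrE ?expR_gt0.
by rewrite /sech2; lra.
Qed.

(** Decay faster than every power, so that the class is stable under products with functions of
    polynomial growth. *)
Definition decay (f : R -> R) := forall m : nat, exists C, forall s, `|f s| * (1 + `|s|) ^+ m <= C.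
Definition polyg (f : R -> R) := exists (C : R) (m : nat), forall s, `|f s| <= C * (1 + `|s|) ^+ m.

Lemma decay_sech2 : decay sech2.
Proof.
case=> [|m].
  exists 1 => s; rewrite expr0 mulr1 ger0_norm ?(ltW (sech2_gt0 s))//.
  by rewrite /sech2; have := sqr_ge0 (w s); lra.
exists (4 * ((m.+1)`!%:R * expR 1)) => s.
rewrite ger0_norm ?(ltW (sech2_gt0 s))// (@le_trans _ _ (4 * expR (- `|s|) * (1 + `|s|) ^+ m.+1))//.
  by rewrite ler_wpM2r ?sech2_le_exp// exprn_ge0// addr_ge0.
rewrite -mulrA ler_wpM2l// expRN ler_pdivrMl ?expR_gt0// mulrCA -expRD (addrC _ 1).
have h : 0 <= 1 + `|s| by rewrite addr_ge0.
have := expR_ge1Dxn m h => h2.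
rewrite -ler_pdivrMl ?ltr0n ?fact_gt0// mulrC; lra.
Qed.

Lemma decayM f g : decay f -> polyg g -> decay (fun s => f s * g s).
Proof.
move=> df [C [m gC]] j; have [D hD] := df (m + j)%N.
have C0 : 0 <= C by have := gC 0; rewrite normr0 addr0 expr1n mulr1; apply: le_trans.
exists (C * D) => s; rewrite normrM.
rewrite (@le_trans _ _ (`|f s| * (C * (1 + `|s|) ^+ m) * (1 + `|s|) ^+ j))//.
  by rewrite ler_wpM2r ?exprn_ge0 ?addr_ge0// ler_wpM2l.
by rewrite mulrCA -!mulrA -exprD ler_wpM2l.
Qed.

Lemma polygM f g : polyg f -> polyg g -> polyg (fun s => f s * g s).
Proof.
move=> [C [m fC]] [D [j gD]]; exists (C * D), (m + j)%N => s.
by rewrite normrM exprD mulrACA ler_pM.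
Qed.

Lemma polygD f g : polyg f -> polyg g -> polyg (fun s => f s + g s).
Proof.
move=> [C [m fC]] [D [j gD]]; exists (C + D), (m + j)%N => s.
have C0 : 0 <= C by have := fC 0; rewrite normr0 addr0 expr1n mulr1; apply: le_trans.
have D0 : 0 <= D by have := gD 0; rewrite normr0 addr0 expr1n mulr1; apply: le_trans.
have h : 1 <= 1 + `|s| by rewrite lerDl.
rewrite (le_trans (ler_normD _ _))// mulrDl lerD//.
  by rewrite (le_trans (fC s))// ler_wpM2l// ler_weXn2l// leq_addr.
by rewrite (le_trans (gD s))// ler_wpM2l// ler_weXn2l// leq_addl.
Qed.

Lemma polyg_cst c : polyg (fun _ => c).
Proof. by exists `|c|, 0 => s; rewrite expr0 mulr1. Qed.

Lemma polyg_id : polyg id.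
Proof. by exists 1, 1 => s; rewrite expr1 mul1r lerDr. Qed.

Lemma polyg_w : polyg w.
Proof. by exists 1, 0 => s; rewrite expr0 mulr1 ltW// w_norm_lt1. Qed.

Lemma polyg_antiderivative h g : (forall s : R, is_derive s 1 h (g s)) -> polyg g -> polyg h.
Proof.
move=> dh [C [m gC]].
have C0 : 0 <= C by have := gC 0; rewrite normr0 addr0 expr1n mulr1; apply: le_trans.
exists (`|h 0| + C), m.+1 => s.
have [r /andP[r0 r1] e] := mvt_global dh 0 s; rewrite !subr0 add0r in e.
have h1 : 1 <= 1 + `|s| by rewrite lerDl.
have -> : h s = h 0 + g (r * s) * s by rewrite -e addrC subrK.
rewrite (le_trans (ler_normD _ _))// mulrDl lerD//.
  by rewrite ler_peMr// exprn_ege1.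
rewrite normrM exprSr mulrA ler_pM ?lerDr// (le_trans (gC _))// ler_wpM2l//.
rewrite lerXn2r ?nnegrE ?addr_ge0// lerD2l normrM ger0_norm// ler_piMl//.
Qed.

End heteroclinic_facts.

Section correctors.
Variable R : realType.
Local Notation k := (Num.sqrt (2 : R)).
Local Notation w := (@heteroclinic R).
Local Notation S := (@sech2 R).

Lemma is_derive_sech2_sqr (s : R) :
  is_derive s 1 (fun x => S x ^+ 2) (- (2 * k * w s) * S s ^+ 2).
Proof.
have d := is_derive_sech2 s.
have -> : (fun x => S x ^+ 2) = S ^+ 2 by apply/funext => x.
by apply: is_derive_eq; rewrite /GRing.scale/=; ring.
Qed.

(* [K = C (1 + s^2) sech^4] decreases fast enough that [G - K] increases and
   [G + K] decreases; their common limit is [L]. *)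
Lemma antiderivative_tail (C : R) (p G : R -> R) :
  (forall s, `|p s| <= C * (1 + s ^+ 2)) ->
  (forall s : R, is_derive s 1 G (p s * S s ^+ 2)) ->
  exists L, forall s, 4 <= s -> `|G s - L| <= C * (1 + s ^+ 2) * S s ^+ 2.
Proof.
move=> pC dG.
have C0 : 0 <= C.
  by have := pC 0; rewrite expr0n/= addr0 mulr1; apply: le_trans.
pose K s := C * (1 + s ^+ 2) * S s ^+ 2.
pose K' s := C * (2 * s - 2 * k * w s * (1 + s ^+ 2)) * S s ^+ 2.
have dK (s : R) : is_derive s 1 K (K' s).
  have d := is_derive_sech2_sqr s.
  have d2 : is_derive s 1 (fun x : R => C * (1 + x ^+ 2)) (C * (2 * s)).
    by apply: is_derive_eq; rewrite /GRing.scale/=; ring.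
  by apply: is_derive_eq; rewrite /GRing.scale/= /K'; ring.
have K'le s : 4 <= s -> `|p s * S s ^+ 2| <= - K' s.
  move=> s4; rewrite normrM (ger0_norm (sqr_ge0 _)) /K' -mulNr ler_wpM2r ?sqr_ge0//.
  rewrite (le_trans (pC s))// -mulrN ler_wpM2l//.
  have := w_ge s4; rewrite -(ler_pM2l (sqrt2_gt0 R)) divff ?lt0r_neq0 ?sqrt2_gt0// => kw.
  have : 0 <= 1 + s ^+ 2 by rewrite addr_ge0 ?sqr_ge0.
  have := sqr_ge0 (s - 1); nra.
(* e = 1 says that G - K increases, e = -1 that G + K decreases. *)
have step (e : R) s t : `|e| = 1 -> 4 <= s -> s <= t ->
    G s * e - K s <= G t * e - K t.
  move=> e1 s4 st.
  have dH (x : R) : is_derive x 1 (fun y => G y * e - K y) (p x * S x ^+ 2 * e - K' x).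
    have d1 := dG x; have d2 := dK x.
    by apply: is_derive_eq; rewrite /GRing.scale/=; ring.
  have [r /andP[r0 r1] e2] := mvt_global dH s t.
  rewrite -subr_ge0 e2 mulr_ge0 ?subr_ge0//.
  have x4 : 4 <= s + r * (t - s) by rewrite (le_trans s4)// lerDl mulr_ge0// subr_ge0.
  have := K'le _ x4; rewrite -(mulr1 `|p _ * _|) -e1 -normrM ler_norml => /andP[h _].
  lra.
have s1 s t : 4 <= s -> s <= t -> G s - K s <= G t - K t.
  by move=> s4 st; have := step 1 s t (normr1 _) s4 st; rewrite !mulr1.
have s2 s t : 4 <= s -> s <= t -> G t + K t <= G s + K s.
  by move=> s4 st; have := step (-1) s t (normrN1 _) s4 st; rewrite !mulrN1; lra.
have K0 s : 0 <= K s by rewrite /K mulr_ge0 ?sqr_ge0// mulr_ge0// addr_ge0// sqr_ge0.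
pose A := [set G s - K s | s in [set s | 4 <= s]].
have mp s t : 4 <= s -> 4 <= t -> G s - K s <= G t + K t.
  move=> s4 t4; have [st|ts] := leP s t.
    by have := s1 s t s4 st; have := K0 t; lra.
  by have := s2 t s t4 (ltW ts); have := K0 s; lra.
(* Every value of G - K lies below every value of G + K, so the supremum of the former is within K
   of G at each point. *)
exists (sup A) => s s4; rewrite ler_distl; apply/andP; split.
  have : sup A <= G s + K s.
    apply: ge_sup; first by exists (G 4 - K 4); exists 4 => //=.
    by move=> _ [t /= t4 <-]; exact: mp.
  by rewrite -/(K s); lra.
have : G s - K s <= sup A.
  apply: ub_le_sup; last by exists s.
  by exists (G 4 + K 4) => _ [t /= t4 <-]; apply: mp.
by rewrite -/(K s); lra.
Qed.

(** sech^4 is the integrating factor: its logarithmic derivative is - 2 sqrt 2 w, so g = G / sech^4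
    solves the equation. Outside [-4, 4] the assumed decay of G bounds g by a quadratic, inside
    compactness does. *)
Lemma bounded_solution (C : R) (p G : R -> R) : continuous G ->
  (forall s, 4 <= `|s| -> `|G s| <= C * (1 + s ^+ 2) * S s ^+ 2) ->
  (forall s : R, is_derive s 1 G (p s * S s ^+ 2)) ->
  exists g : R -> R, (forall s : R, is_derive s 1 g (2 * k * w s * g s + p s)) /\ polyg g.
Proof.
move=> cG GC dG; exists (fun s => G s * (S s ^+ 2)^-1).
have S0 s : S s ^+ 2 != 0 by rewrite expf_neq0// lt0r_neq0// sech2_gt0.
have dg (s : R) : is_derive s 1 (fun s => G s * (S s ^+ 2)^-1)
    (2 * k * w s * (G s * (S s ^+ 2)^-1) + p s).
  have d1 := dG s; have d2 := is_deriveV (S0 s : (fun x => S x ^+ 2) s != 0) (is_derive_sech2_sqr s).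
  by apply: is_derive_eq; rewrite /GRing.scale/=; field; rewrite lt0r_neq0// sech2_gt0.
split=> //.
have cg : continuous (fun s => `|G s * (S s ^+ 2)^-1|).
  move=> s; apply: (@continuous_comp _ _ _ (fun s => G s * (S s ^+ 2)^-1) (fun x : R => `|x|)).
    exact: is_derive_continuous (dg s).
  exact: norm_continuous.
have m44 : (-4 : R) <= 4 by lra.
have [c _ cmax] := EVT_max m44 (continuous_subspaceT cg).
exists (`|G c * (S c ^+ 2)^-1| + `|C|), 2 => s.
have h1 : 1 <= (1 + `|s|) ^+ 2 by rewrite exprn_ege1// lerDl.
have h2 : 1 + s ^+ 2 <= (1 + `|s|) ^+ 2.
  by rewrite -(real_normK (num_real s)); have := normr_ge0 s; nra.
have [s4|s4] := leP 4 `|s|.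
  rewrite mulrDl (le_trans (y := `|C| * (1 + `|s|) ^+ 2))//; last first.
    by rewrite lerDr mulr_ge0// exprn_ge0// addr_ge0.
  rewrite normrM normfV (ger0_norm (sqr_ge0 _)) ler_pdivrMr ?exprn_gt0 ?sech2_gt0//.
  rewrite (le_trans (GC s s4))// ler_wpM2r ?sqr_ge0//.
  rewrite (@le_trans _ _ (`|C| * (1 + s ^+ 2)))//.
    by rewrite ler_wpM2r ?ler_norm// addr_ge0// sqr_ge0.
  by rewrite ler_wpM2l.
rewrite mulrDl (@le_trans _ _ (`|G c * (S c ^+ 2)^-1|))//.
  by apply: cmax; rewrite in_itv/= -ler_norml ltW.
by rewrite (@le_trans _ _ (`|G c * (S c ^+ 2)^-1| * (1 + `|s|) ^+ 2))//
  ?ler_peMr// lerDl mulr_ge0// exprn_ge0// addr_ge0.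
Qed.

Lemma derivative0_cst (f : R -> R) : (forall s : R, is_derive s 1 f 0) ->
  forall s, f s = f 0.
Proof.
move=> df s; have [r _ e] := mvt_global df 0 s.
by apply/eqP; rewrite -subr_eq0 e mul0r.
Qed.

Lemma is_derive_oppf (f : R -> R) (s d : R) :
  is_derive (- s) 1 f d -> is_derive s 1 (fun x => f (- x)) (- d).
Proof.
move=> df; have h3 : is_derive s 1 (f \o (fun y => - y)) (d * - 1).
  exact: is_derive1_comp.
by apply: is_derive_eq; rewrite mulrN1.
Qed.

Lemma continuous_sech2 : continuous S.
Proof. by move=> s; exact: is_derive_continuous (is_derive_sech2 s). Qed.

(* Reduction of order: f = h w' solves f'' + (1 - 3 w^2) f = p w' as soon as g = h'
   solves g' = 2 sqrt 2 w g + p.  It grows polynomially only if p is orthogonal to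
   w'^2; this holds for p = s by parity and fixes [b] in [even_corrector]. *)
Lemma odd_corrector : exists g : R -> R,
  (forall s : R, is_derive s 1 g (2 * k * w s * g s + s)) /\ polyg g.
Proof.
have cp : continuous (fun s : R => s * S s ^+ 2).
  apply: continuous_mul; first by move=> s; exact: cvg_id.
  exact: (continuous_compf continuous_sech2 (@exprn_continuous R 2)).
have [A dA] := antiderivative cp.
have evenA s : A (- s) = A s.
  have e (x : R) : is_derive x 1 (fun x => A (- x) - A x) 0.
    have d1 := is_derive_oppf (dA (- x)); have d2 := dA x.
    by apply: is_derive_eq; rewrite sech2_even; ring.
  by have := derivative0_cst e s; rewrite oppr0 subrr => /eqP; rewrite subr_eq0 => /eqP.
have h1 (s : R) : `|s| <= 1 * (1 + s ^+ 2).
  by rewrite mul1r -(real_normK (num_real s)); have := sqr_ge0 (`|s| - 1); have := sqr_ge0 `|s|; nra.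
(* The integrand is odd, so A is even and has the same limit L at both ends; subtracting L gives the
   decay that [bounded_solution] asks for. *)
have [L hL] := antiderivative_tail h1 dA.
have dG (s : R) : is_derive s 1 (fun s => A s - L) (s * S s ^+ 2).
  by have d := dA s; apply: is_derive_eq; rewrite subr0.
apply: (@bounded_solution 1 id (fun s => A s - L)) => //.
- by move=> s; exact: is_derive_continuous (dG s).
- move=> s; have [s0|s0] := leP 0 s.
    by rewrite ger0_norm//; exact: hL.
  rewrite ltr0_norm// => s4; rewrite -evenA -sech2_even -(sqrrN s); exact: hL.
Qed.

Lemma even_corrector : exists (b : R) (g : R -> R),
  (forall s : R, is_derive s 1 g (2 * k * w s * g s + (b - s ^+ 2))) /\ polyg g.
Proof.
have cp : continuous (fun s : R => s ^+ 2 * S s ^+ 2).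
  apply: continuous_mul; first exact: exprn_continuous.
  exact: (continuous_compf continuous_sech2 (@exprn_continuous R 2)).
have [A0 dA0] := antiderivative cp.
pose A s := A0 s - A0 0.
have dA (s : R) : is_derive s 1 A (s ^+ 2 * S s ^+ 2).
  by have d := dA0 s; apply: is_derive_eq; rewrite subr0.
have oddA s : A (- s) = - A s.
  have e (x : R) : is_derive x 1 (fun x => A (- x) + A x) 0.
    have d1 := is_derive_oppf (dA (- x)); have d2 := dA x.
    by apply: is_derive_eq; rewrite sech2_even sqrrN; ring.
  have := derivative0_cst e s; rewrite oppr0 (_ : A 0 = 0) ?addr0; last by rewrite /A subrr.
  by move=> /eqP; rewrite addr_eq0 => /eqP.
have h1 (s : R) : `|s ^+ 2| <= 1 * (1 + s ^+ 2).
  by rewrite mul1r ger0_norm ?sqr_ge0// lerDr.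
have [L hL] := antiderivative_tail h1 dA.
(* An explicit odd antiderivative of sech^4, with limit [k * (2 / 3)] at +oo. *)
pose J s := k * (w s - w s ^+ 3 / 3).
have dJ (s : R) : is_derive s 1 J (S s ^+ 2).
  have d := is_derive_w s.
  rewrite (_ : J = k \*: (w - 3^-1 \*: (w ^+ 3))); last first.
    by apply/funext => x; rewrite /J /GRing.scale/= mulrC [in LHS](mulrC _ 3^-1) mulrC.
  apply: is_derive_eq; rewrite /GRing.scale/= /sech2; field.
  by rewrite lt0r_neq0// sqrt2_gt0.
(* Orthogonality of b - s^2 to w'^2: b J and A have the same limit at +oo and, both being odd, also
   at -oo. *)
pose b := L / (k * (2 / 3)).
have k0 := lt0r_neq0 (sqrt2_gt0 R).
have bL : b * (k * (2 / 3)) = L by rewrite /b divfK// mulf_neq0//; lra.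
exists b.
pose G s := b * J s - A s.
have dG (s : R) : is_derive s 1 G ((b - s ^+ 2) * S s ^+ 2).
  have d1 := dJ s; have d2 := dA s.
  by apply: is_derive_eq; rewrite /GRing.scale/=; ring.
have GC s : 4 <= s -> `|G s| <= (`|b| * k + 1) * (1 + s ^+ 2) * S s ^+ 2.
  move=> s4; have -> : G s = b * (J s - k * (2 / 3)) - (A s - L).
    by rewrite /G -bL; ring.
  rewrite (le_trans (ler_normB _ _))//.
  rewrite (_ : (`|b| * k + 1) * (1 + s ^+ 2) * S s ^+ 2 =
    `|b| * k * (1 + s ^+ 2) * S s ^+ 2 + 1 * (1 + s ^+ 2) * S s ^+ 2); last by ring.
  apply: lerD; last exact: hL.
  have k1 := ltW (sqrt2_gt0 R).
  suff hJ : `|J s - k * (2 / 3)| <= k * S s ^+ 2.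
    rewrite normrM -2![leRHS]mulrA ler_wpM2l// (le_trans hJ)// ler_wpM2l//.
    by rewrite ler_peMl ?sqr_ge0// lerDl sqr_ge0.
  (* The polynomial w - w^3 / 3 - 2 / 3 has a double zero at w = 1, hence J approaches its limit as
     fast as (1 - w)^2 <= sech^4. *)
  have -> : J s - k * (2 / 3) = - (k * ((1 - w s) ^+ 2 * ((w s + 2) / 3))).
    by rewrite /J; field.
  have ws0 : 0 <= w s by rewrite -(@w0 R) w_mono//; lra.
  have w1 := w_norm_lt1 s; rewrite (ger0_norm ws0) in w1.
  have hS : (1 - w s) ^+ 2 <= S s ^+ 2.
    have a1 : 0 <= 1 - w s  by lra.
    have a2 : 1 - w s <= S s by rewrite /sech2; nra.
    by rewrite lerXn2r ?nnegrE// (le_trans a1).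
  have h3 : 0 <= (w s + 2) / 3 by rewrite divr_ge0//; lra.
  have h4 : 0 <= k * ((1 - w s) ^+ 2 * ((w s + 2) / 3)).
    by rewrite mulr_ge0// mulr_ge0// sqr_ge0.
  rewrite normrN (ger0_norm h4) ler_wpM2l//.
  rewrite (le_trans _ hS)// ler_piMr ?sqr_ge0//.
  by rewrite ler_pdivrMr//; lra.
apply: (@bounded_solution (`|b| * k + 1) (fun s => b - s ^+ 2) G) => //.
- by move=> s; exact: is_derive_continuous (dG s).
- move=> s; have [s0|s0] := leP 0 s.
    by rewrite ger0_norm//; exact: GC.
  rewrite ltr0_norm// => s4; rewrite -sech2_even -(sqrrN s).
  have -> : G s = - G (- s) by rewrite /G oddA /J w_odd; field.
  by rewrite normrN; exact: GC.
Qed.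

Lemma profile_of_corrector (p g : R -> R) : polyg p ->
  (forall s : R, is_derive s 1 g (2 * k * w s * g s + p s)) -> polyg g ->
  exists psi psi1 : R -> R,
    [/\ forall s : R, is_derive s 1 psi (psi1 s),
        forall s : R, is_derive s 1 psi1 (p s * (k^-1 * S s) - (1 - 3 * w s ^+ 2) * psi s),
        decay psi, decay psi1 &
        decay (fun s => p s * (k^-1 * S s) - (1 - 3 * w s ^+ 2) * psi s)].
Proof.
move=> pp dg pg.
have cg : continuous g by move=> s; exact: is_derive_continuous (dg s).
have [h dh] := antiderivative cg.
have ph := polyg_antiderivative dh pg.
have k0 := lt0r_neq0 (sqrt2_gt0 R).
have dS := decay_sech2 R.
(* The profile is h w' with h' = g, because w' is [k^-1 * S]; h and g grow polynomially, so the
   factor S gives the decay. *)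
exists (fun s => S s * (k^-1 * h s)), (fun s => S s * (k^-1 * g s + - w s * h s)); split.
- move=> s; have d1 := is_derive_sech2 s; have d2 := dh s.
  by apply: is_derive_eq; rewrite /GRing.scale/=; field.
- move=> s; have d1 := is_derive_sech2 s; have d2 := dh s; have d3 := dg s.
  have d4 := is_derive_w s.
  apply: is_derive_eq; rewrite /GRing.scale/= sqrt2_inv.
  have := sqrt2_sqr R; move: (g s) (h s) (p s) => gs hs ps.
  rewrite /sech2; move: (w s) => ws; move: k => q q2.
  have qq : q * q - 2 = 0 by rewrite -expr2 q2 subrr.
  apply/eqP; rewrite -subr_eq0; apply/eqP.
  rewrite -[RHS](mul0r (ws * gs * (1 - ws ^+ 2) / 2)) -qq; by field.
- by apply: decayM => //; apply: polygM => //; exact: polyg_cst.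
- apply: decayM => //; apply: polygD.
    by apply: polygM => //; exact: polyg_cst.
  apply: polygM => //; exists 1, 0 => s.
  by rewrite normrN expr0 mulr1 ltW// w_norm_lt1.
- rewrite (_ : (fun s => _) = (fun s => S s * (k^-1 * p s + (-1 + 3 * (w s * w s)) * (k^-1 * h s)))).
    apply: decayM => //; apply: polygD; first by apply: polygM => //; exact: polyg_cst.
    apply: polygM; last by apply: polygM => //; exact: polyg_cst.
    apply: polygD; first exact: polyg_cst.
    by do ?[exact: polyg_cst|exact: polyg_w|apply: polygM].
  by apply/funext => s; ring.
Qed.

End correctors.

(** * Residual of the barriers *)

Section residual.
Variable R : realType.

Lemma normM_le (x y X Y : R) : `|x| <= X -> `|y| <= Y -> `|x * y| <= X * Y.
Proof. by move=> hx hy; rewrite normrM ler_pM. Qed.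

Lemma normD_le (x y X Y : R) : `|x| <= X -> `|y| <= Y -> `|x + y| <= X + Y.
Proof. by move=> hx hy; rewrite (le_trans (ler_normD _ _))// lerD. Qed.

(* Here e = 1 / rho, s = rhat - rho, rr = 1 / rhat; [1 - eta] and [l] stand for
   |grad rhat|^2 and the Laplacian of rhat; [p] and [x] are the two profiles and
   V = - rho'.  [N] is the residual of the barrier P: the equations of the profiles
   cancel it up to e^3, and [CE] must not depend on [A] and [B], which are chosen
   from it. *)
Lemma residual_bound (a b c D : R) : 0 <= a -> 0 <= c -> 0 <= D ->
  exists2 CE, 0 <= CE & forall A B, 0 <= A -> 0 <= B ->
  exists2 CAB, 0 <= CAB &
  forall e rr s w w1 w2 p p1 p2 x x1 x2 th d l eta : R,
    0 < e <= 1 -> 0 < rr <= 1 -> rr = e - e * s * rr -> `|w| <= 1 ->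
    w2 = - (1 - w ^+ 2) * w -> p2 = s * w1 - (1 - 3 * w ^+ 2) * p ->
    x2 = (b - s ^+ 2) * w1 - (1 - 3 * w ^+ 2) * x ->
    `|w1| * (1 + `|s|) ^+ 4 <= D -> `|w2| * (1 + `|s|) ^+ 4 <= D ->
    `|p| * (1 + `|s|) ^+ 4 <= D -> `|p1| * (1 + `|s|) ^+ 4 <= D ->
    `|p2| * (1 + `|s|) ^+ 4 <= D -> `|x| * (1 + `|s|) ^+ 4 <= D ->
    `|x1| * (1 + `|s|) ^+ 4 <= D -> `|x2| * (1 + `|s|) ^+ 4 <= D ->
    `|l - a * rr| <= c * rr ^+ 4 -> `|eta| <= c * rr ^+ 4 -> `|th| = 1 ->
    0 <= d <= B * e ^+ 4 ->
    let V := a * e + a * b * e ^+ 3 + th * d in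
    let Ps := w1 + a * e ^+ 2 * (p1 + e * x1) in
    let Pss := w2 + a * e ^+ 2 * (p2 + e * x2) in
    let P := w + a * e ^+ 2 * (p + e * x) + th * A * e ^+ 4 in
    let Pe := a * (2 * e * p + 3 * e ^+ 2 * x) in
    let N := V * Ps + V * e ^+ 2 * Pe + 4 * th * A * V * e ^+ 5
      - (1 - eta) * Pss - l * Ps - (P - P ^+ 3) in
    is_true (`|N - th * (d * w1 + A * e ^+ 4 * (3 * w ^+ 2 - 1))| <= (CE + e * CAB) * e ^+ 4).
Proof.
move=> a0 c0 D0.
exists (a * D + 2 * a ^+ 2 * D + 2 * a ^+ 2 * `|b| * D + 2 * (c * (D + 2 * a * D))
  + 5 * a * D * (a + a * `|b|) + 12 * a ^+ 2 * D ^+ 2).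
  by do ?[apply: addr_ge0|apply: mulr_ge0|apply: exprn_ge0|exact: normr_ge0|exact: ler0n|assumption].
move=> A B A0 B0.
exists (2 * a * B * D + 5 * a * D * B + 4 * A * (a + a * `|b| + B)
  + 3 * (4 * a * D * A + A ^+ 2) + (2 * a * D + A) ^+ 3).
  by do ?[apply: addr_ge0|apply: mulr_ge0|apply: exprn_ge0|exact: normr_ge0|exact: ler0n|assumption].
move=> e rr s w w1 w2 p p1 p2 x x1 x2 th d l eta /andP[e0 e1] /andP[r0 r1] rrE.
move=> hw w2E p2E x2E dw1 dw2 dp dp1 dp2 dx dx1 dx2 hl heta th1 /andP[d0 dB] V Ps Pss P Pe N.
pose m := 1 + `|s|.
have m1 : 1 <= m by rewrite /m lerDl.
have m0 : 0 <= m by exact: le_trans ler01 m1.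
have sm : `|s| <= m by rewrite /m lerDr.
have e0' := ltW e0; have r0' := ltW r0.
have ek j : e ^+ j <= 1 by rewrite exprn_ile1.
have ek0 j : 0 <= e ^+ j by rewrite exprn_ge0.
have m4 : 1 <= m ^+ 4 by rewrite exprn_ege1.
(* Away from the interface 1 / rhat may be much larger than e, but only by the factor 1 + |s|; the
   fourth power of this weight in the decay hypotheses pays for it. *)
have rem : rr <= e * m.
  rewrite rrE -mulrA -{1}[e]mulr1 -mulrBr ler_wpM2l// /m lerD2l.
  rewrite (le_trans (ler_norm _))// normrN normrM ler_piMr// ger0_norm//.
have wk (X : R) : `|X| * m ^+ 4 <= D -> `|X| <= D.
  by apply: le_trans; rewrite ler_peMr.
have rr4 : rr ^+ 4 <= e ^+ 4 * m ^+ 4 by rewrite -exprMn lerXn2r ?nnegrE ?mulr_ge0.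
have q1m : `|p1 + e * x1| * m ^+ 4 <= 2 * D.
  rewrite (le_trans (ler_wpM2r _ (ler_normD _ _))) ?exprn_ge0// mulrDl mulr2n mulrDl mul1r.
  rewrite lerD// normrM ger0_norm// -mulrA (le_trans _ dx1)// ler_piMl// mulr_ge0//.
  exact: exprn_ge0.
have q2m : `|p2 + e * x2| * m ^+ 4 <= 2 * D.
  rewrite (le_trans (ler_wpM2r _ (ler_normD _ _))) ?exprn_ge0// mulrDl mulr2n mulrDl mul1r.
  rewrite lerD// normrM ger0_norm// -mulrA (le_trans _ dx2)// ler_piMl// mulr_ge0//.
  exact: exprn_ge0.
have q1n : `|p1 + e * x1| <= 2 * D.
  by apply: le_trans q1m; rewrite ler_peMr.
have q0n : `|p + e * x| <= 2 * D.
  rewrite (le_trans (ler_normD _ _))// mulr2n mulrDl mul1r.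
  apply: lerD; first exact: wk.
  by rewrite normrM ger0_norm//; apply: le_trans (wk _ dx); rewrite ler_piMl.
have hV : `|V| <= e * (a + a * `|b| + B * e).
  rewrite /V (_ : e * _ = e * a + a * `|b| * e + B * e ^+ 2); last by ring.
  apply: normD_le; last first.
    rewrite normrM th1 mul1r ger0_norm// (le_trans dB)// ler_wpM2l//.
    by rewrite ler_wiXn2l.
  apply: normD_le; first by rewrite ger0_norm ?mulr_ge0// mulrC.
  apply: normM_le; first by rewrite normrM ger0_norm.
  by rewrite ger0_norm// -[leRHS]expr1 ler_wiXn2l.
have T1 : `|a * e ^+ 3 * s ^+ 3 * rr * w1| <= a * D * e ^+ 4.
  rewrite (_ : a * D * e ^+ 4 = a * e ^+ 3 * (e * D)); last by ring.
  rewrite (_ : _ * w1 = a * e ^+ 3 * (s ^+ 3 * (rr * w1))); last by ring.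
  apply: normM_le; first by rewrite ger0_norm// mulr_ge0.
  rewrite normrM [`|rr * w1|]normrM normrX (ger0_norm r0') (@le_trans _ _ (m ^+ 3 * (e * m * `|w1|)))//.
    by rewrite ler_pM ?mulr_ge0 ?exprn_ge0// ?ler_wpM2r// lerXn2r ?nnegrE.
  rewrite (_ : m ^+ 3 * (e * m * `|w1|) = e * (`|w1| * m ^+ 4)); last by ring.
  by rewrite ler_wpM2l.
have T2 : `|a * e * s * rr * (a * e ^+ 2 * (p1 + e * x1))| <= 2 * a ^+ 2 * D * e ^+ 4.
  rewrite (_ : _ * _ = a ^+ 2 * e ^+ 3 * (s * (rr * (p1 + e * x1)))); last by ring.
  rewrite (_ : 2 * _ * _ * _ = a ^+ 2 * e ^+ 3 * (e * (2 * D))); last by ring.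
  apply: normM_le; first by rewrite ger0_norm// mulr_ge0 ?sqr_ge0.
  rewrite normrM [`|rr * _|]normrM (ger0_norm r0').
  rewrite (@le_trans _ _ (m ^+ 3 * (e * m * `|p1 + e * x1|)))//.
    rewrite ler_pM ?mulr_ge0// ?ler_wpM2r// (le_trans sm)// exprS ler_peMr//.
    by rewrite exprn_ege1.
  rewrite (_ : m ^+ 3 * (e * m * `|p1 + e * x1|) = e * (`|p1 + e * x1| * m ^+ 4)); last by ring.
  by rewrite ler_wpM2l.
have T3 : `|a * b * e ^+ 3 * (a * e ^+ 2 * (p1 + e * x1))| <= 2 * a ^+ 2 * `|b| * D * e ^+ 4.
  rewrite (_ : _ * (_ * (p1 + _)) = (a ^+ 2 * b) * (e ^+ 5 * (p1 + e * x1))); last by ring.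
  rewrite (_ : 2 * _ * _ * _ * _ = a ^+ 2 * `|b| * (e ^+ 4 * (2 * D))); last by ring.
  apply: normM_le; first by rewrite normrM ger0_norm ?sqr_ge0.
  by apply: normM_le => //; rewrite ger0_norm// ler_wiXn2l.
have T4 : `|th * d * (a * e ^+ 2 * (p1 + e * x1))| <= e * (2 * a * B * D) * e ^+ 4.
  rewrite (_ : e * _ * _ = B * e ^+ 4 * (a * e * (2 * D))); last by ring.
  apply: normM_le; first by rewrite normrM th1 mul1r ger0_norm.
  apply: normM_le => //; rewrite ger0_norm ?mulr_ge0// ler_wpM2l//.
  by rewrite -[leRHS]expr1 ler_wiXn2l.
have PsB : `|Ps| * m ^+ 4 <= D + 2 * a * D.
  rewrite (le_trans (ler_wpM2r _ (ler_normD _ _))) ?exprn_ge0// mulrDl lerD//.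
  rewrite normrM -mulrA (_ : 2 * a * D = a * (2 * D)); last by ring.
  by rewrite ler_pM ?mulr_ge0 ?exprn_ge0// ger0_norm ?mulr_ge0// ler_piMr.
have PssB : `|Pss| * m ^+ 4 <= D + 2 * a * D.
  rewrite (le_trans (ler_wpM2r _ (ler_normD _ _))) ?exprn_ge0// mulrDl lerD//.
  rewrite normrM -mulrA (_ : 2 * a * D = a * (2 * D)); last by ring.
  by rewrite ler_pM ?mulr_ge0 ?exprn_ge0// ger0_norm ?mulr_ge0// ler_piMr.
have rrX (y Z : R) : `|y| <= c * rr ^+ 4 -> `|Z| * m ^+ 4 <= D + 2 * a * D ->
    `|y * Z| <= c * (D + 2 * a * D) * e ^+ 4.
  move=> hy hZ; rewrite normrM.
  rewrite (@le_trans _ _ (c * (e ^+ 4 * m ^+ 4) * `|Z|))//.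
    by rewrite ler_wpM2r// (le_trans hy)// ler_wpM2l.
  rewrite (_ : _ * `|Z| = c * e ^+ 4 * (`|Z| * m ^+ 4)); last by ring.
  rewrite (_ : c * (D + _) * _ = c * e ^+ 4 * (D + 2 * a * D)); last by ring.
  by rewrite ler_wpM2l ?mulr_ge0.
have T5 := rrX _ _ hl PsB.
have T6 := rrX _ _ heta PssB.
have T7 : `|V * e ^+ 2 * Pe| <= (5 * a * D * (a + a * `|b|) + e * (5 * a * D * B)) * e ^+ 4.
  rewrite (_ : _ * e ^+ 4 = e * (a + a * `|b| + B * e) * e ^+ 2 * (a * e * (5 * D))); last by ring.
  rewrite /Pe (_ : _ * e ^+ 2 * _ = V * e ^+ 2 * (a * e * (2 * p + 3 * e * x))); last by ring.
  apply: normM_le; first by apply: normM_le => //; rewrite ger0_norm.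
  apply: normM_le; first by rewrite ger0_norm ?mulr_ge0.
  rewrite (_ : 5 * D = 2 * D + 3 * D); last by ring.
  apply: normD_le; first by rewrite normrM ger0_norm// ler_wpM2l// wk.
  rewrite !normrM (ger0_norm (ler0n _ 3)) (ger0_norm e0') -mulrA ler_wpM2l//.
  by apply: le_trans (wk _ dx); rewrite ler_piMl.
have VB : `|V| <= e * (a + a * `|b| + B).
  apply: (le_trans hV); rewrite ler_wpM2l// lerD2l ler_piMr//.
have T8 : `|4 * th * A * V * e ^+ 5| <= e * (4 * A * (a + a * `|b| + B)) * e ^+ 4.
  rewrite (_ : e * _ * _ = 4 * A * (e * (a + a * `|b| + B)) * e ^+ 4); last by ring.
  apply: normM_le; last by rewrite ger0_norm// ler_wiXn2l.
  apply: normM_le => //; rewrite !normrM th1 mulr1 !ger0_norm//.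
pose dl := a * e ^+ 2 * (p + e * x) + th * A * e ^+ 4.
have ab0 : 0 <= 2 * a * D + A by rewrite addr_ge0// !mulr_ge0.
have dlB : `|dl| <= e ^+ 2 * (2 * a * D + A * e).
  rewrite (_ : e ^+ 2 * _ = a * e ^+ 2 * (2 * D) + A * e ^+ 3); last by ring.
  apply: normD_le.
    by apply: normM_le => //; rewrite ger0_norm// mulr_ge0.
  apply: normM_le; first by rewrite normrM th1 mul1r ger0_norm.
  by rewrite ger0_norm// ler_wiXn2l.
have dlB2 : `|dl| <= e ^+ 2 * (2 * a * D + A).
  by apply: (le_trans dlB); rewrite ler_wpM2l// lerD2l ler_piMr.
have T9 : `|3 * w * dl ^+ 2 + dl ^+ 3| <=
    (12 * a ^+ 2 * D ^+ 2 + e * (3 * (4 * a * D * A + A ^+ 2) + (2 * a * D + A) ^+ 3)) * e ^+ 4.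
  rewrite (_ : _ * e ^+ 4 = (3 * (4 * a ^+ 2 * D ^+ 2 + e * (4 * a * D * A + A ^+ 2)) * e ^+ 4)
     + e * (2 * a * D + A) ^+ 3 * e ^+ 4); last by ring.
  apply: normD_le.
    rewrite -(mulrA 3 w) -(mulrA 3 (_ + _)).
    apply: normM_le; first by rewrite ger0_norm.
    rewrite -[leRHS]mul1r; apply: normM_le => //; rewrite normrX.
    apply: (@le_trans _ _ ((e ^+ 2 * (2 * a * D + A * e)) ^+ 2)).
      by rewrite lerXn2r ?nnegrE// (le_trans (normr_ge0 _) dlB).
    rewrite (_ : (e ^+ 2 * _) ^+ 2 = (4 * a ^+ 2 * D ^+ 2 + e * (4 * a * D * A + e * A ^+ 2)) * e ^+ 4); last by ring.
    by rewrite ler_wpM2r// lerD2l ler_wpM2l// lerD2l ler_piMl// sqr_ge0.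
  rewrite normrX (@le_trans _ _ ((e ^+ 2 * (2 * a * D + A)) ^+ 3))//.
    by rewrite lerXn2r ?nnegrE// (le_trans (normr_ge0 _) dlB2).
  rewrite (_ : _ ^+ 3 = e * (2 * a * D + A) ^+ 3 * e ^+ 4 * e); last by ring.
  by rewrite ler_piMr// !mulr_ge0// exprn_ge0.
have h1 : e - rr - e * s * rr = 0 by rewrite {1}rrE; ring.
(* [h1] iterated: the expansion of 1 / rhat in powers of e up to e^3 s^2, with an exact remainder
   that becomes the first error term. *)
have h2 : e - rr - (e ^+ 2 * s - e ^+ 3 * s ^+ 2 + e ^+ 3 * s ^+ 3 * rr) = 0.
  rewrite (_ : _ - _ = (e - rr - e * s * rr) * (1 - e * s + e ^+ 2 * s ^+ 2)).
    by rewrite h1 mul0r.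
  ring.
(* Order by order, w'' cancels the reaction, the speed a e cancels the leading curvature, the
   equation of p removes the term in s e^2, and that of x those in b e^3 and s^2 e^3. Every
   surviving term is of order e^4 or smaller. *)
have id : N - th * (d * w1 + A * e ^+ 4 * (3 * w ^+ 2 - 1)) =
   a * e ^+ 3 * s ^+ 3 * rr * w1 + a * e * s * rr * (a * e ^+ 2 * (p1 + e * x1))
   + a * b * e ^+ 3 * (a * e ^+ 2 * (p1 + e * x1)) + th * d * (a * e ^+ 2 * (p1 + e * x1))
   - (l - a * rr) * Ps + eta * Pss + V * e ^+ 2 * Pe + 4 * th * A * V * e ^+ 5
   + (3 * w * dl ^+ 2 + dl ^+ 3).
  apply/eqP; rewrite -subr_eq0; apply/eqP.
  transitivity (w1 * a * (e - rr - (e ^+ 2 * s - e ^+ 3 * s ^+ 2 + e ^+ 3 * s ^+ 3 * rr))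
     + a * e ^+ 2 * (p1 + e * x1) * a * (e - rr - e * s * rr)); last first.
    by rewrite h1 h2 !mulr0 addr0.
  rewrite /N /P /Pss /dl /Pe w2E p2E x2E; rewrite /V /Ps; ring.
rewrite id.
rewrite (_ : (_ + e * _) * e ^+ 4 =
  a * D * e ^+ 4 + 2 * a ^+ 2 * D * e ^+ 4 + 2 * a ^+ 2 * `|b| * D * e ^+ 4
  + e * (2 * a * B * D) * e ^+ 4 + c * (D + 2 * a * D) * e ^+ 4 + c * (D + 2 * a * D) * e ^+ 4
  + (5 * a * D * (a + a * `|b|) + e * (5 * a * D * B)) * e ^+ 4
  + e * (4 * A * (a + a * `|b| + B)) * e ^+ 4
  + (12 * a ^+ 2 * D ^+ 2 + e * (3 * (4 * a * D * A + A ^+ 2) + (2 * a * D + A) ^+ 3)) * e ^+ 4); last by ring.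
do 4!(apply: normD_le => //).
apply: normD_le; last by rewrite normrN.
by do 3!(apply: normD_le => //).
Qed.

End residual.

(** * Smoothed radius and interface motion *)

Section derivative_rules.
Variables (R : realType) (V : normedModType R).
Implicit Types (f g : V -> R) (x v : V).

Lemma is_derive_addf f g x v a b : is_derive x v f a -> is_derive x v g b ->
  is_derive x v (fun y => f y + g y) (a + b).
Proof. by move=> df dg; exact: is_deriveD. Qed.

Lemma is_derive_mulf f g x v a b : is_derive x v f a -> is_derive x v g b ->
  is_derive x v (fun y => f y * g y) (a * g x + f x * b).
Proof.
move=> df dg; have h := is_deriveM df dg.
by apply: is_derive_eq; rewrite /GRing.scale/= addrC (mulrC (g x)).
Qed.

Lemma is_derive_cstf x v c : is_derive x v (fun _ : V => c : R) 0.
Proof. exact: is_derive_cst. Qed.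

Lemma is_derive_scalef c f x v a : is_derive x v f a ->
  is_derive x v (fun y => c * f y) (c * a).
Proof.
move=> df; have h := is_derive_mulf (is_derive_cstf x v c) df.
by apply: is_derive_eq; rewrite mul0r add0r.
Qed.

Lemma is_derive_chain f (g : R -> R) x v a b : is_derive x v f a ->
  is_derive (f x) 1 g b -> is_derive x v (fun y => g (f y)) (b * a).
Proof.
move=> /is_derive_line0 df dg; apply/is_derive_line0.
have dg' : is_derive (f (x + 0 *: v)) 1 g b by rewrite scale0r addr0.
exact: (is_derive1_comp dg' df).
Qed.

Lemma is_derive_powf f x v a n : is_derive x v f a ->
  is_derive x v (fun y => f y ^+ n.+1) (n.+1%:R * f x ^+ n * a).
Proof.
by move=> df; rewrite -[fun y => _]exprfctE; exact: (is_deriveX n.+1 df).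
Qed.

Lemma is_derive_invf f x v a : f x != 0 -> is_derive x v f a ->
  is_derive x v (fun y => (f y)^-1) (- (f x)^-1 ^+ 2 * a).
Proof.
move=> fx df; have d : is_derive (f x) 1 (fun z : R => z^-1) (- (f x)^-1 ^+ 2).
  have h : is_derive (f x) 1 (@id R) 1 by exact: is_derive_id.
  have h2 := @is_deriveV R (@id R) (f x) _ _ fx h.
  by apply: is_derive_eq; rewrite /GRing.scale/= mulr1 exprVn.
exact: is_derive_chain df d.
Qed.

End derivative_rules.

Section smoothed_radius.
Variables (R : realType) (n : nat).
Local Notation X := ('rV[R]_n * R)%type.
Implicit Types p : X.

Lemma is_derive_time (f : R -> R) (d : R) (o : option 'I_n) p :
  is_derive p.2 1 f d ->
  is_derive p (dirv R o) (fun q => f q.2) (if o is None then d else 0).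
Proof.
move=> df; apply/is_derive_line0; case: o => [i|].
  rewrite (_ : (fun h : R => _) = cst (f p.2)); first exact: is_derive_cst.
  by apply/funext => h /=; rewrite scaler0 addr0.
rewrite (_ : (fun h : R => _) = fun h => f (p.2 + h *: 1)); last first.
  by apply/funext => h.
exact/is_derive_line0.
Qed.

Lemma is_derive_coord (j : 'I_n) (o : option 'I_n) p :
  is_derive p (dirv R o) (fun q => q.1 ord0 j) (if o is Some i then (i == j)%:R else 0).
Proof.
apply/is_derive_line0.
pose c : R := if o is Some i then (i == j)%:R else 0.
rewrite (_ : (fun h : R => _) = fun h : R => p.1 ord0 j + c * h); last first.
  apply/funext => h; rewrite /c; case: o {c} => [i|] /=; first exact: evE.
  by rewrite scaler0 addr0 mul0r addr0.
have h1 := is_derive_scalef c (@is_derive_id R R 0 1).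
have h2 := is_derive_addf (is_derive_cstf (0 : R) 1 (p.1 ord0 j)) h1.
by apply: is_derive_eq; rewrite add0r mulr1.
Qed.

(* [rhat] = (1 + |x|^4)^(1/4) has bounded derivatives and |grad rhat|^2 and the
   Laplacian agree with those of |x| up to O(rhat^-4). *)
Definition rsq p : R := \sum_i p.1 ord0 i ^+ 2.
Definition rhat p : R := Num.sqrt (Num.sqrt (1 + rsq p ^+ 2)).
Definition rhat_inv p : R := (rhat p)^-1.
Definition rdir p i : R := p.1 ord0 i * rhat_inv p.
Definition rratio p : R := rsq p * rhat_inv p ^+ 2.
Definition rhat1 i p : R := rratio p * rdir p i.
Definition rhat2 i j p : R := rhat_inv p *
  (2 * rdir p i * rdir p j + (i == j)%:R * rratio p - 3 * rratio p ^+ 2 * rdir p i * rdir p j).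

Lemma rsq_ge0 p : 0 <= rsq p.
Proof. by apply: sumr_ge0 => i _; exact: sqr_ge0. Qed.

Lemma rhat4 p : rhat p ^+ 4 = 1 + rsq p ^+ 2.
Proof.
by rewrite (exprM _ 2 2) sqr_sqrtr ?sqrtr_ge0// sqr_sqrtr// addr_ge0// sqr_ge0.
Qed.

Lemma rhat_ge1 p : 1 <= rhat p.
Proof.
rewrite -[1]sqrtr1 ler_wsqrtr// -[leLHS]sqrtr1 ler_wsqrtr// lerDl; exact: sqr_ge0.
Qed.

Lemma rhat_gt0 p : 0 < rhat p. Proof. exact: lt_le_trans ltr01 (rhat_ge1 p). Qed.

Lemma rhat_neq0 p : rhat p != 0. Proof. exact: lt0r_neq0 (rhat_gt0 p). Qed.

Lemma is_derive_rsq (o : option 'I_n) p :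
  is_derive p (dirv R o) rsq (if o is Some i then 2 * p.1 ord0 i else 0).
Proof.
have d j : is_derive p (dirv R o) (fun q => q.1 ord0 j ^+ 2)
    (2 * p.1 ord0 j * (if o is Some i then (i == j)%:R else 0)).
  have h := is_derive_powf 1 (is_derive_coord j o p).
  by apply: is_derive_eq; rewrite expr1.
have h := is_derive_lincomb (index_enum 'I_n) (fun _ => 1) d.
rewrite (_ : rsq = fun q => \sum_i 1 * q.1 ord0 i ^+ 2); last first.
  by apply/funext => q; apply: eq_bigr => i _; rewrite mul1r.
apply: is_derive_eq; case: o {d h} => [i|].
  rewrite (bigD1 i)//= eqxx mul1r mulr1 big1 ?addr0// => j ji.
  by rewrite eq_sym (negbTE ji) !mulr0.
by rewrite big1// => j _; rewrite !mulr0.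
Qed.

Lemma is_derive_rhat (o : option 'I_n) p :
  is_derive p (dirv R o) rhat (if o is Some i then rhat1 i p else 0).
Proof.
have d1 : is_derive (rsq p) 1 (fun y : R => 1 + y ^+ 2) (2 * rsq p).
  have h := is_derive_powf 1 (@is_derive_id R R (rsq p) 1).
  have h2 := is_derive_addf (is_derive_cstf (rsq p : R) 1 1) h.
  by apply: is_derive_eq; rewrite add0r expr1 mulr1.
have p0 : 0 < 1 + rsq p ^+ 2 by rewrite ltr_pwDl// sqr_ge0.
have h1 := is_derive_chain (is_derive_chain (is_derive_rsq o p) d1) (is_derive1_sqrt p0).
have p1 : 0 < Num.sqrt (1 + rsq p ^+ 2) by rewrite sqrtr_gt0.
have h2 := is_derive_chain h1 (is_derive1_sqrt p1).
apply: is_derive_eq; case: o {h1 h2} => [i|]; last by rewrite !mulr0.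
have -> : Num.sqrt (1 + rsq p ^+ 2) = rhat p ^+ 2 by rewrite sqr_sqrtr// ltW.
rewrite (_ : Num.sqrt (rhat p ^+ 2) = rhat p); last by rewrite sqrtr_sqr ger0_norm// ltW// rhat_gt0.
rewrite /rhat1 /rratio /rdir /rhat_inv; have r0 := rhat_neq0 p; by field.
Qed.

Lemma is_derive_rhat_inv (o : option 'I_n) p :
  is_derive p (dirv R o) rhat_inv
    (- rhat_inv p ^+ 2 * (if o is Some i then rhat1 i p else 0)).
Proof. exact: is_derive_invf (rhat_neq0 p) (is_derive_rhat o p). Qed.

Lemma is_derive_rhat1 i (o : option 'I_n) p :
  is_derive p (dirv R o) (rhat1 i) (if o is Some j then rhat2 i j p else 0).
Proof.
have h1 := is_derive_mulf (is_derive_coord i o p) (is_derive_rhat_inv o p).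
have h2 := is_derive_mulf (is_derive_rsq o p) (is_derive_powf 1 (is_derive_rhat_inv o p)).
have h3 := is_derive_mulf h2 h1.
apply: is_derive_eq; case: o {h1 h2 h3} => [j|]; last by ring.
rewrite /rhat2 /rhat1 /rratio /rdir (eq_sym j i); ring.
Qed.

Lemma rhat_inv_gt0 p : 0 < rhat_inv p. Proof. by rewrite invr_gt0 rhat_gt0. Qed.

Lemma rhat_inv_le1 p : rhat_inv p <= 1.
Proof. by rewrite invf_le1 ?rhat_ge1// rhat_gt0. Qed.

Lemma rratio_ge0 p : 0 <= rratio p.
Proof. by rewrite mulr_ge0 ?rsq_ge0// sqr_ge0. Qed.

Lemma rratio_sqr p : rratio p ^+ 2 = 1 - rhat_inv p ^+ 4.
Proof.
have r0 := rhat_neq0 p; apply: (mulIf (expf_neq0 4 r0)).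
rewrite {1}rhat4 /rratio mulrBl mul1r -exprMn mulVf// expr1n rhat4.
rewrite /rhat_inv; rewrite -[in LHS]rhat4; by field.
Qed.

Lemma rratio_le1 p : rratio p <= 1.
Proof.
rewrite -(@ler_sqr R) ?nnegrE ?rratio_ge0// expr1n rratio_sqr gerBl.
by rewrite exprn_ge0// ltW// rhat_inv_gt0.
Qed.

(** [rratio] is |x|^2 / rhat^2, and its square is 1 - rhat^-4. All deviations of [rhat] from |x| in
    the gradient and the Laplacian are multiples of [1 - rratio]. *)
Lemma one_sub_rratio p : 0 <= 1 - rratio p <= rhat_inv p ^+ 4.
Proof.
have h0 := rratio_ge0 p; have h1 := rratio_le1 p; have h2 := rratio_sqr p.
by apply/andP; split; nra.
Qed.

Lemma sum_rdir_sqr p : \sum_i rdir p i ^+ 2 = rratio p.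
Proof. by rewrite /rratio /rsq mulr_suml; apply: eq_bigr => i _; rewrite exprMn. Qed.

Lemma rdir_norm_le1 p i : `|rdir p i| <= 1.
Proof.
rewrite -(@ler_sqr R) ?nnegrE// expr1n real_normK ?num_real//.
rewrite (le_trans _ (rratio_le1 p))// -sum_rdir_sqr (bigD1 i)//= lerDl.
by apply: sumr_ge0 => j _; exact: sqr_ge0.
Qed.

Lemma rhat_gradient p :
  `|1 - \sum_i rhat1 i p ^+ 2| <= 3 * rhat_inv p ^+ 4.
Proof.
rewrite (_ : \sum_i _ = rratio p ^+ 3); last first.
  rewrite exprSr -{2}sum_rdir_sqr mulr_sumr.
  by apply: eq_bigr => i _; rewrite /rhat1 exprMn.
have /andP[h0 h1] := one_sub_rratio p; have h2 := rratio_ge0 p; have h3 := rratio_le1 p.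
rewrite ger0_norm.
  have s1 : rratio p ^+ 2 <= 1 by rewrite exprn_ile1.
  have : 0 <= (1 - rratio p) * (2 - rratio p - rratio p ^+ 2) by rewrite mulr_ge0//; lra.
  by move: h1; set y := rhat_inv p ^+ 4; lra.
by rewrite subr_ge0 exprn_ile1.
Qed.

Lemma rhat_laplacian p :
  `|\sum_i rhat2 i i p - (n%:R - 1) * rhat_inv p| <= (n%:R + 11) * rhat_inv p ^+ 4.
Proof.
rewrite (_ : \sum_i _ = rhat_inv p * (2 * rratio p + n%:R * rratio p - 3 * rratio p ^+ 3)); last first.
  rewrite /rhat2 -mulr_sumr; congr (_ * _).
  rewrite !big_split/= sumrN; congr (_ + _ - _).
  - by rewrite -sum_rdir_sqr mulr_sumr; apply: eq_bigr => i _; rewrite expr2 mulrA.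
  - under eq_bigr do rewrite eqxx mul1r.
    by rewrite sumr_const card_ord mulr_natl.
  - rewrite (_ : 3 * rratio p ^+ 3 = 3 * rratio p ^+ 2 * \sum_i rdir p i ^+ 2); last first.
      by rewrite sum_rdir_sqr; ring.
    by rewrite mulr_sumr; apply: eq_bigr => i _; ring.
have /andP[h0 h1] := one_sub_rratio p; have h2 := rratio_ge0 p; have h3 := rratio_le1 p.
have i0 := ltW (rhat_inv_gt0 p); have i1 := rhat_inv_le1 p.
have n0 : 0 <= n%:R :> R by [].
(* At [rratio] = 1 the bracket takes the value n - 1 found for |x|; the error factors through
   [1 - rratio]. *)
rewrite (_ : _ - _ = rhat_inv p *
  ((1 - rratio p) * (3 * (1 + rratio p + rratio p ^+ 2) - (n%:R + 2)))); last by ring.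
rewrite normrM (ger0_norm i0) -[leRHS]mul1r ler_pM//.
rewrite normrM ger0_norm// mulrC ler_pM//.
have s0 := sqr_ge0 (rratio p).
have s1 : rratio p ^+ 2 <= 1 by rewrite exprn_ile1.
by rewrite ler_norml; apply/andP; split; lra.
Qed.

Lemma enorm_rsq p : enorm p.1 ^+ 2 = rsq p.
Proof. by rewrite sqr_sqrtr// rsq_ge0. Qed.

Lemma rhat_radial (x y : 'rV[R]_n) t : enorm x = enorm y -> rhat (x, t) = rhat (y, t).
Proof. by move=> xy; rewrite /rhat -!enorm_rsq/= xy. Qed.

(** 1 = rhat^4 - |x|^4 factors as (rhat - |x|) (rhat + |x|) (rhat^2 + |x|^2), where the product of
    the last two factors is at least rhat. *)
Lemma rhat_enorm p : 0 <= rhat p - enorm p.1 <= rhat_inv p.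
Proof.
have e0 : 0 <= enorm p.1 := sqrtr_ge0 _.
have r1 := rhat_ge1 p; have h4 := rhat4 p; rewrite -enorm_rsq -exprM in h4.
have er : enorm p.1 <= rhat p.
  rewrite -(@ler_pXn2r R 4) ?nnegrE//; last by rewrite ltW// rhat_gt0.
  by rewrite h4 lerDr.
rewrite subr_ge0 er/= /rhat_inv -[leRHS]mul1r ler_pdivlMr ?rhat_gt0//.
set r := rhat p in r1 h4 er *; set e := enorm _ in e0 h4 er *.
rewrite [leRHS](_ : 1 = (r - e) * ((r + e) * (r ^+ 2 + e ^+ 2))); last first.
  by rewrite -[1](addrK (e ^+ 4)) -h4; ring.
rewrite ler_wpM2l ?subr_ge0//.
have : r <= (r + e) * 1 by rewrite mulr1 lerDl.
move=> /le_trans; apply; rewrite ler_wpM2l ?addr_ge0// ?(le_trans ler01 r1)//.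
by rewrite -[leLHS]addr0 lerD ?sqr_ge0// exprn_ege1.
Qed.

Lemma continuous_coordX i : continuous (fun p : X => p.1 ord0 i).
Proof.
apply: (@continuous_compf X 'rV[R]_n R fst (fun x => x ord0 i)); first exact: continuous_fst.
exact: coord_continuous.
Qed.

Lemma continuous_rsq : continuous rsq.
Proof.
apply: continuous_sum => i; rewrite (_ : (fun p : X => _) = fun p => p.1 ord0 i * p.1 ord0 i).
  apply: continuous_mul; exact: continuous_coordX.
by apply/funext => p; rewrite expr2.
Qed.

Lemma continuous_rhat : continuous rhat.
Proof.
have c0 := @sqrt_continuous R.
apply: (@continuous_compf X R R (fun p => Num.sqrt (1 + rsq p ^+ 2)) Num.sqrt) => //.
apply: (@continuous_compf X R R (fun p => 1 + rsq p ^+ 2) Num.sqrt) => //.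
apply: (@continuous_add R X R); first exact: cst_continuous.
apply: (@continuous_compf X R R rsq (fun y => y ^+ 2)); first exact: continuous_rsq.
exact: exprn_continuous.
Qed.

Lemma bcx_rhat_inv : bcx rhat_inv.
Proof.
exists 1; split=> [p|p]; last by rewrite ger0_norm ?rhat_inv_le1// ltW// rhat_inv_gt0.
by apply: cvgV; [exact: rhat_neq0|exact: continuous_rhat].
Qed.

Lemma bcx_rdir i : bcx (rdir^~ i).
Proof.
exists 1; split=> [|p]; last exact: rdir_norm_le1.
by apply: continuous_mul; [exact: continuous_coordX|case: bcx_rhat_inv => C []].
Qed.

Lemma bcx_rratio : bcx rratio.
Proof.
rewrite (_ : rratio = fun p => \sum_i rdir p i * rdir p i).
  by apply: bcx_sum => i; apply: bcx_mul; exact: bcx_rdir.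
by apply/funext => p; rewrite -sum_rdir_sqr; apply: eq_bigr => i _; rewrite expr2.
Qed.

Lemma bcx_rhat1 i : bcx (rhat1 i).
Proof. by apply: bcx_mul; [exact: bcx_rratio|exact: bcx_rdir]. Qed.

Lemma bcx_rhat2 i j : bcx (rhat2 i j).
Proof.
rewrite (_ : rhat2 i j = fun p => rhat_inv p *
  (2 * rdir p i * rdir p j + (i == j)%:R * rratio p
   + - (3 * (rratio p * rratio p) * rdir p i * rdir p j))); last by [].
by do ?[exact: bcx_rhat_inv|exact: bcx_rdir|exact: bcx_rratio|exact: bcx_cst
  |apply: bcx_mul|apply: bcx_opp|apply: bcx_add].
Qed.

End smoothed_radius.

(** * Explicit motion of the interface *)

Section radius.
Variable R : realType.

(* With Q = x ^ 4 and L = ln Q, [Y] is rho ^ 2 and d(rho^2)/dQ = 2 a + b / Q + th m / (2 Q^(3/2)). *)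
Lemma radius_algebra (a b m : R) : 1 <= a -> 0 < m ->
  exists2 x0, 1 <= x0 & forall x L th : R, x0 <= x -> 0 <= L <= 4 * x -> `|th| = 1 ->
  let Y := 2 * a * x ^+ 4 + b * L - th * m * (x ^+ 2)^-1 in
  a * x ^+ 4 <= Y <= 3 * a * x ^+ 4 /\
  `|th * (b * (x ^+ 4)^-1 - 2 * a * b * Y^-1)| <= m / 4 * (x ^+ 6)^-1.
Proof.
move=> a1 m0; have a0 : 0 < a by exact: lt_le_trans a1.
(* The deviation of Y from 2 a x^4 is at most c x, so x >= c confines Y; x >= d brings the last
   error down to the fraction m / 4. *)
pose c := 4 * `|b| + m; pose d := 4 * `|b| * c / m.
have c0 : 0 < c by rewrite ltr_wpDl.
have d0 : 0 <= d by apply: divr_ge0 (ltW m0); rewrite mulr_ge0 ?(ltW c0)//.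
exists (1 + c + d) => [|x L th xx /andP[L0 L4] th1]; first by rewrite -addrA lerDl addr_ge0// ltW.
have x1 : 1 <= x by apply: le_trans xx; rewrite -addrA lerDl addr_ge0// ltW.
have cx : c <= x by apply: le_trans xx; rewrite -addrA addrCA lerDl addr_ge0.
have dx : d <= x by apply: le_trans xx; rewrite lerDr addr_ge0// ltW.
have x0 : 0 < x by exact: lt_le_trans x1.
have x0' := ltW x0.
move=> Y; pose D := b * L - th * m * (x ^+ 2)^-1.
have YE : Y = 2 * a * x ^+ 4 + D by rewrite /Y /D addrA.
have DB : `|D| <= c * x.
  rewrite /c mulrDl (le_trans (ler_normB _ _))// lerD//.
    by rewrite normrM (ger0_norm L0) (mulrC 4) -mulrA ler_wpM2l.
  rewrite !normrM th1 mul1r (gtr0_norm m0) ler_wpM2l ?(ltW m0)//.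
  rewrite ger0_norm ?invr_ge0 ?exprn_ge0// (le_trans _ x1)// invf_le1 ?exprn_gt0//.
  exact: exprn_ege1.
have DX : `|D| <= a * x ^+ 4.
  apply: (le_trans DB); apply: (@le_trans _ _ (x * x)); first by rewrite ler_wpM2r.
  rewrite -expr2 (le_trans (ler_weXn2l x1 (_ : (2 <= 4)%N)))//.
  by rewrite -[leLHS]mul1r ler_wpM2r// exprn_ge0.
have [Y1 Y2] : a * x ^+ 4 <= Y /\ Y <= 3 * a * x ^+ 4.
  move: DX; rewrite YE ler_norml => /andP[]; set u := x ^+ 4; clear; split; nra.
have ax0 : 0 < a * x ^+ 4 by rewrite mulr_gt0// exprn_gt0.
have Y0 : 0 < Y by exact: lt_le_trans Y1.
split; first by rewrite Y1.
have Yn := lt0r_neq0 Y0; have xn := lt0r_neq0 x0.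
rewrite normrM th1 mul1r (_ : _ - _ = b * D * ((x ^+ 4)^-1 * Y^-1)); last first.
  rewrite (_ : D = Y - 2 * a * x ^+ 4); last by rewrite YE addrC addKr.
  by field; rewrite xn Yn.
rewrite 2!normrM.
apply: (@le_trans _ _ (`|b| * (c * x) * ((x ^+ 4)^-1 * (x ^+ 4)^-1))).
  rewrite ler_pM ?mulr_ge0// ?ler_wpM2l//.
  rewrite ger0_norm ?mulr_ge0 ?invr_ge0 ?exprn_ge0// ?(ltW Y0)//.
  rewrite ler_wpM2l ?invr_ge0 ?exprn_ge0// lef_pV2 ?posrE ?exprn_gt0//.
  by rewrite (le_trans _ Y1)// -[leLHS]mul1r ler_wpM2r ?exprn_ge0.
have -> : `|b| * (c * x) * ((x ^+ 4)^-1 * (x ^+ 4)^-1) = d * (m / 4) / x * (x ^+ 6)^-1.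
  by rewrite /d; field; rewrite xn lt0r_neq0.
rewrite ler_wpM2r ?invr_ge0 ?exprn_ge0// ler_pdivrMr// mulrC ler_wpM2l//.
by rewrite divr_ge0// ltW.
Qed.

(** The numerator is the derivative of rho^2 in Q for m = 8 B. Trading b / x^4 for 2 a b / r^2 costs
    at most 2 B / x^6 out of the available 4 B / x^6, so between 2 B and 6 B remain before division
    by 2 r. Then x^2 <= r gives the lower bound and r^3 <= 9 a^2 x^6 the factor 27 = 3 * 9. *)
Lemma radius_speed (a b B x r th : R) : 1 <= a -> 0 <= B -> 0 < x -> 0 < r -> th ^+ 2 = 1 ->
  a * x ^+ 4 <= r ^+ 2 <= 3 * a * x ^+ 4 ->
  `|th * (b * (x ^+ 4)^-1 - 2 * a * b * (r ^+ 2)^-1)| <= 8 * B / 4 * (x ^+ 6)^-1 ->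
  exists2 d, (2 * a + b * (x ^+ 4)^-1 + th * (8 * B) / 2 * (x ^+ 6)^-1) / (2 * r) =
     a * r^-1 + a * b * r^-1 ^+ 3 + th * d & B * r^-1 ^+ 4 <= d <= 27 * a ^+ 2 * B * r^-1 ^+ 4.
Proof.
move=> a1 B0 x0 r0 th2 /andP[Y1 Y2]; set e := th * _ => he.
have a0 : 0 < a by exact: lt_le_trans a1.
have rn := lt0r_neq0 r0; have xn := lt0r_neq0 x0.
have r2 : x ^+ 2 <= r.
  rewrite -(@ler_sqr R) ?nnegrE ?exprn_ge0 ?(ltW r0) ?(ltW x0) ?(ltW a0)// -exprM (le_trans _ Y1)//.
  by rewrite -[leLHS]mul1r ler_wpM2r// exprn_ge0// ltW.
have r3 : r <= 3 * a * x ^+ 2.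
  rewrite -(@ler_sqr R) ?nnegrE ?(ltW r0) ?mulr_ge0 ?exprn_ge0 ?(ltW r0) ?(ltW x0) ?(ltW a0)//.
  rewrite (le_trans Y2)// exprMn -exprM ler_wpM2r ?exprn_ge0 ?(ltW r0) ?(ltW x0) ?(ltW a0)//.
  rewrite expr2 ler_peMl ?mulr_ge0 ?(ltW a0)//; lra.
have x6 : 0 <= (x ^+ 6)^-1 by rewrite invr_ge0 exprn_ge0// ltW.
exists ((e + 4 * B * (x ^+ 6)^-1) / (2 * r)).
  have the : th * e = b * (x ^+ 4)^-1 - 2 * a * b * (r ^+ 2)^-1.
    by rewrite /e mulrA -expr2 th2 mul1r.
  rewrite [th * (_ / _)]mulrA mulrDr the; by field; rewrite ?xn ?rn.
move: he; rewrite ler_norml => /andP[e1 e2].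
have lo : 2 * B * (x ^+ 6)^-1 <= e + 4 * B * (x ^+ 6)^-1 by lra.
have hi : e + 4 * B * (x ^+ 6)^-1 <= 6 * B * (x ^+ 6)^-1 by lra.
have r20 : 0 <= (2 * r)^-1 by rewrite invr_ge0 mulr_ge0// ltW.
have x60 : 0 < x ^+ 6 by rewrite exprn_gt0.
apply/andP; split.
  apply: (le_trans _ (ler_wpM2r r20 lo)).
  rewrite (_ : 2 * B * _ * _ = B * (x ^+ 6 * r)^-1); last by field; rewrite ?xn ?rn.
  rewrite ler_wpM2l// exprVn lef_pV2 ?posrE ?exprn_gt0// ?mulr_gt0//.
  by rewrite [r ^+ 4]exprSr ler_wpM2r ?(ltW r0)// (exprM x 2 3) lerXn2r// nnegrE ?exprn_ge0 ?(ltW r0) ?(ltW x0) ?(ltW a0).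
apply: (le_trans (ler_wpM2r r20 hi)).
rewrite (_ : 6 * B * _ * _ = 3 * B * r^-1 * (x ^+ 6)^-1); last by field; rewrite ?xn ?rn.
rewrite (_ : 27 * _ * _ * _ = 3 * B * r^-1 * (9 * a ^+ 2 * r^-1 ^+ 3)); last by ring.
rewrite ler_wpM2l ?mulr_ge0 ?invr_ge0 ?(ltW r0)//.
rewrite exprVn ler_pdivlMr ?exprn_gt0// ler_pdivrMl//.
rewrite [r ^+ 3]exprSr (_ : x ^+ 6 * (9 * a ^+ 2) = (3 * a * x ^+ 4) * (3 * a * x ^+ 2)); last by ring.
by rewrite ler_pM ?exprn_ge0 ?(ltW r0) ?(ltW x0) ?(ltW a0).
Qed.

End radius.

Section shrinking_radius.
Variable R : realType.

(** This C^1 function, zero for t <= 0, continues the time variable Q beyond t = 0 without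
    disturbing it before. *)
Lemma is_derive_pos_sqr (t : R) :
  is_derive t 1 (fun s => Num.max s 0 ^+ 2) (2 * Num.max t 0).
Proof.
apply/is_deriveP/cvgrPdist_le => e e0; near=> h.
have h0 : h != 0 by near: h; exact: nbhs_dnbhs_neq.
have he : `|h| <= e by near: h; apply: dnbhs0_le.
rewrite scaler1.
have key : `|Num.max (h + t) 0 ^+ 2 - Num.max t 0 ^+ 2 - 2 * Num.max t 0 * h| <= h ^+ 2.
  by rewrite ler_norml; case: (leP (h + t) 0) => ?; case: (leP t 0) => ?; apply/andP; split; nra.
rewrite distrC (_ : _ - _ = h^-1 * (Num.max (h + t) 0 ^+ 2 - Num.max t 0 ^+ 2 - 2 * Num.max t 0 * h)).
  rewrite normrM normfV ler_pdivrMl ?normr_gt0// (le_trans key)//.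
  by rewrite -real_normK ?num_real// expr2 ler_wpM2l.
by field.
Unshelve. all: by end_near. Qed.

Lemma sqrt_diff (u v : R) : 0 <= u -> 0 <= v ->
  `|Num.sqrt u - Num.sqrt v| * Num.sqrt u <= `|u - v|.
Proof.
move=> u0 v0; rewrite -{3}(sqr_sqrtr u0) -{2}(sqr_sqrtr v0) subr_sqr normrM.
by rewrite ler_wpM2l// (le_trans _ (ler_norm _))// lerDl sqrtr_ge0.
Qed.

(** No differential equation is solved: rho^2 is explicit, and the desired law for - rho' holds with
    a d merely confined between two multiples of rho^-4. The functions live on the whole time line
    because the barriers must be smooth and bounded there; the law is asserted for t <= 0. *)
Lemma shrinking_radius (a b B r0 : R) : 1 <= a -> 0 < B ->
  exists (rho V : R -> R -> R) (c : R),
  [/\ forall th, `|th| = 1 ->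
    [/\ forall t : R, is_derive t 1 (rho th) (- V th t), continuous (V th),
      forall t, `|V th t| <= c, forall t, r0 <= rho th t &
      forall t, t <= 0 -> Num.sqrt (- t) <= rho th t /\
        exists2 d, V th t = a * (rho th t)^-1 + a * b * (rho th t)^-1 ^+ 3 + th * d &
          B * (rho th t)^-1 ^+ 4 <= d <= 27 * a ^+ 2 * B * (rho th t)^-1 ^+ 4],
    forall t, rho 1 t <= rho (-1) t <= rho 1 t + 48 * a * B * (rho 1 t)^-1 ^+ 2 &
    forall t, t <= 0 -> `|rho 1 t - Num.sqrt (- 2 * a * t)| <= c].
Proof.
move=> a1 B0; have a0 : 0 < a by exact: lt_le_trans a1.
have m0 : 0 < 8 * B by rewrite mulr_gt0.
have [x0 x01 alg] := radius_algebra b a1 m0.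
(* Q = K + 1 - t for t <= 0, continued to stay above K, and
   rho^2 = 2 a Q + b ln Q - 8 th B / sqrt Q. *)
pose K := x0 ^+ 4 + r0 ^+ 2.
have x04 : 1 <= x0 ^+ 4 by exact: exprn_ege1.
have K1 : 1 <= K by rewrite /K (le_trans x04)// lerDl sqr_ge0.
pose P (t : R) := Num.max t 0.
pose S (t : R) := Num.sqrt (1 + P t ^+ 2).
pose Q (t : R) := K - t + S t.
pose Q1 (t : R) := 1 - P t * (S t)^-1.
have P0 t : 0 <= P t by rewrite /P le_max lexx orbT.
have Pt t : t <= P t by rewrite /P le_max lexx.
have Sp t : 0 < 1 + P t ^+ 2 by rewrite ltr_pwDl// sqr_ge0.
have S0 t : 0 < S t by rewrite sqrtr_gt0.
have PS t : P t <= S t.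
  by rewrite -{1}(ger0_norm (P0 t)) -sqrtr_sqr ler_wsqrtr// lerDr.
have QK t : K <= Q t.
  by rewrite /Q -addrA lerDl addrC subr_ge0 (le_trans (Pt t)).
have Q0 t : 0 < Q t by apply: lt_le_trans (QK t); exact: lt_le_trans K1.
have dQ (t : R) : is_derive t 1 Q (- Q1 t).
  have d1 := is_derive_addf (is_derive_cstf t 1 1) (is_derive_pos_sqr t).
  have d2 := is_derive_chain d1 (is_derive1_sqrt (Sp t)).
  have d3 := is_derive_addf (is_derive_addf (is_derive_cstf t 1 K)
     (is_derive_scalef (-1) (@is_derive_id R R t 1))) d2.
  rewrite (_ : Q = fun s => K + -1 * s + Num.sqrt (1 + Num.max s 0 ^+ 2)); last first.
    by apply/funext => s; rewrite /Q mulN1r.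
  apply: is_derive_eq; rewrite /Q1 -/(P t) -/(S t); have s0 := lt0r_neq0 (S0 t).
  by field.
have Q11 t : `|Q1 t| <= 1.
  rewrite /Q1 ger0_norm ?subr_ge0 ?ler_pdivrMr ?mul1r//.
  by rewrite gerBl mulr_ge0// invr_ge0 ltW.
have Q1E t : t <= 0 -> Q1 t = 1 by move=> t0; rewrite /Q1 /P max_r// mul0r subr0.
have QE t : t <= 0 -> Q t = K + 1 - t.
  by move=> t0; rewrite /Q /S /P max_r// expr0n/= addr0 sqrtr1 addrAC.
pose z t := Num.sqrt (Q t).
pose x t := Num.sqrt (z t).
have z0 t : 0 < z t by rewrite sqrtr_gt0.
have zn t : z t != 0 by exact: lt0r_neq0.
have x2 t : x t ^+ 2 = z t by rewrite sqr_sqrtr// ltW.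
have z2 t : z t ^+ 2 = Q t by rewrite sqr_sqrtr// ltW.
have x4 t : x t ^+ 4 = Q t by rewrite (exprM _ 2 2) x2.
have xx0 t : x0 <= x t.
  rewrite -(@ler_pXn2r R 4) ?nnegrE ?sqrtr_ge0 ?(le_trans ler01)// x4.
  by rewrite (le_trans _ (QK t))// lerDl sqr_ge0.
have x1 t : 1 <= x t by exact: le_trans (xx0 t).
have xp t : 0 < x t by exact: lt_le_trans (x1 t).
have L04 t : 0 <= ln (Q t) <= 4 * x t.
  apply/andP; split; first by rewrite ln_ge0// (le_trans K1).
  rewrite -x4 lnXn// -[_ *+ 4]mulr_natl ler_wpM2l// ltW//; exact: ln_sublinear.
pose Y th t := 2 * a * Q t + b * ln (Q t) - th * (8 * B) * (z t)^-1.
pose rho th t := Num.sqrt (Y th t).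
pose V th t := (2 * a + b * (z t)^-1 ^+ 2 + th * (8 * B) / 2 * (z t)^-1 ^+ 3)
   * (2 * rho th t)^-1 * Q1 t.
have alg' th t : `|th| = 1 -> a * Q t <= Y th t <= 3 * a * Q t /\
    `|th * (b * (x t ^+ 4)^-1 - 2 * a * b * (Y th t)^-1)| <= 8 * B / 4 * (x t ^+ 6)^-1.
  by move=> th1; have /= := alg _ _ _ (xx0 t) (L04 t) th1; rewrite x4 x2.
have YQ th t : `|th| = 1 -> Q t <= Y th t.
  move=> th1; have [/andP[h _] _] := alg' _ t th1; apply: le_trans h.
  by rewrite -[leLHS]mul1r ler_wpM2r// ltW.
have Yp th t : `|th| = 1 -> 0 < Y th t by move=> th1; exact: lt_le_trans (YQ _ t th1).
have rho2 th t : `|th| = 1 -> rho th t ^+ 2 = Y th t by move=> th1; rewrite sqr_sqrtr// ltW// Yp.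
have rhoz th t : `|th| = 1 -> z t <= rho th t by move=> th1; rewrite ler_wsqrtr// YQ.
have z1 t : 1 <= z t by rewrite -x2 exprn_ege1.
have rhop th t : `|th| = 1 -> 0 < rho th t by move=> th1; exact: lt_le_trans (rhoz _ t th1).
have dz (t : R) := is_derive_chain (dQ t) (is_derive1_sqrt (Q0 t)).
have drho th : `|th| = 1 -> forall t : R, is_derive t 1 (rho th) (- V th t).
  move=> th1 t.
  have d1 := is_derive_scalef (2 * a) (dQ t).
  have d2 := is_derive_scalef b (is_derive_chain (dQ t) (is_derive1_ln (Q0 t))).
  have d3 := is_derive_scalef (- (th * (8 * B))) (is_derive_invf (zn t) (dz t)).
  have d4 := is_derive_addf (is_derive_addf d1 d2) d3.
  have YE : Y th = fun s => 2 * a * Q s + b * ln (Q s) + - (th * (8 * B)) * (z s)^-1.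
    by apply/funext => s; rewrite /Y mulNr.
  rewrite -YE in d4.
  have d5 := is_derive_chain d4 (is_derive1_sqrt (Yp _ t th1)).
  apply: is_derive_eq; rewrite /V -/(rho th t) -/(z t) -(z2 t).
  have rn := lt0r_neq0 (rhop _ t th1); by field; rewrite rn zn.
have cz : continuous z by move=> t; exact: is_derive_continuous (dz t).
have cP : continuous P by move=> t; apply: continuous_max; [exact: cvg_id|exact: cvg_cst].
have cS : continuous S.
  apply: (@continuous_compf R R R (fun t => 1 + P t ^+ 2) Num.sqrt); last exact: sqrt_continuous.
  apply: (@continuous_add R R R); first exact: cst_continuous.
  by apply: (@continuous_compf R R R P (fun y => y ^+ 2)) => //; exact: exprn_continuous.
have cV th : `|th| = 1 -> continuous (V th).
  move=> th1.
  have crho : continuous (rho th) by move=> t; exact: is_derive_continuous (drho _ th1 t).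
  have czV : continuous (fun t => (z t)^-1) by move=> t; apply: cvgV => //; exact: cz.
  have czn k : continuous (fun t => (z t)^-1 ^+ k).
    by apply: (@continuous_compf R R R (fun t => (z t)^-1) (fun y => y ^+ k)) => //; exact: exprn_continuous.
  have cc k : continuous (fun _ : R => k : R) by exact: cst_continuous.
  apply: continuous_mul; last first.
    apply: (@continuous_add R R R) => //; apply: continuous_opp; apply: continuous_mul => //.
    by move=> t; apply: cvgV; [exact: lt0r_neq0|exact: cS].
  apply: continuous_mul; last first.
    move=> t; apply: cvgV; first by rewrite mulf_neq0// lt0r_neq0// rhop.
    by apply: cvgM; [exact: cvg_cst|exact: crho].
  by do ?[exact: cc|exact: czn|apply: (@continuous_add R R R)|apply: continuous_mul].
pose c := 2 * a * (K + 1) + 4 * `|b| + 8 * B.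
have ziv t : 0 <= (z t)^-1 <= 1 by rewrite invr_ge0 (ltW (z0 t))/= invf_le1.
exists rho, V, c; split.
- move=> th th1; split.
  + exact: drho.
  + exact: cV.
  + move=> t; have /andP[zi0 zi1] := ziv t.
    rewrite 2!normrM -[leRHS]mulr1 ler_pM ?mulr_ge0//.
    rewrite -[leRHS]mulr1 ler_pM//; last first.
      rewrite ger0_norm ?invr_ge0 ?mulr_ge0 ?(ltW (rhop _ t th1))//.
      rewrite invf_le1 ?mulr_gt0 ?rhop//; have := rhoz _ t th1; have := z1 t; lra.
    rewrite /c (le_trans (ler_normD _ _))// lerD//.
      rewrite (le_trans (ler_normD _ _))// lerD//.
        by rewrite ger0_norm ?mulr_ge0 ?(ltW a0)// ler_peMr ?mulr_ge0 ?(ltW a0)// lerDr (le_trans ler01 K1).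
      rewrite normrM (@le_trans _ _ (`|b| * 1))// ?ler_wpM2l//; last by rewrite mulr1 ler_peMl//; lra.
      by rewrite ger0_norm ?exprn_ge0// exprn_ile1.
    rewrite normrM -[leRHS]mulr1 ler_pM//; last by rewrite ger0_norm ?exprn_ge0// exprn_ile1.
    rewrite !normrM th1 mul1r; rewrite !ger0_norm ?invr_ge0 ?ltW//; lra.
  + move=> t; rewrite (le_trans (ler_norm _))// -sqrtr_sqr ler_wsqrtr// (le_trans _ (YQ _ t th1))//.
    by rewrite (le_trans _ (QK t))// lerDr exprn_ge0// (le_trans ler01 x01).
  + move=> t t0; split.
      by rewrite (le_trans _ (rhoz _ t th1))// ler_wsqrtr// QE// lerDr; lra.
    have [hY he] := alg' _ t th1; rewrite -(rho2 _ t th1) -x4 in hY he.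
    have th2 : th ^+ 2 = 1 by rewrite -real_normK ?num_real// th1 expr1n.
    have [d dE dB] := radius_speed a1 (ltW B0) (xp t) (rhop _ t th1) th2 hY he.
    exists d => //; rewrite -dE /V Q1E// mulr1 -!x2 -!exprVn -!exprM.
    by [].
- have p1 : `|1 : R| = 1 by rewrite normr1.
  have n1 : `|-1 : R| = 1 by rewrite normrN1.
  (* The squares of the radii differ by 16 B / sqrt Q; division by rho, which is comparable to sqrt
     Q, leaves O(rho^-2). *)
  move=> t; have Yd : Y (-1) t = Y 1 t + 16 * B * (z t)^-1 by rewrite /Y; ring.
  have le : rho 1 t <= rho (-1) t.
    by rewrite ler_wsqrtr// Yd lerDl mulr_ge0 ?mulr_ge0 ?invr_ge0 ?ltW.
  rewrite le/=; have rp := rhop _ t p1.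
  have rz : rho 1 t <= 3 * a * z t.
    rewrite -(@ler_sqr R) ?nnegrE ?(ltW rp) ?mulr_ge0 ?(ltW a0) ?(ltW (z0 t))// rho2//.
    have [/andP[_ h] _] := alg' _ t p1; apply: (le_trans h).
    rewrite exprMn z2 ler_wpM2r ?(ltW (Q0 t))// expr2 ler_peMl ?mulr_ge0 ?(ltW a0)//; lra.
  rewrite -lerBlDl exprVn ler_pdivlMr ?exprn_gt0//.
  have h : (rho (-1) t - rho 1 t) * rho 1 t <= 16 * B * (z t)^-1.
    have := sqrt_diff (ltW (Yp _ t p1)) (ltW (Yp _ t n1)).
    rewrite -/(rho 1 t) -/(rho (-1) t) distrC ger0_norm ?subr_ge0// => /le_trans; apply.
    by rewrite distrC Yd addrC addKr ger0_norm// mulr_ge0 ?mulr_ge0 ?invr_ge0 ?ltW.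
  rewrite expr2 mulrA (le_trans (ler_wpM2r (ltW rp) h))//.
  rewrite mulrAC ler_pdivrMr// (_ : 48 * a * B * z t = 16 * B * (3 * a * z t)); last by ring.
  by rewrite ler_wpM2l// mulr_ge0// ltW.
- have p1 : `|1 : R| = 1 by rewrite normr1.
  move=> t t0; have rp := rhop _ t p1; have r1 := le_trans (z1 t) (rhoz _ t p1).
  have at0 : 0 <= - 2 * a * t by nra.
  rewrite -(ler_pM2r rp) (le_trans (sqrt_diff (ltW (Yp _ t p1)) at0))//.
  (* rho^2 differs from - 2 a t by a constant, a logarithm and a bounded term. Since ln Q <= 4 x <=
     4 rho, the radii differ by O(1). *)
  rewrite (_ : _ - _ = 2 * a * (K + 1) + (b * ln (Q t) - 8 * B * (z t)^-1)); last first.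
    by rewrite /Y {1}QE//; ring.
  have /andP[L0 L4] := L04 t; have /andP[zi0 zi1] := ziv t.
  have zr := rhoz _ t p1.
  have xz : x t <= z t by rewrite -x2 expr2 ler_peMl// (ltW (xp t)).
  rewrite [leRHS](_ : _ = 2 * a * (K + 1) * rho 1 t + (4 * `|b| * rho 1 t + 8 * B * rho 1 t)); last first.
    by rewrite /c; ring.
  rewrite (le_trans (ler_normD _ _))// lerD//.
    by rewrite ger0_norm ?ler_peMr// !mulr_ge0 ?(ltW a0)// addr_ge0// (le_trans ler01 K1).
  rewrite (le_trans (ler_normB _ _))// lerD//.
    rewrite normrM (ger0_norm L0) (mulrC 4) -mulrA ler_wpM2l// (le_trans L4)// ler_wpM2l//.
    exact: le_trans zr.
  rewrite normrM (gtr0_norm m0) ler_wpM2l ?(ltW m0)// ger0_norm//.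
  exact: le_trans r1.
Qed.

End shrinking_radius.

(** * Barriers *)

Section profiles.
Variable R : realType.
Local Notation k := (Num.sqrt (2 : R)).
Local Notation w := (@heteroclinic R).

Definition w1 (s : R) : R := k^-1 * sech2 s.
Definition w2 (s : R) : R := - sech2 s * w s.

Lemma is_derive_w1 (s : R) : is_derive s 1 w1 (w2 s).
Proof.
have d := is_derive_scalef k^-1 (is_derive_sech2 s).
have k0 := lt0r_neq0 (@sqrt2_gt0 R).
by apply: is_derive_eq; rewrite /w2; field.
Qed.

Lemma w1_gt0 s : 0 < w1 s.
Proof. by rewrite mulr_gt0 ?invr_gt0 ?sqrt2_gt0 ?sech2_gt0. Qed.

(** The fourth power is what [residual_bound] spends to replace 1 / rhat by 1 / rho. *)
Definition bound4 (D : R) (f : R -> R) := forall s, `|f s| * (1 + `|s|) ^+ 4 <= D.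

Lemma bound4_le D f s : bound4 D f -> `|f s| <= D.
Proof. by move=> /(_ s); apply: le_trans; rewrite ler_peMr// exprn_ege1// lerDl. Qed.

(* [f] solves f'' + (1 - 3 w^2) f = p w', the equation linearized at [w]. *)
Definition profile (D : R) (p f f1 f2 : R -> R) :=
  [/\ forall s : R, is_derive s 1 f (f1 s), forall s : R, is_derive s 1 f1 (f2 s),
      forall s, f2 s = p s * w1 s - (1 - 3 * w s ^+ 2) * f s &
      [/\ bound4 D f, bound4 D f1, bound4 D f2 & continuous f2]].

Lemma profile_le D E p f f1 f2 : D <= E -> profile D p f f1 f2 -> profile E p f f1 f2.
Proof.
move=> DE [? ? ? [h1 h2 h3 ?]]; split=> //.
by split=> // s; [apply: le_trans (h1 s) _|apply: le_trans (h2 s) _|apply: le_trans (h3 s) _].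
Qed.

Lemma profile_exists (p g : R -> R) : polyg p -> continuous p ->
  (forall s : R, is_derive s 1 g (2 * k * w s * g s + p s)) -> polyg g ->
  exists D f f1 f2, profile D p f f1 f2.
Proof.
move=> pp cp dg pg.
have [f [f1 [df df1 /(_ 4)[C1 h1] /(_ 4)[C2 h2] /(_ 4)[C3 h3]]]] := profile_of_corrector pp dg pg.
exists (`|C1| + `|C2| + `|C3|), f, f1, (fun s => p s * w1 s - (1 - 3 * w s ^+ 2) * f s).
split=> //; split=> [s|s|s|].
- by rewrite (le_trans (h1 s))// (le_trans (ler_norm _))// -addrA lerDl addr_ge0.
- by rewrite (le_trans (h2 s))// (le_trans (ler_norm _))// addrAC lerDr addr_ge0.
- by rewrite (le_trans (h3 s))// (le_trans (ler_norm _))// lerDr addr_ge0.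
have cf : continuous f by move=> s; exact: is_derive_continuous (df s).
have cw1 : continuous w1 by move=> s; exact: is_derive_continuous (is_derive_w1 s).
have cw : continuous w by move=> s; exact: is_derive_continuous (is_derive_w s).
apply: (@continuous_add R R R); first exact: continuous_mul.
apply: continuous_opp; apply: continuous_mul => //.
apply: (@continuous_add R R R); first exact: cst_continuous.
apply: continuous_opp; apply: continuous_mul; first exact: cst_continuous.
by apply: (@continuous_compf R R R w (fun y => y ^+ 2)) => //; exact: exprn_continuous.
Qed.

Lemma profiles : exists (D b : R) (f f1 f2 g g1 g2 : R -> R),
  [/\ 0 <= D, profile D id f f1 f2, profile D (fun s => b - s ^+ 2) g g1 g2,
      bound4 D w1 & bound4 D w2].
Proof.
have [g [dg pg]] := @odd_corrector R.
have [b [h [dh ph]]] := @even_corrector R.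
have cid : continuous (@id R) by move=> s; exact: cvg_id.
have [D1 [f [f1 [f2 h1]]]] := profile_exists (@polyg_id R) cid dg pg.
have cp : continuous (fun s : R => b - s ^+ 2).
  apply: (@continuous_add R R R); first exact: cst_continuous.
  by apply: continuous_opp; exact: exprn_continuous.
have pp : polyg (fun s : R => b - s ^+ 2).
  apply: polygD; first exact: polyg_cst.
  rewrite (_ : (fun s : R => _) = fun s => -1 * (s * s)); last by apply/funext => s; rewrite mulN1r expr2.
  by apply: polygM; [exact: polyg_cst|apply: polygM; exact: polyg_id].
have [D2 [q [q1 [q2 h2]]]] := profile_exists pp cp dh ph.
have [D3 h3] := decayM (@decay_sech2 R) (@polyg_cst R k^-1) 4.
have [D4 h4] := decayM (@decay_sech2 R) (@polyg_w R) 4.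
pose D := `|D1| + `|D2| + `|D3| + `|D4|.
have [e1 e2 e3 e4] : [/\ D1 <= D, D2 <= D, D3 <= D & D4 <= D].
  have := normr_ge0 D1; have := normr_ge0 D2; have := normr_ge0 D3; have := normr_ge0 D4.
  have := ler_norm D1; have := ler_norm D2; have := ler_norm D3; have := ler_norm D4.
  by rewrite /D => *; split; lra.
exists D, b, f, f1, f2, q, q1, q2; split.
- by rewrite /D !addr_ge0.
- exact: profile_le h1.
- exact: profile_le h2.
- by move=> s; rewrite (le_trans _ e3)// /w1 mulrC (mulrC k^-1) mulrC; exact: h3.
- by move=> s; rewrite (le_trans _ e4)// /w2 mulNr normrN; exact: h4.
Qed.

End profiles.

Section barrier.
Variables (R : realType) (n : nat) (a b A th D : R) (rho V : R -> R).
Variables (f f1 f2 g g1 g2 : R -> R).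
Local Notation X := ('rV[R]_n * R)%type.
Local Notation w := (@heteroclinic R).
Implicit Types p : X.

(* The barrier w(s) + a e^2 (f(s) + e g(s)) + th A e^4 with s = rhat - rho and
   e = 1 / rho; [bPs], [bPss], [bPe] are its partial derivatives in s, s s and e
   (without the last term). *)
Definition bs p : R := rhat p - rho p.2.
Definition be p : R := (rho p.2)^-1.
Definition bval p : R :=
  w (bs p) + a * be p ^+ 2 * (f (bs p) + be p * g (bs p)) + th * A * be p ^+ 4.
Definition bPs p : R := w1 (bs p) + a * be p ^+ 2 * (f1 (bs p) + be p * g1 (bs p)).
Definition bPss p : R := w2 (bs p) + a * be p ^+ 2 * (f2 (bs p) + be p * g2 (bs p)).
Definition bPe p : R := a * (2 * be p * f (bs p) + 3 * be p ^+ 2 * g (bs p)).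
Definition bF1 (o : option 'I_n) p : R :=
  if o is Some i then bPs p * rhat1 i p
  else V p.2 * bPs p + V p.2 * be p ^+ 2 * bPe p + 4 * th * A * V p.2 * be p ^+ 5.
Definition bF2 (i j : 'I_n) p : R := bPss p * rhat1 j p * rhat1 i p + bPs p * rhat2 i j p.
Definition barrier : jet R n := (bval, bF1, bF2).

Hypothesis pf : profile D id f f1 f2.
Hypothesis pg : profile D (fun s => b - s ^+ 2) g g1 g2.
Hypothesis drho : forall t : R, is_derive t 1 rho (- V t).
Hypothesis rho1 : forall t, 1 <= rho t.

Lemma rho_neq0 t : rho t != 0. Proof. exact: lt0r_neq0 (lt_le_trans ltr01 (rho1 t)). Qed.

Let ds (o : option 'I_n) p := if o is Some i then rhat1 i p else V p.2.
Let de (o : option 'I_n) p := if o is Some i then 0 else V p.2 * be p ^+ 2.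

Lemma is_derive_bs o p : is_derive p (dirv R o) bs (ds o p).
Proof.
have h := is_derive_addf (is_derive_rhat o p) (is_derive_scalef (-1) (is_derive_time o (drho p.2))).
rewrite (_ : bs = fun q => rhat q + -1 * rho q.2); last by apply/funext => q; rewrite mulN1r.
by apply: is_derive_eq; rewrite /ds; case: o {h} => [i|]; ring.
Qed.

Lemma is_derive_be o p : is_derive p (dirv R o) be (de o p).
Proof.
have h := is_derive_invf (rho_neq0 p.2) (is_derive_time o (drho p.2)).
by apply: is_derive_eq; rewrite /de /be; case: o {h} => [i|]; ring.
Qed.

Lemma is_derive_bval o p : is_derive p (dirv R o) bval (bF1 o p).
Proof.
have [df _ _ _] := pf; have [dg _ _ _] := pg.
have hs := is_derive_bs o p; have he := is_derive_be o p.
have h := is_derive_addf (is_derive_addf (is_derive_chain hs (is_derive_w _))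
  (is_derive_mulf (is_derive_scalef a (is_derive_powf 1 he))
    (is_derive_addf (is_derive_chain hs (df _)) (is_derive_mulf he (is_derive_chain hs (dg _))))))
  (is_derive_scalef (th * A) (is_derive_powf 3 he)).
apply: is_derive_eq; rewrite /bF1 /bPs /bPe /w1 /ds /de.
by case: o {h hs he} => [i|]; ring.
Qed.

Lemma is_derive_bPs i p : is_derive p (dirv R (Some i)) bPs (bPss p * rhat1 i p).
Proof.
have [_ df _ _] := pf; have [_ dg _ _] := pg.
have hs := is_derive_bs (Some i) p; have he := is_derive_be (Some i) p.
have h := is_derive_addf (is_derive_chain hs (is_derive_w1 _))
  (is_derive_mulf (is_derive_scalef a (is_derive_powf 1 he))
    (is_derive_addf (is_derive_chain hs (df _)) (is_derive_mulf he (is_derive_chain hs (dg _))))).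
by apply: is_derive_eq; rewrite /bPss /ds /de; ring.
Qed.

Lemma is_derive_bF1 i j p : is_derive p (dirv R (Some j)) (bF1 (Some i)) (bF2 i j p).
Proof.
have h := is_derive_mulf (is_derive_bPs j p) (is_derive_rhat1 i (Some j) p).
by apply: is_derive_eq.
Qed.

Lemma continuous_bs : continuous bs.
Proof.
apply: (@continuous_add R X R); first exact: continuous_rhat.
apply: continuous_opp; apply: (@continuous_compf X R R (fun p => p.2) rho).
  exact: continuous_snd.
by move=> t; exact: is_derive_continuous (drho t).
Qed.

Lemma bcx_be : bcx be.
Proof.
exists 1; split=> [p|p].
  apply: cvgV; first exact: rho_neq0.
  apply: (@continuous_compf X R R (fun p => p.2) rho); first exact: continuous_snd.
  by move=> t; exact: is_derive_continuous (drho t).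
have r0 : 0 < rho p.2 by exact: lt_le_trans (rho1 _).
by rewrite ger0_norm ?invr_ge0 ?(ltW r0)// invf_le1.
Qed.

Lemma bcx_bs (h : R -> R) (C : R) : continuous h -> (forall s, `|h s| <= C) -> bcx (fun p => h (bs p)).
Proof.
move=> ch hC; exists C; split=> [|p]; last exact: hC.
exact: (continuous_compf continuous_bs ch).
Qed.

Lemma continuous_derive (h h' : R -> R) : (forall s : R, is_derive s 1 h (h' s)) -> continuous h.
Proof. by move=> dh s; exact: is_derive_continuous (dh s). Qed.

Hypotheses (bw1 : bound4 D (@w1 R)) (bw2 : bound4 D (@w2 R)).
Hypothesis cV : continuous V.
Variable cstV : R.
Hypothesis bV : forall t, `|V t| <= cstV.

Lemma barrier_smooth : exists C, jsmooth C barrier.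
Proof.
have [df df1 _ [b0 b1 b2 cf2]] := pf; have [dg dg1 _ [c0 c1 c2 cg2]] := pg.
have cw := continuous_derive (@is_derive_w R).
have cw1 := continuous_derive (@is_derive_w1 R).
have cw2 : continuous (@w2 R).
  apply: continuous_mul => //; apply: continuous_opp; exact: continuous_derive (@is_derive_sech2 R).
have hw := bcx_bs cw (fun s => ltW (w_norm_lt1 s)).
have hw1 := bcx_bs cw1 (fun s => bound4_le s bw1).
have hw2 := bcx_bs cw2 (fun s => bound4_le s bw2).
have hf := bcx_bs (continuous_derive df) (fun s => bound4_le s b0).
have hf1 := bcx_bs (continuous_derive df1) (fun s => bound4_le s b1).
have hf2 := bcx_bs cf2 (fun s => bound4_le s b2).
have hg := bcx_bs (continuous_derive dg) (fun s => bound4_le s c0).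
have hg1 := bcx_bs (continuous_derive dg1) (fun s => bound4_le s c1).
have hg2 := bcx_bs cg2 (fun s => bound4_le s c2).
have he := bcx_be.
have hek j : bcx (fun p => be p ^+ j).
  elim: j => [|j IH]; first by rewrite (_ : (fun _ => _) = fun _ => 1) //; exact: bcx_cst.
  rewrite (_ : (fun p => _) = fun p => be p * be p ^+ j); first exact: bcx_mul.
  by apply/funext => p; rewrite exprS.
have hV : bcx (fun p : X => V p.2).
  exists cstV; split=> [|p]; last exact: bV.
  by apply: (@continuous_compf X R R (fun p => p.2) V) => //; exact: continuous_snd.
have hPs : bcx bPs by do ?[assumption|exact: hek|exact: bcx_cst|apply: bcx_mul|apply: bcx_add].
have hPss : bcx bPss by do ?[assumption|exact: hek|exact: bcx_cst|apply: bcx_mul|apply: bcx_add].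
apply: smooth_of_bcx => /=.
- by do ?[assumption|exact: hek|exact: bcx_cst|apply: bcx_mul|apply: bcx_add].
- case=> [i|]; first by apply: bcx_mul => //; exact: bcx_rhat1.
  by do ?[assumption|exact: hek|exact: bcx_cst|apply: bcx_mul|apply: bcx_add].
- move=> i j; apply: bcx_add; apply: bcx_mul => //; last exact: bcx_rhat2.
    by apply: bcx_mul => //; exact: bcx_rhat1.
  exact: bcx_rhat1.
- exact: is_derive_bval.
- exact: is_derive_bF1.
Qed.

End barrier.

Section barrier_estimates.
Variable R : realType.
Local Notation w := (@heteroclinic R).

Lemma bound4_tail (D eta : R) (f g : R -> R) : 0 < eta -> bound4 D f -> bound4 D g ->
  exists2 C, 0 <= C & forall s, `|f s| + `|g s| <= C * w1 s + eta.
Proof.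
move=> eta0 hf hg.
have D0 : 0 <= D by exact: le_trans (bound4_le 0 hf).
(* Beyond M the decay alone gives [eta]; on [-M, M] the positive minimum of w' determines C. *)
pose M := 2 * D / eta.
have M0 : 0 <= M by rewrite divr_ge0 ?mulr_ge0// ltW.
have cw : {within `[- M, M], continuous (@w1 R)}.
  by apply: continuous_subspaceT => s; exact: is_derive_continuous (is_derive_w1 s).
have MM : - M <= M by lra.
have [x _ hx] := EVT_min MM cw.
have wx := w1_gt0 x.
exists (2 * D / w1 x) => [|s]; first by apply: divr_ge0 (ltW wx); rewrite mulr_ge0.
have [sM|Ms] := leP `|s| M.
  have h : w1 x <= w1 s by apply: hx; rewrite in_itv/= -ler_norml.
  have h2 : 2 * D <= 2 * D / w1 x * w1 s.
    by rewrite -mulrA ler_peMr ?mulr_ge0// mulrC ler_pdivlMr// mul1r.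
  have := bound4_le s hf; have := bound4_le s hg; lra.
have m1 : 1 <= 1 + `|s| by rewrite lerDl.
have weak (h : R -> R) : bound4 D h -> `|h s| * (1 + `|s|) <= D.
  move=> /(_ s); apply: le_trans; rewrite ler_wpM2l//.
  by rewrite -[leLHS]expr1 ler_weXn2l.
apply: (@le_trans _ _ eta); last first.
  by rewrite lerDr; apply: mulr_ge0 (ltW (w1_gt0 s)); apply: divr_ge0 (ltW wx); rewrite mulr_ge0.
rewrite -(ler_pM2r (lt_le_trans ltr01 m1)) (@le_trans _ _ (2 * D))//.
  have := weak _ hf; have := weak _ hg; lra.
rewrite (_ : 2 * D = eta * M); last by rewrite /M [eta * _]mulrC divfK// gt_eqF.
by rewrite ler_wpM2l ?(ltW eta0)// (le_trans (ltW Ms))// lerDr.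
Qed.

Variables (a b A c D : R) (f f1 f2 g g1 g2 : R -> R).

Definition bfun (th r rho : R) : R :=
  w (r - rho) + a * rho^-1 ^+ 2 * (f (r - rho) + rho^-1 * g (r - rho)) + th * A * rho^-1 ^+ 4.

Lemma bfun_perturbation th e s : 0 <= a -> 0 <= A -> bound4 D f -> bound4 D g ->
  `|th| = 1 -> 0 <= e <= 1 ->
  `|a * e ^+ 2 * (f s + e * g s) + th * A * e ^+ 4| <= (2 * a * D + A) * e.
Proof.
move=> a0 A0 hf hg th1 /andP[e0 e1].
rewrite mulrDl; apply: normD_le.
  rewrite (_ : 2 * a * D * e = a * e * (D + D)); last by ring.
  apply: normM_le.
    by rewrite ger0_norm ?mulr_ge0 ?exprn_ge0// ler_wpM2l// -[leRHS]expr1 ler_wiXn2l.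
  apply: normD_le; first exact: bound4_le.
  by rewrite -[D in leRHS]mul1r; apply: normM_le; [rewrite ger0_norm|exact: bound4_le].
apply: normM_le; first by rewrite normrM th1 mul1r ger0_norm.
by rewrite ger0_norm ?exprn_ge0// -[leRHS]expr1 ler_wiXn2l.
Qed.

Lemma radius_shift (rho rho' : R) : 0 <= c -> 1 <= rho ->
  rho <= rho' <= rho + c * rho^-1 ^+ 2 ->
  [/\ 0 < rho^-1 <= 1, 0 <= rho'^-1 <= rho^-1 & rho^-1 - rho'^-1 <= c * rho^-1 ^+ 4].
Proof.
move=> c0 r1 /andP[h1 h2].
have r0 : 0 < rho by exact: lt_le_trans r1.
have r0' : 0 < rho' by exact: lt_le_trans h1.
have e0 : 0 < rho^-1 by rewrite invr_gt0.
have ee : rho'^-1 <= rho^-1 by rewrite lef_pV2.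
split; first by rewrite e0 invf_le1.
  by rewrite ee invr_ge0 ltW.
rewrite (_ : _ - _ = (rho' - rho) * rho^-1 * rho'^-1); last by field; rewrite !gt_eqF.
rewrite (_ : c * _ = c * rho^-1 ^+ 2 * rho^-1 * rho^-1); last by ring.
by rewrite ler_pM ?mulr_ge0 ?subr_ge0 ?invr_ge0 ?(ltW r0) ?(ltW r0')// ler_wpM2r ?(ltW e0)// lerBlDl.
Qed.

(* Moving the interface by O(e^2) costs at most eta e^4, because w' dominates the
   derivatives of the profiles on compact sets and these are small elsewhere; the
   two terms A e^4 absorb it. *)
Lemma bfun_order : 0 <= a -> 0 < A -> 0 <= c ->
  profile D id f f1 f2 -> profile D (fun s => b - s ^+ 2) g g1 g2 ->
  exists2 delta, 0 < delta & forall r rho rho', 1 <= rho -> rho^-1 <= delta ->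
    rho <= rho' <= rho + c * rho^-1 ^+ 2 -> bfun (-1) r rho' <= bfun 1 r rho.
Proof.
move=> a0 A0 c0 [df _ _ [hf hf1 _ _]] [dg _ _ [hg hg1 _ _]].
have D0 : 0 <= D by exact: le_trans (bound4_le 0 hf).
have ca0 : 0 <= c * a by rewrite mulr_ge0.
(* One half of A e^4 will pay for the displacement of the interface, through [eta]; the other half
   for the change of e inside the profiles, through [q] below. *)
pose eta := A / (2 * (c * a + 1)).
have ca1 : 0 < 2 * (c * a + 1) by lra.
have eta0 : 0 < eta by rewrite divr_gt0.
have caeta : c * a * eta <= A / 2.
  rewrite /eta mulrA ler_pdivrMr// (_ : A / 2 * _ = A * (c * a + 1)); last by field.
  by rewrite mulrC ler_wpM2l ?(ltW A0)// lerDl.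
have [C C0 hC] := bound4_tail eta0 hf1 hg1.
have aC : 0 <= a * C by rewrite mulr_ge0.
pose q := 10 * c * a * D / A.
have q0 : 0 <= q by rewrite divr_ge0 ?mulr_ge0// ltW.
have p0 : 0 < 1 + a * C + q by lra.
exists ((1 + a * C + q)^-1); first by rewrite invr_gt0.
move=> r rho rho' r1 ed h; have [/andP[e0 e1] /andP[e'0 e'e] ee'] := radius_shift c0 r1 h.
have /andP[h1 h2] := h.
rewrite /bfun; set e := rho^-1 in ed e0 e1 e'e ee' h2 *; set e' := rho'^-1 in e'0 e'e ee' *.
have e0' := ltW e0.
have ek j : 0 <= e ^+ j by rewrite exprn_ge0.
have small : e * (1 + a * C + q) <= 1 by rewrite -ler_pdivlMr// mul1r.
have ea0 : 0 <= e * (a * C) by rewrite mulr_ge0.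
have eq0 : 0 <= e * q by rewrite mulr_ge0.
have s1 : a * e ^+ 2 * C <= 1.
  apply: (@le_trans _ _ (e * (a * C))); last by move: small; rewrite !mulrDr; lra.
  rewrite (_ : a * _ * C = e ^+ 2 * (a * C)); last by ring.
  by rewrite ler_wpM2r// -[leRHS]expr1 ler_wiXn2l.
have s2 : 5 * c * a * D * e <= A / 2.
  have : e * q <= 1 by move: small; rewrite !mulrDr; lra.
  rewrite /q mulrA ler_pdivrMr// mul1r; move=> h10; lra.
(* Here e is frozen, so the mean value theorem sees only the displacement of s; [e2] and [e3]
   account for the change of e. *)
pose G (s : R) := w s + a * e ^+ 2 * (f s + e * g s).
have dG (s : R) : is_derive s 1 G (w1 s + a * e ^+ 2 * (f1 s + e * g1 s)).
  exact: is_derive_addf (is_derive_w s)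
    (is_derive_scalef _ (is_derive_addf (df s) (is_derive_scalef e (dg s)))).
have [t _ Gt] := mvt_global dG (r - rho') (r - rho).
set x := _ + t * _ in Gt.
have ge : - (a * e ^+ 2 * eta) <= w1 x + a * e ^+ 2 * (f1 x + e * g1 x).
  have fg : - (C * w1 x + eta) <= f1 x + e * g1 x.
    have : `|f1 x + e * g1 x| <= C * w1 x + eta.
      apply: le_trans (hC x); apply: normD_le => //.
      by rewrite normrM ger0_norm// ler_piMl.
    by rewrite ler_norml => /andP[].
  have := ler_wpM2l (_ : 0 <= a * e ^+ 2) fg; rewrite mulr_ge0// => /(_ isT).
  have := ler_wpM2r (ltW (w1_gt0 x)) s1.
  rewrite mul1r (_ : a * e ^+ 2 * (- _) = - (a * e ^+ 2 * C * w1 x) - a * e ^+ 2 * eta); last by ring.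
  lra.
have Gd : - (A / 2 * e ^+ 4) <= G (r - rho) - G (r - rho').
  rewrite Gt (_ : r - rho - (r - rho') = rho' - rho); last by ring.
  have d0 : 0 <= rho' - rho by rewrite subr_ge0.
  have d1 : rho' - rho <= c * e ^+ 2 by rewrite lerBlDl.
  apply: le_trans (ler_wpM2r d0 ge).
  rewrite mulNr lerN2 (@le_trans _ _ (a * e ^+ 2 * eta * (c * e ^+ 2)))//.
    by apply: ler_wpM2l d1; rewrite mulr_ge0 ?(ltW eta0)// mulr_ge0.
  rewrite (_ : _ * (c * _) = c * a * eta * e ^+ 4); last by ring.
  by rewrite ler_wpM2r.
have e2 : `|a * (e ^+ 2 - e' ^+ 2) * f (r - rho')| <= 2 * c * a * D * e ^+ 5.
  rewrite (_ : 2 * c * _ * _ * _ = a * (c * e ^+ 4 * (2 * e)) * D); last by ring.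
  apply: normM_le; last exact: bound4_le.
  rewrite subr_sqr ger0_norm ?mulr_ge0 ?subr_ge0 ?addr_ge0// ler_wpM2l// ler_pM ?subr_ge0 ?addr_ge0//.
  by rewrite mulr2n mulrDl mul1r lerD.
have e3 : `|a * (e ^+ 3 - e' ^+ 3) * g (r - rho')| <= 3 * c * a * D * e ^+ 5.
  rewrite (_ : 3 * c * _ * _ * _ = a * (c * e ^+ 4 * (3 * e)) * D); last by ring.
  apply: normM_le; last exact: bound4_le.
  rewrite (_ : e ^+ 3 - _ = (e - e') * (e ^+ 2 + e * e' + e' ^+ 2)); last by ring.
  rewrite ger0_norm ?mulr_ge0 ?subr_ge0 ?addr_ge0 ?mulr_ge0 ?exprn_ge0//.
  rewrite ler_wpM2l// ler_pM ?subr_ge0 ?addr_ge0 ?mulr_ge0 ?exprn_ge0//.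
  have e'1 : e' <= 1 by exact: le_trans e1.
  by nra.
have e5 : 5 * c * a * D * e ^+ 5 <= A / 2 * e ^+ 4.
  by rewrite exprS mulrA ler_wpM2r.
have e'4 : 0 <= A * e' ^+ 4 by rewrite mulr_ge0 ?(ltW A0)// exprn_ge0.
rewrite -subr_ge0 (_ : _ - _ = (G (r - rho) - G (r - rho')) + a * (e ^+ 2 - e' ^+ 2) * f (r - rho')
  + a * (e ^+ 3 - e' ^+ 3) * g (r - rho') + A * e ^+ 4 + A * e' ^+ 4); last first.
  by rewrite /G; ring.
move: e2 e3; rewrite !ler_norml => /andP[e2 _] /andP[e3 _].
move: Gd e2 e3 e5 e'4.
by set y := e ^+ 5; set z := A * e ^+ 4; rewrite (_ : A / 2 * e ^+ 4 = z / 2); [lra|rewrite /z; field].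
Qed.

(** Three errors are added: the shift of the interface, the passage from [rhat] to |x|, and the
    corrections. The second is delicate near the origin, where rhat - |x| is not small; but there
    the interface is far away, 1 / rhat is at most 2 (1 + |x|) / rho with x the argument of w', and
    the decay of w' absorbs the factor. *)
Lemma bfun_near_w : 0 <= a -> 0 <= A -> 0 <= c -> bound4 D f -> bound4 D g -> bound4 D (@w1 R) ->
  exists C, forall th r re rho rho', `|th| = 1 -> 1 <= rho ->
    rho <= rho' <= rho + c * rho^-1 ^+ 2 -> 1 <= r -> 0 <= r - re <= r^-1 ->
    `|bfun th r rho' - w (re - rho)| <= C * rho^-1.
Proof.
move=> a0 A0 c0 hf hg hw; exists (D * c + 2 * D + (2 * a * D + A)).
move=> th r re rho rho' th1 r1 h rr /andP[d0 d1].
have [/andP[e0 e1] /andP[e'0 e'e] ee'] := radius_shift c0 r1 h.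
have /andP[h1 h2] := h.
have D0 : 0 <= D by exact: le_trans (bound4_le 0 hf).
have rp : 0 < r by exact: lt_le_trans rr.
have rhop : 0 < rho by exact: lt_le_trans r1.
rewrite /bfun (_ : _ - _ = (w (r - rho') - w (r - rho)) + (w (r - rho) - w (re - rho))
  + (a * rho'^-1 ^+ 2 * (f (r - rho') + rho'^-1 * g (r - rho')) + th * A * rho'^-1 ^+ 4)); last by ring.
rewrite [leRHS]mulrDl [(_ + 2 * D) * _]mulrDl.
have cw := @is_derive_w R.
apply: normD_le; first apply: normD_le.
- have [t _ ->] := mvt_global cw (r - rho) (r - rho').
  rewrite -mulrA; apply: normM_le; first exact: bound4_le hw.
  rewrite (_ : r - rho' - (r - rho) = rho - rho'); last by ring.
  rewrite distrC ger0_norm ?subr_ge0// (@le_trans _ _ (c * rho^-1 ^+ 2)) ?lerBlDl//.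
  by rewrite ler_wpM2l// -[leRHS]expr1 ler_wiXn2l ?(ltW e0).
- have [t /andP[t0 t1] ->] := mvt_global cw (re - rho) (r - rho).
  set x := _ + t * _; rewrite (_ : r - rho - (re - rho) = r - re); last by ring.
  have hx : `|r - rho - x| <= 1.
    rewrite (_ : _ - x = (1 - t) * (r - re)); last by rewrite /x; ring.
    rewrite -[leRHS]mulr1; apply: normM_le; first by rewrite ler_norml; apply/andP; split; lra.
    by rewrite ger0_norm// (le_trans d1)// invf_le1.
  have hr : r^-1 <= rho^-1 * (2 * (1 + `|x|)).
    rewrite -ler_pdivrMl ?invr_gt0// invrK ler_pdivrMr//.
    have : `|r - rho| <= 1 + `|x|.
      by rewrite -[r - rho](subrK x) (le_trans (ler_normD _ _))// lerD.
    have := normr_ge0 x; rewrite ler_norml; move=> nx /andP[k1 k2]; nra.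
  have := hw x; rewrite (ger0_norm (ltW (w1_gt0 x))) => hwx.
  have hw1 : w1 x * (1 + `|x|) <= D.
    apply: le_trans hwx; rewrite ler_wpM2l ?(ltW (w1_gt0 x))// -[leLHS]expr1 ler_weXn2l//.
    by rewrite lerDl.
  rewrite normrM (ger0_norm (ltW (w1_gt0 x))) (ger0_norm d0).
  apply: (@le_trans _ _ (w1 x * (rho^-1 * (2 * (1 + `|x|))))).
    by rewrite ler_wpM2l ?(ltW (w1_gt0 x))// (le_trans d1).
  rewrite (_ : w1 x * _ = 2 * (w1 x * (1 + `|x|)) * rho^-1); last by ring.
  by rewrite ler_wpM2r ?(ltW e0)// ler_wpM2l.
- apply: (@le_trans _ _ ((2 * a * D + A) * rho'^-1)).
    by apply: bfun_perturbation => //; rewrite e'0 (le_trans e'e).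
  by rewrite ler_wpM2l// addr_ge0// !mulr_ge0.
Qed.

End barrier_estimates.

(** * Conclusion *)

Section uniform_decay.
Variables (R : realType) (T : choiceType).

Lemma uniform_cvg0_ninfty (C : R) (phi : T -> R -> R) :
  (forall x t, t < 0 -> `|phi x t| <= C / Num.sqrt (- t)) ->
  {uniform, (fun (t : R) (x : T) => phi x t) @ -oo_R --> (cst 0 : T -> R)}.
Proof.
move=> hC P /uniform_nbhs[E [entE EP]].
have [e /= e0 eE] : exists2 e : R, 0 < e & forall x y : R, `|x - y| < e -> E (x, y).
  by move: entE; rewrite -entourage_ballE => -[e e0 eE]; exists e => // x y xy; exact: eE.
have e1 : 0 < (`|C| + 1) / e by rewrite divr_gt0.
near=> t.
have t0 : t < 0 by near: t; exact: nbhs_ninfty_lt.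
have tM : t <= - ((`|C| + 1) / e) ^+ 2 by near: t; apply: nbhs_ninfty_le; exact: num_real.
apply: EP => x _ /=; apply: eE; rewrite sub0r normrN.
have s0 : 0 < Num.sqrt (- t) by rewrite sqrtr_gt0 oppr_gt0.
have sM : (`|C| + 1) / e <= Num.sqrt (- t).
  by rewrite -[leLHS]gtr0_norm// -sqrtr_sqr ler_wsqrtr// lerNr.
apply: (le_lt_trans (hC x t t0)); rewrite ltr_pdivrMr//.
apply: (@lt_le_trans _ _ (`|C| + 1)); first by rewrite (le_lt_trans (ler_norm _))// ltrDl.
by rewrite mulrC -ler_pdivrMr.
Unshelve. all: by end_near. Qed.

End uniform_decay.

Section final.
Variables (R : realType) (n : nat).
Local Notation X := ('rV[R]_n * R)%type.
Local Notation k := (Num.sqrt (2 : R)).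
Local Notation w := (@heteroclinic R).

Lemma jsmooth_le C C' (s : jet R n) : C <= C' -> jsmooth C s -> jsmooth C' s.
Proof.
move=> CC' [h h1 h2 d d1]; split=> //; first exact: bcW h.
  by move=> i; exact: bcW (h1 i).
by move=> i j; exact: bcW (h2 i j).
Qed.

(** The terms 11 u cancel, and the Allen-Cahn residual appears in the shape of [residual_bound],
    with eta = 1 - |grad rhat|^2 and l the Laplacian of [rhat]. *)
Lemma barrier_residual a A th (rho V f f1 f2 g g1 g2 : R -> R) (p : X) :
  let s := barrier n a A th rho V f f1 f2 g g1 g2 in
  let e := be rho p in let x := bs rho p in let v := V p.2 in
  heatop s.1.1 s.1.2 (fun i => s.2 i i) p - nl (s.1.1 p) =
  v * (w1 x + a * e ^+ 2 * (f1 x + e * g1 x))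
  + v * e ^+ 2 * (a * (2 * e * f x + 3 * e ^+ 2 * g x)) + 4 * th * A * v * e ^+ 5
  - (1 - (1 - \sum_i rhat1 i p ^+ 2)) * (w2 x + a * e ^+ 2 * (f2 x + e * g2 x))
  - (\sum_i rhat2 i i p) * (w1 x + a * e ^+ 2 * (f1 x + e * g1 x))
  - (s.1.1 p - s.1.1 p ^+ 3).
Proof.
move=> s e x v.
rewrite /heatop /nl /=.
rewrite (_ : \sum_i bF2 _ _ _ _ _ _ i i p = bPss a rho f2 g2 p * (\sum_i rhat1 i p ^+ 2)
   + bPs a rho f1 g1 p * \sum_i rhat2 i i p); last first.
  rewrite !mulr_sumr -big_split/=; apply: eq_bigr => i _.
  by rewrite /bF2 -mulrA -expr2.
rewrite /bF1 /bPss /bPs /bPe -/e -/x -/v; ring.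
Qed.

(* 3 sqrt 2 A w' + A (3 w^2 - 1) = 2 A: the speed correction makes up for the sign
   change of the linearized reaction near the interface. *)
Lemma reaction_balance (A wx th N e d w1x CE CAB : R) : 0 <= CE -> A = CE + 1 ->
  w1x = k^-1 * (1 - wx ^+ 2) -> 0 <= w1x -> th ^+ 2 = 1 -> 0 <= e -> e * CAB <= 1 ->
  3 * k * A * e ^+ 4 <= d ->
  `|N - th * (d * w1x + A * e ^+ 4 * (3 * wx ^+ 2 - 1))| <= (CE + e * CAB) * e ^+ 4 ->
  `|th| = 1 -> 0 <= th * N.
Proof.
move=> CE0 AE w1E w10 th2 e0 eC hd hN th1.
have e4 : 0 <= e ^+ 4 by exact: exprn_ge0.
have k0 := lt0r_neq0 (@sqrt2_gt0 R).
have hX : 2 * A * e ^+ 4 <= d * w1x + A * e ^+ 4 * (3 * wx ^+ 2 - 1).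
  apply: (@le_trans _ _ (3 * k * A * e ^+ 4 * w1x + A * e ^+ 4 * (3 * wx ^+ 2 - 1))).
    by rewrite le_eqVlt; apply/orP; left; apply/eqP; rewrite w1E; field.
  by rewrite lerD2r ler_wpM2r.
move: hX hN; set Z := d * w1x + _ => hX hN.
have : `|th * N - Z| <= (CE + 1) * e ^+ 4.
  rewrite (_ : th * N - Z = th * (N - th * Z)); last by rewrite mulrBr mulrA -expr2 th2 mul1r.
  by rewrite normrM th1 mul1r (le_trans hN)// ler_wpM2r// lerD2l.
rewrite -AE ler_norml => /andP[h _].
have A0 : 0 <= A * e ^+ 4 by rewrite mulr_ge0// AE addr_ge0.
lra.
Qed.

End final.

Theorem theorem1p1 (R : realType) (n : nat) (hn : (2 <= n)%N) :
  exists (u : 'rV[R]_n -> R -> R) (rho : R -> R) (phi : 'rV[R]_n -> R -> R),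
    [/\ (forall t : R, t <= 0 -> radially_symmetric (u ^~ t)),
        ancient_allen_cahn u,
        (exists C : R, \forall t \near -oo_R,
          `|rho t - Num.sqrt (- 2 * (n%:R - 1) * t)| <= C),
        (forall (x : 'rV[R]_n) (t : R), t <= 0 ->
          u x t = heteroclinic (enorm x - rho t) + phi x t) &
        {uniform, (fun (t : R) (x : 'rV[R]_n) => phi x t) @ -oo_R
          --> (cst 0 : 'rV[R]_n -> R)}].
Proof.
pose X := ('rV[R]_n * R)%type.
pose k : R := Num.sqrt 2.
have k0 : 0 < k by exact: sqrt2_gt0.
have [D [b [f [f1 [f2 [g [g1 [g2 [D0 pf pg bw1 bw2]]]]]]]]] := profiles R.
have [_ _ f2E [bf bf1 bf2 _]] := pf; have [_ _ g2E [bg bg1 bg2 _]] := pg.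
pose a : R := n%:R - 1.
have a1 : 1 <= a by rewrite /a lerBrDr; have -> : 1 + 1 = 2%:R :> R by []; rewrite ler_nat.
have a0 : 0 <= a by exact: le_trans a1.
have c0 : 0 <= n%:R + 11 :> R by [].
have [CE CE0 HCE] := residual_bound b a0 c0 D0.
(* The unit added to [CE] absorbs [e * CAB]. B is the speed correction demanded by
   [reaction_balance], and 27 a^2 B the upper bound on d supplied by [shrinking_radius]. *)
pose A := CE + 1; have A0 : 0 < A by rewrite ltr_wpDl.
pose B := 3 * k * A; have B0 : 0 < B by rewrite !mulr_gt0.
have B'0 : 0 <= 27 * a ^+ 2 * B by rewrite mulr_ge0 ?(ltW B0)// mulr_ge0// exprn_ge0.
have [CAB CAB0 {}HCE] := HCE _ _ (ltW A0) B'0.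
pose c := 48 * a * B; have cc0 : 0 <= c by rewrite mulr_ge0 ?(ltW B0)// mulr_ge0.
have [delta delta0 order] := bfun_order a0 A0 cc0 pf pg.
have [Cn near_w] := bfun_near_w a0 (ltW A0) cc0 bf bg bw1.
pose M := 2 * a * D + A; have M0 : 0 <= M by rewrite addr_ge0 ?(ltW A0)// !mulr_ge0.
(* A single lower bound on the radius ensures the ordering, [e * CAB <= 1] and the bound 2 at all
   times, so that the barriers are valid up to t = 0. *)
pose r0 := 1 + delta^-1 + CAB + M.
have [rho [V [cst_ [Hrho rho_order rho_asym]]]] := shrinking_radius b r0 a1 B0.
have p1 : `|1 : R| = 1 by rewrite normr1.
have n1 : `|-1 : R| = 1 by rewrite normrN1.
have di0 : 0 < delta^-1 by rewrite invr_gt0.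
have rho_large th t : `|th| = 1 ->
    [/\ 1 <= rho th t, (rho th t)^-1 <= delta, (rho th t)^-1 * CAB <= 1 & M * (rho th t)^-1 <= 1].
  move=> th1; have [_ _ _ /(_ t) h _] := Hrho th th1.
  have [h1 h2 h3 h4] : [/\ 1 <= rho th t, delta^-1 <= rho th t, CAB <= rho th t & M <= rho th t].
    by move: h di0 CAB0 M0; rewrite /r0 => h d0 ? ?; split; lra.
  have rp : 0 < rho th t by exact: lt_le_trans h1.
  split=> //; first by rewrite -[delta]invrK lef_pV2// posrE.
    by rewrite mulrC ler_pdivrMr// mul1r.
  by rewrite ler_pdivrMr// mul1r.
pose s th : jet R n := barrier n a A th (rho th) (V th) f f1 f2 g g1 g2.
have sE th p : (s th).1.1 p = bfun a A f g th (rhat p) (rho th p.2) by [].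
have e01 th t : `|th| = 1 -> 0 < (rho th t)^-1 <= 1.
  move=> th1; have [h1 _ _ _] := rho_large th t th1.
  have rp : 0 < rho th t by exact: lt_le_trans h1.
  by rewrite invr_gt0 rp invf_le1.
have smooth_s th : `|th| = 1 -> exists C, jsmooth C (s th).
  move=> th1; have [d1 d2 d3 _ _] := Hrho th th1.
  have r1 t : 1 <= rho th t by have [] := rho_large th t th1.
  exact: (barrier_smooth n a A th pf pg d1 r1 bw1 bw2 d2 d3).
have s_le2 th p : `|th| = 1 -> `|(s th).1.1 p| <= 2.
  move=> th1; rewrite sE /bfun -addrA (_ : 2 = 1 + 1)//.
  apply: normD_le; first by rewrite ltW// w_norm_lt1.
  have [_ _ _ h] := rho_large th p.2 th1; apply: le_trans h.
  apply: (@bfun_perturbation _ a A D f g) => //; first exact: ltW.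
  by have /andP[h1 h2] := e01 _ p.2 th1; rewrite ltW.
have res th p : `|th| = 1 -> p.2 <= 0 -> 0 <= th *
    (heatop (s th).1.1 (s th).1.2 (fun i => (s th).2 i i) p - nl ((s th).1.1 p)).
  move=> th1 t0; have [_ _ _ _ /(_ _ t0)[_ [d VE /andP[d1 d2]]]] := Hrho th th1.
  have [r1 _ eC _] := rho_large th p.2 th1.
  have rp : 0 < rho th p.2 by exact: lt_le_trans r1.
  have d0 : 0 <= d.
    by apply: le_trans d1; rewrite mulr_ge0 ?(ltW B0)// exprn_ge0// invr_ge0 ltW.
  rewrite /s barrier_residual.
  apply: (@reaction_balance _ A (heteroclinic (bs (rho th) p)) _ _ (be (rho th) p) d
    (w1 (bs (rho th) p)) CE CAB) => //.
  - exact: ltW (w1_gt0 _).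
  - by rewrite -real_normK ?num_real// th1 expr1n.
  - by rewrite invr_ge0 ltW.
  rewrite VE; apply: (HCE _ (rhat_inv p) (bs (rho th) p)) => //.
  - exact: e01.
  - by rewrite rhat_inv_gt0 rhat_inv_le1.
  - rewrite /bs /be /rhat_inv; have := lt0r_neq0 rp; have := rhat_neq0 p.
    by move=> h1 h2; field; rewrite h1.
  - exact: ltW (w_norm_lt1 _).
  - exact: rhat_laplacian.
  - rewrite (le_trans (rhat_gradient p))// ler_wpM2r ?exprn_ge0 ?(ltW (rhat_inv_gt0 p))//.
    by have : 0 <= n%:R :> R by []; lra.
  - by rewrite d0.
have [C1 sm1] := smooth_s 1 p1; have [C2 sm2] := smooth_s (-1) n1.
have {}sm1 := jsmooth_le (ler_norm C1) sm1; have {}sm2 := jsmooth_le (ler_norm C2) sm2.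
have {}sm1 : jsmooth (`|C1| + `|C2|) (s 1) by apply: jsmooth_le sm1; rewrite lerDl.
have {}sm2 : jsmooth (`|C1| + `|C2|) (s (-1)) by apply: jsmooth_le sm2; rewrite lerDr.
have [] := ancient_solution sm1 (fun p => s_le2 1 p p1) (smooth_c21 sm2) (fun p => s_le2 (-1) p n1).
- by move=> p t0; have := res 1 p p1 t0; rewrite mul1r subr_ge0.
- by move=> p t0; have := res (-1) p n1 t0; rewrite mulN1r opprB subr_ge0.
- move=> p _; rewrite !sE; have [h1 h2 _ _] := rho_large 1 p.2 p1.
  exact: order (rho_order _).
- by move=> x y t xy; rewrite !sE (rhat_radial t xy).
move=> u [u_rad u_sol u_bd].
(* The radius of the supersolution is chosen; the interface of the subsolution lies within O(rho^-2)
   of it, so both barriers are compared with the same w. *)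
exists u, (rho 1), (fun x t => u x t - heteroclinic (enorm x - rho 1 t)); split=> //.
- exists cst_; near=> t; apply: rho_asym; near: t; apply: nbhs_ninfty_le; exact: num_real.
- by move=> x t t0; rewrite addrC subrK.
apply: (@uniform_cvg0_ninfty _ _ `|Cn|) => x t t0.
have [r1 _ _ _] := rho_large 1 t p1.
have rp : 0 < rho 1 t by exact: lt_le_trans r1.
have rs : Num.sqrt (- t) <= rho 1 t.
  by have [_ _ _ _ /(_ _ (ltW t0))[]] := Hrho 1 p1.
have st : 0 < Num.sqrt (- t) by rewrite sqrtr_gt0 oppr_gt0.
apply: (@le_trans _ _ (`|Cn| * (rho 1 t)^-1)); last by rewrite ler_wpM2l// lef_pV2.
apply: (@le_trans _ _ (Cn * (rho 1 t)^-1)); last first.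
  by rewrite ler_wpM2r ?ler_norm// invr_ge0 ltW.
have rr0 : rho 1 t <= rho 1 t <= rho 1 t + c * (rho 1 t)^-1 ^+ 2.
  by rewrite lexx lerDl mulr_ge0// exprn_ge0// invr_ge0 ltW.
have hi := near_w 1 _ _ _ _ p1 r1 rr0 (rhat_ge1 (x, t)) (rhat_enorm (x, t)).
have lo := near_w (-1) _ _ _ _ n1 r1 (rho_order t) (rhat_ge1 (x, t)) (rhat_enorm (x, t)).
have /andP[u1 u2] := u_bd x t (ltW t0); rewrite !sE/= in u1 u2.
move: hi lo; rewrite !ler_norml/= => /andP[_ hi] /andP[lo _].
by apply/andP; split; lra.
Unshelve. all: by end_near. Qed.
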